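(* Suppose Assumption 1 (path realization) and Assumption 2 (additivity along the core, $\mathcal H_\kappa=\mathcal A(\gamma)$) hold, and consider the Gaussian-shift experiment described in the context, with target $\tau(h)=\langle\tilde\psi_\kappa,h_\kappa\rangle+\gamma(h_\perp)$. Let $\ell:\mathbb R\to[0,+\infty]$ be bowl-shaped and lower semicontinuous. Put $\ell_\kappa(c):=\mathbb E\,\ell(c+G)$ for $G\sim N(0,V_\kappa)$; this loss is again bowl-shaped and lower semicontinuous, and $\ell_\kappa(c)=c^2+V_\kappa$ for squared error. For nonempty $B\subseteq\mathcal H_\kappa^\perp\cap\mathcal T$, define $$\mathcal M_\ell(B):=\inf_T\sup_{h\in\mathcal H_\kappa\times B}\mathbb E_h\,\ell(T-\tau(h)),\qquad \mathcal N_\ell(B):=\inf_U\sup_{h_\perp\in B}\mathbb E_{h_\perp}\,\ell_\kappa(U(Z_\perp)-\gamma(h_\perp)),$$ where the infima are over randomized rules in the respective experiments ($T$ based on $Z$, $U$ based on $Z_\perp$). Then $\mathcal M_\ell(B)=\mathcal N_\ell(B)$.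
   Context: A loss is bowl-shaped if it is nonnegative, symmetric, and nondecreasing in the magnitude of its argument. Model. $P$ is a fixed element of a set $\mathcal P$ of probability measures; $L_2^0(P)$ is the mean-zero subspace of $L_2(P)$ with inner product $\langle\cdot,\cdot\rangle$. A DQM path with score $h$ is a map $t\mapsto P_t\in\mathcal P$, $t\in[0,\varepsilon)$, $P_0=P$, with $\int[(dP_t^{1/2}-dP^{1/2})/t-\tfrac12h\,dP^{1/2}]^2\to0$ as $t\downarrow0$. The tangent space $\mathcal T\subseteq L_2^0(P)$ is a linear subspace. Assumption 1: $\mathcal T$ is closed in $L_2(P)$ and every $h\in\mathcal T$ is the score of some DQM path in $\mathcal P$. $\gamma:\mathcal T\to\mathbb R$ is the positively homogeneous directional derivative of $\Psi:\mathcal P\to\mathbb R$ at $P$: $t^{-1}\{\Psi(P_t)-\Psi(P)\}\to\gamma(h)$ as $t\downarrow0$ for every $h\in\mathcal T$ and every DQM path with score $h$; $\gamma$ is then continuous. $N(\gamma):=\{h\in\mathcal T:\gamma(h)+\gamma(-h)=0\}$. Core: $\mathcal H_\kappa:=\{w\in N(\gamma):\gamma(v+cw)=\gamma(v)+c\gamma(w)\ \forall v\in N(\gamma),c\in\mathbb R\}$, a closed linear subspace on which $\gamma$ is linear. Additivity space: $\mathcal A(\gamma):=\{w\in\mathcal T:\gamma(h+w)=\gamma(h)+\gamma(w)\ \forall h\in\mathcal T\}$. Assumption 2: $\mathcal H_\kappa=\mathcal A(\gamma)$. $\tilde\psi_\kappa\in\mathcal H_\kappa$ is the Riesz representer of $\gamma|_{\mathcal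 H_\kappa}$ and $V_\kappa:=\|\tilde\psi_\kappa\|^2$. Write $h=h_\kappa+h_\perp$ with $h_\kappa\in\mathcal H_\kappa$, $h_\perp\in\mathcal H_\kappa^\perp\cap\mathcal T$; $h\in\mathcal H_\kappa\times B$ means $h_\kappa\in\mathcal H_\kappa$, $h_\perp\in B$. Experiment. $\Delta$ is the isonormal process on $\mathcal T$ (centred Gaussian, $\operatorname{Cov}(\Delta(g),\Delta(g'))=\langle g,g'\rangle$). Under $h\in\mathcal T$ one observes $Z=\Delta+\langle h,\cdot\rangle$ (a process indexed by $\mathcal T$); $Z=(Z_\kappa,Z_\perp)$ are its restrictions to $\mathcal H_\kappa$ and $\mathcal H_\kappa^\perp\cap\mathcal T$, independent Gaussian shifts indexed by $h_\kappa$ and $h_\perp$. Randomized rules are real-valued measurable functions of the observation and independent auxiliary randomization. *)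

(* Defs.v *)
From HB Require Import structures.
From mathcomp Require Import all_boot all_order all_algebra.
From mathcomp Require Import all_classical all_reals all_analysis.
Import Order.TTheory GRing.Theory Num.Theory.
Import numFieldNormedType.Exports.

Set Implicit Arguments.
Unset Strict Implicit.
Unset Printing Implicit Defensive.

Local Open Scope classical_set_scope.
Local Open Scope ring_scope.

(* Square-integrable functions, not quotiented by P-almost-everywhere equality
   (the quotient LspaceType carries no vector space structure).  Sets that are
   closed for the L_2 seminorm are automatically saturated for a.e. equality,
   so they correspond to the closed subsets of the quotient. *)
Notation L2 P := (LfunType P (lee1n 2)).

Section SquareIntegrable.
Context {d : measure_display} {X : measurableType d} {R : realType}.
Variable P : probability X R.

Definition inner (f g : L2 P) : R := \int[P]_x (f x * g x).

Definition mean_zero (S : set (L2 P)) : Prop :=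
  forall f, S f -> ('E_P[f] = 0)%E.

Definition linear_subspace (S : set (L2 P)) : Prop :=
  S 0 /\ forall (a : R) (f g : L2 P), S f -> S g -> S (a *: f + g).

Definition L2_closed (S : set (L2 P)) : Prop :=
  forall (u : nat -> L2 P) (f : L2 P), (forall n, S (u n)) ->
    'N[P]_2%:E[EFin \o (u n - f)%R]%E @[n --> \oo] --> 0%E -> S f.

Definition orthocomplement (S W : set (L2 P)) : set (L2 P) :=
  [set h | S h /\ forall w, W w -> inner h w = 0].

End SquareIntegrable.

Section LocalModel.
Context {d : measure_display} {X : measurableType d} {R : realType}.

Definition is_density (mu : {measure set X -> \bar R}) (f : X -> R)
    (Q : probability X R) : Prop :=
  [/\ measurable_fun setT f, forall x, 0 <= f x &
    forall A, measurable A -> Q A = (\int[mu]_(x in A) (f x)%:E)%E].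

Variables (PP : set (probability X R)) (P : probability X R).

(* For each t, the integral over dP_t^{1/2} and dP^{1/2} is written with
   densities with respect to some sigma-finite measure mu_t dominating P_t and
   P; its value does not depend on the choice of mu_t.  The values of Pt outside
   [0, eps) are irrelevant. *)
Definition dqm_path (h : X -> R) (Pt : R -> probability X R) : Prop :=
  exists eps : R, [/\ 0 < eps, Pt 0 = P,
    forall t, 0 <= t < eps -> PP (Pt t) &
    exists (mu : R -> {sigma_finite_measure set X -> \bar R})
           (q p : R -> X -> R),
      (forall t, 0 < t < eps ->
         is_density (mu t) (q t) (Pt t) /\ is_density (mu t) (p t) P) /\
      (\int[mu t]_x (((Num.sqrt (q t x) - Num.sqrt (p t x)) / t
                       - 2^-1 * h x * Num.sqrt (p t x)) ^+ 2)%:E)%E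
        @[t --> 0^'+] --> 0%E].

Definition directional_derivative (TT : set (L2 P))
    (Psi : probability X R -> R) (gamma : L2 P -> R) : Prop :=
  forall (h : L2 P) (Pt : R -> probability X R), TT h -> dqm_path h Pt ->
    t^-1 * (Psi (Pt t) - Psi P) @[t --> 0^'+] --> gamma h.

Definition path_realization (TT : set (L2 P)) : Prop :=
  L2_closed TT /\ forall h : L2 P, TT h -> exists Pt, dqm_path h Pt.

End LocalModel.

Section Core.
Context {d : measure_display} {X : measurableType d} {R : realType}.
Context {P : probability X R}.
Variables (TT : set (L2 P)) (gamma : L2 P -> R).

Definition antisymmetry_set : set (L2 P) :=
  [set h | TT h /\ gamma h + gamma (- h) = 0].

Definition core : set (L2 P) :=
  [set w | antisymmetry_set w /\
     forall (v : L2 P) (c : R), antisymmetry_set v ->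
       gamma (v + c *: w) = gamma v + c * gamma w].

Definition additivity_space : set (L2 P) :=
  [set w | TT w /\ forall h, TT h -> gamma (h + w) = gamma h + gamma w].

Definition riesz_representer (W : set (L2 P)) (psi : L2 P) : Prop :=
  W psi /\ forall w, W w -> gamma w = inner psi w.

End Core.

Section Loss.
Context {R : realType}.

Definition bowl_shaped (l : R -> \bar R) : Prop :=
  [/\ forall x, (0 <= l x)%E, forall x, l (- x) = l x &
    forall x y, `|x| <= `|y| -> (l x <= l y)%E].

(* N(0, v); the library's normal_prob with standard deviation 0 is the uniform
   law on [0, 1], so the degenerate case is treated separately. *)
Definition centred_normal (v : R) : probability (measurableTypeR R) R :=
  if v == 0 then (\d_(0 : measurableTypeR R) : probability _ R)
  else (normal_prob 0 (Num.sqrt v) : probability _ R).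

Definition smoothed_loss (l : R -> \bar R) (v : R) (c : R) : \bar R :=
  (\int[centred_normal v]_g l (c + g)%R)%E.

End Loss.

Section PathSpace.
Context {R : realType} {I : Type}.

(* R^S with the sigma-algebra generated by the coordinate projections. *)
Definition coordinate_cylinders (S : set I) : set (set (S -> R)) :=
  [set C | exists (i : S) (A : set R), measurable A /\ C = [set z | A (z i)]].

Definition path_space (S : set I) : measurableType _ :=
  g_sigma_algebraType (@coordinate_cylinders S).

End PathSpace.
Arguments path_space R {I} S.

Section Experiment.
Context {d : measure_display} {X : measurableType d} {R : realType}.
Context {P : probability X R}.
Context {d' : measure_display} {Omega : measurableType d'}.
Variables (Q : probability Omega R) (Delta : L2 P -> Omega -> R).

(* Only the variables Delta g with g in TT matter. *)
Definition isonormal (TT : set (L2 P)) : Prop :=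
  [/\ forall g, TT g -> measurable_fun setT (Delta g),
    (forall (n : nat) (g : 'I_n -> L2 P) (c : 'I_n -> R),
       (forall i, TT (g i)) ->
       exists2 v : R, 0 <= v & forall A, measurable A ->
         Q [set w | A (\sum_i c i * Delta (g i) w)] = centred_normal v A) &
    forall g g', TT g -> TT g' ->
      covariance Q (Delta g) (Delta g') = (inner g g')%:E].

(* The restriction to S of Z = Delta + <h, .>. *)
Definition observation (S : set (L2 P)) (h : L2 P) (w : Omega)
  : path_space R S := fun g : S => Delta (\val g) w + inner h (\val g).

Definition risk (S : set (L2 P)) (l : R -> \bar R) (da : measure_display)
    (Aux : measurableType da) (nu : probability Aux R)
    (rule : {mfun (path_space R S * Aux)%type >-> R}) (h : L2 P) (target : R)
  : \bar R :=
  (\int[Q \x nu]_w l (rule (observation h w.1, w.2) - target)%R)%E.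

(* The infimum ranges over all auxiliary probability spaces (Aux, nu) and all
   rules; at parameter i in K the shift is shift i and the target is target i. *)
Definition minimax_risk (S : set (L2 P)) (l : R -> \bar R) (I : Type)
    (K : set I) (shift : I -> L2 P) (target : I -> R) : \bar R :=
  ereal_inf [set r | exists (da : measure_display) (Aux : measurableType da)
    (nu : probability Aux R) (rule : {mfun (path_space R S * Aux)%type >-> R}),
    r = ereal_sup [set risk l nu rule (shift i) (target i) | i in K]].

Definition full_minimax_risk (TT : set (L2 P)) (gamma : L2 P -> R)
    (psi : L2 P) (l : R -> \bar R) (B : set (L2 P)) : \bar R :=
  minimax_risk TT l (core TT gamma `*` B)
    (fun h => h.1 + h.2) (fun h => inner psi h.1 + gamma h.2).

Definition reduced_minimax_risk (TT : set (L2 P)) (gamma : L2 P -> R)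
    (psi : L2 P) (l : R -> \bar R) (B : set (L2 P)) : \bar R :=
  minimax_risk (orthocomplement TT (core TT gamma))
    (smoothed_loss l (inner psi psi)) B id gamma.

End Experiment.

(* Main.v *)
(* Proof idea.  Put G = Delta psi, a N(0, V) variable independent of Z_perp.

   M <= N: from a rule U for Z_perp build T(Z) = U(Z_perp) + Z(psi); its error is
   that of U plus an independent copy of G, and averaging over G turns l into the
   smoothed loss.

   M >= N: restrict the parameter to h + (s / V) psi and average the risk of T
   over s in [-M - n, M + n].  By the Cameron-Martin formula the density of the
   shift by (s / V) psi is exp(s G / V - s^2 / 2V); completing the square, this
   average dominates, up to the factor (M + n) / M, the risk of T - G for the
   smoothed loss with the Gaussian kernel truncated to [-n, n], under the law of
   the experiment reweighted so that G becomes uniform on [-M, M].  As G is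
   independent of Z_perp, the reweighting does not change the law of Z_perp.
   Let M, n tend to infinity along an ultrafilter: the limits of the measures
   A |-> P(Z_perp in A, T - G in D) have densities with respect to the law of
   Z_perp, and the quantile transform of these densities for D = ]-oo, q] is a
   randomized rule U for Z_perp.  A superlevel set of a bowl-shaped lower
   semicontinuous loss is empty or of the form {|x| > c}, an open set, so that
   the layer-cake formula bounds the risk of U by the limit of the risks.  The
   likelihood ratio of the shift by h depends on Z_perp only, so one rule serves
   all h in B.  If V = 0, then h itself is used and no averaging is needed.

   Equality of laws on the path space R^S is reduced to equality of the laws of
   linear forms (Cramer-Wold), which gives both the independence of G and Z_perp
   and the Cameron-Martin formula from one-dimensional Gaussian computations. *)
Require Import Defs.
From HB Require Import structures.
From mathcomp Require Import all_boot all_order all_algebra.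
From mathcomp Require Import finmap.
From mathcomp Require Import all_classical all_reals all_analysis.
From mathcomp Require Import measurable_realfun.
From mathcomp Require Import ring lra.
Import Order.TTheory GRing.Theory Num.Theory.
Import numFieldNormedType.Exports.

Local Open Scope classical_set_scope.
Local Open Scope ring_scope.

(** * Integration tools *)

(** The obstacle is compactness of rules: no topology is used on the path space, an uncountable
    product, and the reweighted laws of T - G need not be tight. For a fixed set D, the limit
    measure in A is dominated by the law of Z_perp. This domination gives both its countable
    additivity and its density. Countably many half-lines D with rational end points suffice to
    build the rule, and one ultrafilter serves them all. Mass that escapes to infinity stays counted
    in the unbounded half-lines on either side of a target a. Hence the finite default value given
    to the rule there costs nothing.

    The truncation of the kernel and the range of s are linked. A kernel of unbounded support would
    require all real s, over which no uniform average exists. A kernel cut at n needs only |s| <= M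
    + n, and M = (n + 1)^2 makes the factor (M + n) / M tend to 1. The rule is fixed before h, the
    target and the loss, as the supremum over B requires.

    The Cramer-Wold theorem is obtained from an algebra of cosines: bounded pointwise limits of
    polynomials in cosines reach the indicators of half-lines. *)

Section MeasureTools.
Context {d : measure_display} {T : measurableType d} {R : realType}.

Import HBNNSimple.

(** The standard induction: a nonnegative measurable function is an increasing limit of simple
    functions, each a finite sum of scaled indicators of its level sets. *)
Lemma ge0_measurable_fun_ind (C : (T -> \bar R) -> Prop) :
  (forall A, measurable A -> C (fun x => (\1_A x)%:E)) ->
  (forall (c : R) (f : T -> \bar R), 0 <= c -> measurable_fun setT f ->
     (forall x, 0 <= f x)%E -> C f -> C (fun x => c%:E * f x)%E) ->
  (forall f g : T -> \bar R, measurable_fun setT f ->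
     measurable_fun setT g -> (forall x, 0 <= f x)%E -> (forall x, 0 <= g x)%E ->
     C f -> C g -> C (fun x => f x + g x)%E) ->
  (forall f : nat -> T -> \bar R, (forall n, measurable_fun setT (f n)) ->
     (forall n x, 0 <= f n x)%E ->
     (forall x, {homo f ^~ x : n m / (n <= m)%N >-> (n <= m)%E}) ->
     (forall n, C (f n)) -> C (fun x => limn (f ^~ x))) ->
  forall f : T -> \bar R, measurable_fun setT f ->
    (forall x, 0 <= f x)%E -> C f.
Proof.
move=> C1 CZ CD Clim f mf f0.
pose h := nnsfun_approx measurableT mf.
have -> : f = (fun x => limn (fun n => (h n x)%:E)).
  by apply/funext => x; apply/esym/cvg_lim => //; exact: cvg_nnsfun_approx.
apply: Clim.
- by move=> n; apply/measurable_EFinP.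
- by move=> n x; rewrite lee_fin.
- by move=> x n m nm; rewrite lee_fin; exact/lefP/nd_nnsfun_approx.
move=> n.
have -> : (fun x => (h n x)%:E) = (fun x => \sum_(y <- fset_set (range (h n)))
   (y%:E * (\1_(h n @^-1` [set y]) x)%:E))%E.
  apply/funext => x; rewrite (fimfunE (h n) x) fsbig_finite//= -sumEFin.
  by apply: eq_bigr => y _; rewrite EFinM.
have : forall y, y \in (fset_set (range (h n)) : seq R) -> 0 <= y.
  move=> y yh; have : y \in fset_set (range (h n)) by [].
  by rewrite in_fset_set// => /set_mem [x _ <-].
(* Nonnegativity of a value is known only from its membership in the range, so it is carried through
   the induction on the list as [s0]. *)
elim: (enum_fset _) => [_|y s ih s0].
  under eq_fun do rewrite big_nil.
  by have := C1 _ measurable0; under eq_fun do rewrite indic0.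
under eq_fun do rewrite big_cons.
have y0 : 0 <= y by apply: s0; rewrite mem_head.
have mI z : measurable_fun setT (fun x => (z%:E * (\1_(h n @^-1` [set z]) x)%:E)%E).
  by apply: measurable_funeM; apply/measurable_EFinP.
apply: CD => //.
- by apply: emeasurable_sum => z.
- by move=> x; rewrite mule_ge0 ?lee_fin.
- move=> x; rewrite big_seq sume_ge0// => z zs; rewrite mule_ge0 ?lee_fin//.
  by apply: s0; rewrite inE zs orbT.
- apply: CZ => //.
  + exact/measurable_EFinP.
  + by apply: C1; exact: measurable_funPTI.
- by apply: ih => z zs; apply: s0; rewrite inE zs orbT.
Qed.

(** The relation between [m] and [w] is a hypothesis and not a construction, so that the same
    formula serves normal laws, [density_measure] and the limit measures along an ultrafilter. *)
Lemma integral_with_density (mu m : {measure set T -> \bar R}) (w : T -> R) :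
  measurable_fun setT w -> (forall x, 0 <= w x) ->
  (forall A, measurable A -> m A = \int[mu]_(x in A) (w x)%:E)%E ->
  forall g : T -> \bar R, measurable_fun setT g -> (forall x, 0 <= g x)%E ->
  (\int[m]_x g x = \int[mu]_x ((w x)%:E * g x))%E.
Proof.
move=> mw' w0' mE.
have mw : measurable_fun setT (fun x => (w x)%:E) by exact/measurable_EFinP.
have w0 x : (0 <= (w x)%:E)%E by rewrite lee_fin.
apply: ge0_measurable_fun_ind.
- move=> A mA; rewrite integral_indic// setIT mE// integral_mkcond.
  by apply: eq_integral => x _; rewrite epatch_indic.
- move=> c f c0 mf f0 fE; rewrite ge0_integralZl// fE -ge0_integralZl//.
  + by apply: eq_integral => x _; rewrite muleCA.
  + exact: emeasurable_funM.
  + by move=> x _; rewrite mule_ge0.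
- move=> f g mf mg f0 g0 fE gE; rewrite ge0_integralD// fE gE -ge0_integralD//.
  + by apply: eq_integral => x _; rewrite ge0_muleDr.
  + by move=> x _; rewrite mule_ge0.
  + exact: emeasurable_funM.
  + by move=> x _; rewrite mule_ge0.
  + exact: emeasurable_funM.
- move=> f mf f0 ndf fE; rewrite monotone_convergence//.
  under eq_fun do rewrite fE.
  rewrite -monotone_convergence//.
  + apply: eq_integral => x _; apply/cvg_lim => //.
    apply: cvgeZl => //; apply: ereal_nondecreasing_is_cvgn => n k nk.
    exact: ndf.
  + by move=> n; exact: emeasurable_funM.
  + by move=> n x _; rewrite mule_ge0.
  + by move=> x _ n k nk; rewrite lee_wpmul2l// ndf.
Qed.

End MeasureTools.

Section DensityMeasure.
Context {d : measure_display} {T : measurableType d} {R : realType}.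
Variables (mu : {measure set T -> \bar R}) (w : T -> R).
Hypotheses (mw : measurable_fun setT w) (w0 : forall x, 0 <= w x).

(* The two proofs are arguments so that the measure structure can be inferred. *)
Definition density_measure of measurable_fun setT w & (forall x, 0 <= w x) :
  set T -> \bar R := fun A => (\int[mu]_(x in A) (w x)%:E)%E.

Local Notation m := (density_measure mw w0).

Let m0 : m set0 = 0%E.
Proof. by rewrite /m integral_set0. Qed.

Let m_ge0 A : (0 <= m A)%E.
Proof. by apply: integral_ge0 => x _; rewrite lee_fin. Qed.

Let m_sigma_additive : semi_sigma_additive m.
Proof.
apply: semi_sigma_additive_nng_induced; first exact/measurable_EFinP.
by move=> x; rewrite lee_fin.
Qed.

HB.instance Definition _ := isMeasure.Build _ _ _ m m0 m_ge0 m_sigma_additive.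

Lemma integral_density_measure (g : T -> \bar R) :
  measurable_fun setT g -> (forall x, 0 <= g x)%E ->
  (\int[m]_x g x = \int[mu]_x ((w x)%:E * g x))%E.
Proof. exact: integral_with_density. Qed.

End DensityMeasure.

Section Reflection.
Context {R : realType}.
Local Notation leb := (@lebesgue_measure R).

Lemma measurable_reflect (a : R) :
  measurable_fun setT (fun x : measurableTypeR R => a - x : measurableTypeR R).
Proof. exact: measurable_funB. Qed.

(** Lebesgue measure is determined by the intervals ]u, v], and the preimage of such an interval is
    [a - v, a - u[, of the same length. *)
Lemma lebesgue_measure_reflect (a : R) (A : set R) : measurable A ->
  pushforward leb (fun x : measurableTypeR R => a - x : measurableTypeR R) A
  = leb A.
Proof.
move=> mA; apply/esym.
have := @lebesgue_measure_unique R
  (pushforward leb (fun x : measurableTypeR R => a - x : measurableTypeR R)).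
move=> /(_ (measurable_reflect a)) H; apply: H => // _ [[u v]] _ <-.
rewrite /pushforward.
rewrite /=; transitivity (leb `[a - v, a - u[%classic); last first.
  by congr (leb _); apply/seteqP; split => x /=; rewrite !in_itv/= => /andP[? ?];
    apply/andP; split; lra.
rewrite !lebesgue_measure_itv/= !lte_fin ltrD2l ltrN2; case: ifP => // uv.
by rewrite -!EFinD; congr EFin; lra.
Qed.

Lemma ge0_integral_reflect (a : R) (f : R -> \bar R) :
  measurable_fun setT f -> (forall x, 0 <= f x)%E ->
  (\int[leb]_x f (a - x)%R = \int[leb]_x f x)%E.
Proof.
move=> mf f0.
rewrite -(@ge0_integral_pushforward _ _ (measurableTypeR R) (measurableTypeR R) R
  _ (measurable_reflect a) leb setT f)//.
apply: eq_measure_integral; first exact: measurable_reflect.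
by move=> ? A mA _; exact: lebesgue_measure_reflect.
Qed.

(** A translation is the composition of the two reflections x |-> - x and x |-> a - x. *)
Lemma ge0_integral_translate (a : R) (f : R -> \bar R) :
  measurable_fun setT f -> (forall x, 0 <= f x)%E ->
  (\int[leb]_x f (x + a)%R = \int[leb]_x f x)%E.
Proof.
move=> mf f0; rewrite -(ge0_integral_reflect 0)//.
rewrite -(ge0_integral_reflect a f)//.
  by apply: eq_integral => x _; congr f; lra.
by apply: (measurableT_comp mf); exact: measurable_funD.
Qed.

End Reflection.

(** * The Cramer-Wold theorem on path spaces *)

Section StepLimit.
Context {R : realType}.

Lemma bernoulli_expr_ge (y : R) m : 0 <= y <= 1 -> 1 - m%:R * y <= (1 - y) ^+ m.
Proof.
move=> /andP[y0 y1]; elim: m => [|m ih]; first by rewrite expr0; lra.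
rewrite exprS -natr1; have : (1 - y) * (1 - m%:R * y) <= (1 - y) * (1 - y) ^+ m.
  by rewrite ler_wpM2l// subr_ge0.
have : (0 : R) <= m%:R by [].
nra.
Qed.

Lemma bernoulli_expr_le (y : R) m : 0 <= y <= 1 ->
  (1 - y) ^+ m * (1 + m%:R * y) <= 1.
Proof.
move=> /andP[y0 y1]; elim: m => [|m ih]; first by rewrite expr0; lra.
apply: le_trans ih; rewrite exprSr -mulrA ler_wpM2l ?exprn_ge0 ?subr_ge0//.
rewrite -natr1; have : (0 : R) <= m%:R by [].
nra.
Qed.

(** Write a = b^2: the bound n b^n <= 1 / (1 - b) absorbs the factor n and leaves a geometric factor
    b^n. *)
Lemma cvg_natM_expr (a : R) : 0 <= a < 1 -> n%:R * a ^+ n @[n --> \oo] --> 0.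
Proof.
move=> /andP[a0 a1]; pose b := Num.sqrt a.
have b0 : 0 <= b by exact: sqrtr_ge0.
have b1 : b < 1 by rewrite -(@sqrtr1 R) ltr_sqrt.
have ab : a = b ^+ 2 by rewrite sqr_sqrtr.
have nb n : n%:R * b ^+ n * (1 - b) <= 1 - b ^+ n.
  elim: n => [|n ih]; first by rewrite expr0; lra.
  rewrite exprS -natr1; have p0 : 0 <= b ^+ n by exact: exprn_ge0.
  have p1 : b ^+ n <= 1 by apply: exprn_ile1 => //; exact: ltW.
  have := ler_wpM2l b0 ih; have := mulr_ge0 (mulr_ge0 b0 p0) b0.
  move: (b ^+ n) p0 p1 => p p0 p1.
  have : b * p <= 1 by nra.
  nra.
apply: (@squeeze_cvgr _ _ _ _ (fun=> 0) (geometric (1 - b)^-1 b)).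
- near=> n; rewrite mulr_ge0 ?exprn_ge0//=.
  rewrite ab -exprM mulnC exprM expr2 mulrA /geometric/=.
  rewrite ler_wpM2r ?exprn_ge0// -[leRHS]mul1r ler_pdivlMr ?subr_gt0//.
  apply: le_trans (nb n) _; rewrite lerBlDr lerDl exprn_ge0//.
- exact: cvg_cst.
- by apply: cvg_geometric; rewrite ger0_norm.
Unshelve. all: by end_near. Qed.

(** The two Bernoulli bounds enclose the expression between 1 - n (2x)^n and 1 / (1 + n (2x)^n). The
    exponent 2^n alone would give the limit 1/e at x = 1/2; the extra factor n turns it into 0. *)
Lemma cvg_step (x : R) : 0 <= x <= 1 ->
  (1 - x ^+ n) ^+ (n * 2 ^ n)%N @[n --> \oo] --> ((x < 2^-1)%R%:R : R).
Proof.
move=> /andP[x0 x1].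
have xn n : 0 <= x ^+ n <= 1 by rewrite exprn_ge0//= exprn_ile1.
case: ltP => x2.
  apply: (@squeeze_cvgr _ _ _ _ (fun n => 1 - n%:R * (2 * x) ^+ n) (fun=> 1)).
  - near=> n; apply/andP; split; last first.
      by apply: exprn_ile1; have /andP[? ?] := xn n; lra.
    apply: le_trans (bernoulli_expr_ge _ _ (xn n)).
    by rewrite natrM natrX exprMn mulrA.
  - rewrite -[X in _ --> X]subr0; apply: cvgB; first exact: cvg_cst.
    by apply: cvg_natM_expr; apply/andP; split; lra.
  - exact: cvg_cst.
apply: (@squeeze_cvgr _ _ _ _ (fun=> 0) harmonic).
- near=> n; apply/andP; split.
    by apply: exprn_ge0; have /andP[? ?] := xn n; lra.
  rewrite /harmonic -[leRHS]mul1r ler_pdivlMr//.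
  apply: le_trans (bernoulli_expr_le _ (n * 2 ^ n)%N (xn n)).
  rewrite ler_wpM2l//.
    by apply: exprn_ge0; have /andP[? ?] := xn n; lra.
  rewrite -natr1 addrC lerD2l natrM natrX -mulrA -exprMn.
  rewrite -[leLHS]mulr1 ler_wpM2l// exprn_ege1//; lra.
- exact: cvg_cst.
- exact: cvg_harmonic.
Unshelve. all: by end_near. Qed.

End StepLimit.

Lemma measurable_path {R : realType} {I : Type} (S : set I)
    {d : measure_display} {T : measurableType d} (F : T -> path_space R S) :
  (forall i, measurable_fun setT (fun w => F w i)) -> measurable_fun setT F.
Proof.
move=> mF; apply: (@measurability _ _ _ (path_space R S) _ F (@coordinate_cylinders R I S)) => //.
move=> _ [_ [i [A [mA ->]]] <-].
by have := mF i measurableT A mA.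
Qed.

Section CramerWold.
Context {R : realType} {I : Type} (S : set I).
Local Notation path := (path_space R S).
Variables m1 m2 : {measure set path -> \bar R}.

(** A list in which indices may repeat, so that concatenation of lists is addition of forms. *)
Definition linear_form (s : seq (S * R)) (z : path) : R :=
  \sum_(p <- s) p.2 * z p.1.

Lemma measurable_coordinate (i : S) : measurable_fun setT (fun z : path => z i).
Proof.
move=> _ A mA; rewrite setTI; apply: sub_sigma_algebra; by exists i, A.
Qed.

Lemma measurable_linear_form s : measurable_fun setT (linear_form s).
Proof.
apply: measurable_sum => p; apply: measurable_funM => //.
exact: measurable_coordinate.
Qed.

Hypothesis m1_fin : (m1 setT < +oo)%E.
Hypothesis same_law : forall s A, measurable A ->
  m1 (linear_form s @^-1` A) = m2 (linear_form s @^-1` A).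

Let m2_fin : (m2 setT < +oo)%E.
Proof. by rewrite -(preimage_setT (linear_form [::])) -same_law ?preimage_setT. Qed.

Definition bounded_measurable (f : path -> R) :=
  measurable_fun setT f /\ exists M, forall z, `|f z| <= M.

Let same_integral (f : path -> R) :=
  (\int[m1]_z (f z)%:E = \int[m2]_z (f z)%:E)%E.

Let bm_integrable (m : {measure set path -> \bar R}) f : (m setT < +oo)%E ->
  bounded_measurable f -> m.-integrable setT (EFin \o f).
Proof.
move=> mfin [mf [M fM]]; apply: measurable_bounded_integrable => //.
exists M; split; first exact: num_real.
by move=> N MN z _; apply: le_trans (fM z) (ltW MN).
Qed.

Let bmM f g : bounded_measurable f -> bounded_measurable g ->
  bounded_measurable (fun z => f z * g z).
Proof.
move=> [mf [M fM]] [mg [N gN]]; split; first exact: measurable_funM.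
by exists (M * N) => z; rewrite normrM ler_pM.
Qed.

Let bmD f g : bounded_measurable f -> bounded_measurable g ->
  bounded_measurable (fun z => f z + g z).
Proof.
move=> [mf [M fM]] [mg [N gN]]; split; first exact: measurable_funD.
by exists (M + N) => z; rewrite (le_trans (ler_normD _ _))// lerD.
Qed.

Let bm_cst (c : R) : bounded_measurable (fun=> c).
Proof. by split => //; exists `|c|. Qed.

Let bm_cos s th : bounded_measurable (fun z => cos (linear_form s z + th)).
Proof.
split; last by exists 1 => z; rewrite ler_norml cos_geN1 cos_le1.
apply: measurableT_comp; first exact: (continuous_measurable_fun (@continuous_cos R)).
by apply: measurable_funD => //; exact: measurable_linear_form.
Qed.

Let same_integral_lin (a b : R) f g :
  bounded_measurable f -> bounded_measurable g ->
  same_integral f -> same_integral g ->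
  same_integral (fun z => a * f z + b * g z).
Proof.
move=> bf bg; rewrite /same_integral => ef eg.
have H (m : {measure set path -> \bar R}) : (m setT < +oo)%E ->
    (\int[m]_z (a * f z + b * g z)%:E =
     a%:E * \int[m]_z (f z)%:E + b%:E * \int[m]_z (g z)%:E)%E.
  move=> mfin; have If := bm_integrable _ _ mfin bf.
  have Ig := bm_integrable _ _ mfin bg.
  under eq_integral do rewrite EFinD !EFinM.
  by rewrite integralD//= ?integralZl//; exact: integrableZl.
by rewrite !H// ef eg.
Qed.

Let same_integral_lim (f_ : nat -> path -> R) (f : path -> R) (M : R) :
  (forall n, measurable_fun setT (f_ n)) -> (forall n z, `|f_ n z| <= M) ->
  (forall z, f_ n z @[n --> \oo] --> f z) ->
  (forall n, same_integral (f_ n)) -> same_integral f.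
Proof.
move=> mf fM ff ef.
have mlim : measurable_fun setT f.
  by apply: measurable_fun_cvg => [n|z _]; [exact: mf|exact: ff].
have H (m : {measure set path -> \bar R}) : (m setT < +oo)%E ->
    (\int[m]_z (f_ n z)%:E @[n --> \oo] --> \int[m]_z (f z)%:E)%E.
  move=> mfin; have [] := @dominated_convergence _ _ _ m setT measurableT
    (fun n z => (f_ n z)%:E) (fun z => (f z)%:E) (fun=> M%:E).
  - by move=> n; exact/measurable_EFinP.
  - exact/measurable_EFinP.
  - by apply/aeW => z _; apply: cvg_EFin; [exact: nearW|exact: ff].
  - exact: (bm_integrable _ _ mfin (bm_cst M)).
  - by apply/aeW => z n _; rewrite lee_fin.
  by [].
have := H m2 m2_fin; under eq_fun do rewrite -ef.
by rewrite /same_integral => /cvg_lim <- //; apply/esym/cvg_lim => //; exact: H.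
Qed.

(* Multipliers form an algebra that contains the functions cos (L + th), L a
   linear form, and that is closed under bounded pointwise limits. *)
Let matched (f : path -> R) := bounded_measurable f /\
  forall s th, same_integral (fun z => f z * cos (linear_form s z + th)).

(** Defined by its action on matched functions, so that products of multipliers are multipliers at
    once. *)
Let multiplier (u : path -> R) := bounded_measurable u /\
  forall f, matched f -> matched (fun z => u z * f z).

Let matched_lin (a b : R) f g : matched f -> matched g ->
  matched (fun z => a * f z + b * g z).
Proof.
move=> [bf mf] [bg mg]; split.
  by apply: bmD; apply: bmM => //; exact: bm_cst.
move=> s th; have := same_integral_lin a b _ _ (bmM _ _ bf (bm_cos s th))
  (bmM _ _ bg (bm_cos s th)) (mf s th) (mg s th).
rewrite /same_integral.
under eq_integral do rewrite !mulrA -mulrDl.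
by under [in X in _ = X -> _]eq_integral do rewrite !mulrA -mulrDl.
Qed.

Let multiplier_lin (a b : R) u v : multiplier u -> multiplier v ->
  multiplier (fun z => a * u z + b * v z).
Proof.
move=> [bu mu] [bv mv]; split.
  by apply: bmD; apply: bmM => //; exact: bm_cst.
move=> f mf; have := matched_lin a b _ _ (mu _ mf) (mv _ mf).
by under eq_fun do rewrite !mulrA -mulrDl.
Qed.

Let multiplierM u v : multiplier u -> multiplier v ->
  multiplier (fun z => u z * v z).
Proof.
move=> [bu mu] [bv mv]; split; first exact: bmM.
by move=> f mf; have := mu _ (mv _ mf); under eq_fun do rewrite mulrA.
Qed.

Let multiplier1 : multiplier (fun=> 1).
Proof.
split; first exact: bm_cst.
by move=> f mf; under eq_fun do rewrite mul1r.
Qed.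

Let multiplier_lim (u_ : nat -> path -> R) (u : path -> R) (M : R) :
  (forall n z, `|u_ n z| <= M) -> (forall z, u_ n z @[n --> \oo] --> u z) ->
  (forall n, multiplier (u_ n)) -> multiplier u.
Proof.
move=> uM uu mu.
have bu : bounded_measurable u.
  split.
    apply: (@measurable_fun_cvg _ _ _ _ u_) => [n|z _]; last exact: uu.
    by have [[]] := mu n.
  exists M => z; have /cvg_norm := uu z => uz.
  rewrite -(cvg_lim (@norm_hausdorff _ _) uz); apply: limr_le; first exact: cvgP uz.
  exact: nearW.
split => // f mf; have [bf _] := mf; have [mf' [N fN]] := bf.
split; first exact: bmM.
move=> s th; have [mc _] := bm_cos s th.
apply: (same_integral_lim (fun n z => u_ n z * f z * cos (linear_form s z + th))
  _ (M * N)).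
- move=> n; have [[mun _] _] := mu n.
  by apply: measurable_funM => //; exact: measurable_funM.
- move=> n z; rewrite !normrM -[leRHS]mulr1 ler_pM//; last first.
    by rewrite ler_norml cos_geN1 cos_le1.
  by rewrite ler_pM.
- move=> z; apply: cvgM; last exact: cvg_cst.
  by apply: cvgM; [exact: uu|exact: cvg_cst].
- by move=> n; have [_ /(_ _ mf)[_]] := mu n; exact.
Qed.

(** By cos a cos b = (cos (a + b) + cos (a - b)) / 2, a product of cosines of two forms is an
    average of cosines of their sum [s1] and their difference [s2]. *)
Let multiplier_cos s th : multiplier (fun z => cos (linear_form s z + th)).
Proof.
split; first exact: bm_cos.
move=> f [bf mf]; split; first by apply: bmM.
move=> s' th'; pose s1 := s ++ s'; pose s2 := s ++ [seq (p.1, - p.2) | p <- s'].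
have := same_integral_lin 2^-1 2^-1 _ _
  (bmM _ _ bf (bm_cos s1 (th + th'))) (bmM _ _ bf (bm_cos s2 (th - th')))
  (mf s1 (th + th')) (mf s2 (th - th')).
suff -> : (fun z => 2^-1 * (f z * cos (linear_form s1 z + (th + th'))) +
    2^-1 * (f z * cos (linear_form s2 z + (th - th')))) =
  (fun z => cos (linear_form s z + th) * f z * cos (linear_form s' z + th')) by [].
apply/funext => z.
have -> : linear_form s1 z + (th + th') =
    (linear_form s z + th) + (linear_form s' z + th').
  by rewrite /linear_form big_cat/=; ring.
have -> : linear_form s2 z + (th - th') =
    (linear_form s z + th) - (linear_form s' z + th').
  rewrite /linear_form big_cat/= big_map/=.
  by under [X in _ + X + (th - th')]eq_bigr do rewrite mulNr; rewrite sumrN; ring.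
by rewrite cosD cosB; field.
Qed.

Let multiplierX u n : multiplier u -> multiplier (fun z => u z ^+ n).
Proof.
move=> mu; elim: n => [|n ih]; first by under eq_fun do rewrite expr0.
by under eq_fun do rewrite exprS; exact: multiplierM.
Qed.

Let multiplier_step u : (forall z, 0 <= u z <= 1) -> multiplier u ->
  multiplier (fun z => (u z < 2^-1)%R%:R).
Proof.
move=> u01 mu.
(* (1 - u^n)^(n 2^n) tends to 1 if u < 1/2 and to 0 otherwise. *)
apply: (multiplier_lim (fun n z => (1 - u z ^+ n) ^+ (n * 2 ^ n)%N) _ 1).
- move=> n z; have /andP[u0 u1] := u01 z.
  have ? := exprn_ge0 n u0; have ? := exprn_ile1 n u0 u1.
  by rewrite ger0_norm ?exprn_ge0 ?exprn_ile1; lra.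
- by move=> z; exact: cvg_step.
- move=> n; apply: multiplierX.
  have := multiplier_lin 1 (-1) _ _ multiplier1 (multiplierX _ n mu).
  by under eq_fun do rewrite mul1r mulN1r.
Qed.

Let multiplier_far (i : S) (y r : R) : 0 < r ->
  multiplier (fun z => (r < `|z i - y|)%R%:R).
Proof.
move=> r0.
pose t n : R := n.+1%:R^-1.
(* The offset 1/2 is the threshold of [multiplier_step], and the factor 1/4 keeps [u] within [0, 1].
   For a small frequency [t n], u < 1/2 means exactly r < |z i - y|. *)
pose u n z : R := 2^-1 + (cos (t n * (z i - y)) - cos (t n * r)) / 4.
apply: (multiplier_lim (fun n z => (u n z < 2^-1)%R%:R) _ 1).
- by move=> n z; case: (_ < _); rewrite ?normr1 ?normr0.
- move=> z; pose w : R := `|z i - y|.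
  have w0 : 0 <= w by exact: normr_ge0.
  have D0 : 0 < r + w + 1 by lra.
  suff H : \forall n \near \oo, (u n z < 2^-1) = (r < w).
    apply: cvg_near_cst; near=> n; congr (_%:R); congr nat_of_bool.
    by near: n.
  have T0 : 0 < pi / (r + w + 1) :> R.
    by rewrite divr_gt0 ?pi_gt0.
  near=> n.
  have tn : t n * (r + w + 1) < pi.
    rewrite -ltr_pdivlMr//.
    by near: n; exact: (near_infty_natSinv_lt (PosNum T0)).
  have t0 : 0 < t n by rewrite invr_gt0.
  rewrite /u; have -> : cos (t n * (z i - y)) = cos (t n * w).
    rewrite /w; have [_|_] := ger0P (z i - y) => //.
    by rewrite mulrN cosN.
  (* t n is small enough for cos to be decreasing on the relevant range *)
  have <- : (cos (t n * w) < cos (t n * r)) = (r < w).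
    rewrite ltr_cos ?in_itv/=.
    - by rewrite ltr_pM2l.
    - apply/andP; split; first by rewrite mulr_ge0// ltW.
      by apply: ltW; apply: le_lt_trans tn; rewrite ler_pM2l//; lra.
    - apply/andP; split; first by rewrite mulr_ge0// ltW.
      by apply: ltW; apply: le_lt_trans tn; rewrite ler_pM2l//; lra.
  by apply/idP/idP => ?; lra.
- move=> n; apply: multiplier_step.
    move=> z; rewrite /u.
    have := cos_geN1 (t n * (z i - y)); have := cos_le1 (t n * (z i - y)).
    have := cos_geN1 (t n * r); have := cos_le1 (t n * r).
    by move=> *; apply/andP; split; lra.
  have -> : u n = (fun z => (2^-1 - cos (t n * r) / 4) * 1 +
      4^-1 * cos (linear_form [:: (i, t n)] z + - (t n * y))).
    by apply/funext => z; rewrite /u /linear_form big_seq1/= mulrBr; field.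
  exact: multiplier_lin.
Unshelve. all: by end_near. Qed.

(** The half-line ]c, +oo[ is the limit of the complements of the intervals [c - 2N, c]: any given
    point eventually lies to the right of c - 2N. *)
Let multiplier_gt (i : S) (c : R) : multiplier (fun z => (c < z i)%R%:R).
Proof.
apply: (multiplier_lim (fun n z => (n.+1%:R < `|z i - (c - n.+1%:R)|)%R%:R) _ 1).
- by move=> n z; case: (_ < _); rewrite ?normr1 ?normr0.
- move=> z; apply: cvg_near_cst.
  have [m cm] : exists m : nat, `|z i - c| <= m%:R.
    by exists (Num.bound `|z i - c|); rewrite ltW// archi_boundP.
  exists m => // n /= mn; congr (_%:R); congr nat_of_bool.
  have {mn} mn : m%:R <= n.+1%:R :> R by rewrite ler_nat (leq_trans mn).
  have := le_trans cm mn; rewrite ler_norml => /andP[? ?].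
  rewrite ger0_norm; last lra.
  by apply/idP/idP => ?; lra.
- by move=> n; exact: multiplier_far.
Qed.

(** These sets form a pi-system, with concatenation of lists as intersection, and they generate the
    sigma-algebra of the path space. *)
Let halfspaces (s : seq (S * R)) : set path :=
  [set z | all (fun p => p.2 < z p.1) s].

Let multiplier_halfspaces s :
  multiplier (fun z => (all (fun p => p.2 < z p.1) s)%:R).
Proof.
elim: s => [|p s ih] /=; first exact: multiplier1.
under eq_fun do rewrite -mulnb natrM.
by apply: multiplierM.
Qed.

Lemma cramer_wold A : measurable A -> m1 A = m2 A.
Proof.
pose G := range halfspaces.
have Gm : G `<=` measurable.
  move=> _ [s _ <-].
  have [[+ _] _] := multiplier_halfspaces s.
  move=> /(_ measurableT [set 1] (measurable_set1 _)); rewrite setTI.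
  congr (measurable _); apply/seteqP; split => z; rewrite /halfspaces/=.
    by case: all => //= /eqP; rewrite eq_sym oner_eq0.
  by move=> ->.
have G1 B : G B -> m1 B = m2 B.
  move=> GB; have mB := Gm _ GB; case: GB mB => s _ <- mB.
  (* The constant 1 is matched: its integral against the cosine of a form depends only on the law of
     that form, which [same_law] controls. *)
  have [_ /(_ (fun=> 1))[]] := multiplier_halfspaces s.
    split; first exact: bm_cst.
    move=> s' th; rewrite /same_integral.
    under eq_integral do rewrite mul1r.
    under [in RHS]eq_integral do rewrite mul1r.
    have H (m : {measure set path -> \bar R}) : (m setT < +oo)%E ->
        (\int[m]_z (cos (linear_form s' z + th))%:E =
         \int[pushforward m (linear_form s')]_x
           (cos (x + th))%:E)%E.
      move=> mfin; rewrite (integral_pushforward (measurable_linear_form s'))//.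
        apply/measurable_EFinP; apply: measurableT_comp.
          exact: (continuous_measurable_fun (@continuous_cos R)).
        exact: measurable_funD.
      exact: bm_integrable _ _ mfin (bm_cos s' th).
    rewrite !H//; apply: eq_measure_integral.
    - exact: measurable_linear_form.
    - exact: measurable_linear_form.
    - by move=> ? ? D mD _; exact: same_law.
  (* The empty form with phase 0 has cosine 1, so what remains is the integral of the indicator
     itself. *)
  move=> _ /(_ [::] 0); rewrite /same_integral /linear_form.
  under eq_integral do rewrite big_nil addr0 cos0 !mulr1.
  under [in X in _ = X -> _]eq_integral do rewrite big_nil addr0 cos0 !mulr1.
  have E (m : {measure set path -> \bar R}) :
      (\int[m]_z ((all (fun p => p.2 < z p.1) s)%:R)%:E = m (halfspaces s))%E.
    rewrite -[halfspaces s]setIT -integral_indic//; apply: eq_integral => z _.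
    by rewrite indicE; congr (_%:R%:E); congr nat_of_bool;
      apply/idP/idP => [?|/set_mem//]; exact/mem_set.
  by rewrite !E.
have GE : measurable `<=` <<s G >>.
  apply: smallest_sub; first exact: smallest_sigma_algebra.
  move=> _ [i [B [mB ->]]].
  have : measurable_fun setT (fun z : g_sigma_algebraType G => (z : S -> R) i).
    apply: (measurability _ (RGenOInfty.measurableE R)) => // _ [_ [c ->] <-].
    apply: sub_sigma_algebra; exists [:: (i, c)] => //.
    rewrite setTI; apply/seteqP; split => z; rewrite /halfspaces/= in_itv/=.
      by rewrite !andbT.
    by rewrite !andbT.
  by move=> /(_ measurableT B mB); rewrite setTI.
move=> mA; apply: (@g_sigma_algebra_measure_unique _ _ _ G Gm (fun=> setT)) => //.
- by move=> _; exists [::] => //; rewrite -subTset => z _.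
- exact: bigcup_const.
- move=> _ _ [s _ <-] [s' _ <-]; exists (s ++ s') => //.
  by apply/seteqP; split => z /=; rewrite /halfspaces/= all_cat => /andP.
- exact: GE.
Qed.

End CramerWold.

(** * Centred normal laws *)

Section NormalDensity.
Context {R : realType}.
Local Notation leb := (@lebesgue_measure R).
Implicit Types (v a b x : R) (f : R -> \bar R).

(** Parametrized by the variance; it is a Gaussian density only for [0 < v]. *)
Definition npdf v x : R := normal_pdf 0 (Num.sqrt v) x.

Lemma npdfE v x : 0 < v ->
  npdf v x = (Num.sqrt (v * pi *+ 2))^-1 * expR (- x ^+ 2 / (2 * v)).
Proof.
move=> v0; rewrite /npdf normal_pdfE ?gt_eqF ?sqrtr_gt0// /normal_peak /normal_fun.
by rewrite subr0 sqr_sqrtr ?ltW// -(mulr_natl v).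
Qed.

Lemma npdf_ge0 v x : 0 <= npdf v x.
Proof. exact: normal_pdf_ge0. Qed.

Lemma measurable_npdf v : measurable_fun setT (npdf v).
Proof. exact: measurable_normal_pdf. Qed.

Lemma integral_npdf v : (\int[leb]_x (npdf v x)%:E = 1)%E.
Proof. exact: integral_normal_pdf. Qed.

Lemma npdfN v x : 0 < v -> npdf v (- x) = npdf v x.
Proof. by move=> v0; rewrite !npdfE// sqrrN. Qed.

Lemma npdf_le v x y : 0 < v -> `|x| <= `|y| -> npdf v y <= npdf v x.
Proof.
move=> v0 xy; rewrite !npdfE// ler_wpM2l ?invr_ge0// ler_expR ler_wpM2r//.
  by rewrite invr_ge0 mulr_ge0// ltW.
by rewrite lerN2 -(real_normK (num_real x)) -(real_normK (num_real y)) ler_sqr ?nnegrE.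
Qed.

Lemma npdf_translate v x s : 0 < v ->
  npdf v (x - s) = expR (s * x / v - s ^+ 2 / (2 * v)) * npdf v x.
Proof.
move=> v0; rewrite !npdfE// mulrCA -expRD; congr (_ * expR _); field.
by rewrite gt_eqF.
Qed.

(** The joint density of a sum u and of its second summand y, factored as the density of the sum
    times the conditional density of y. Given u, the latter is normal with mean b u / (a + b) and
    variance a b / (a + b). *)
Lemma npdfM a b u y : 0 < a -> 0 < b ->
  npdf a (u - y) * npdf b y =
  npdf (a + b) u * npdf (a * b / (a + b)) (y - b / (a + b) * u).
Proof.
move=> a0 b0; have ab0 : 0 < a + b by exact: addr_gt0.
have w0 : 0 < a * b / (a + b) by rewrite divr_gt0// mulr_gt0.
rewrite !npdfE//.
have Hp : (Num.sqrt (a * pi *+ 2))^-1 * (Num.sqrt (b * pi *+ 2))^-1 =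
    (Num.sqrt ((a + b) * pi *+ 2))^-1 *
    (Num.sqrt (a * b / (a + b) * pi *+ 2))^-1 :> R.
  have E (p : R) : a * p *+ 2 * (b * p *+ 2) =
      (a + b) * p *+ 2 * (a * b / (a + b) * p *+ 2).
    by field; rewrite gt_eqF.
  rewrite -!invfM -!sqrtrM.
  - by rewrite E.
  - by rewrite mulrn_wge0// mulr_ge0 ?pi_ge0// ltW.
  - by rewrite mulrn_wge0// mulr_ge0 ?pi_ge0// ltW.
have He : expR (- (u - y) ^+ 2 / (2 * a)) * expR (- y ^+ 2 / (2 * b)) =
    expR (- u ^+ 2 / (2 * (a + b))) *
    expR (- (y - b / (a + b) * u) ^+ 2 / (2 * (a * b / (a + b)))).
  have E : - (u - y) ^+ 2 / (2 * a) + - y ^+ 2 / (2 * b) =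
      - u ^+ 2 / (2 * (a + b)) +
      - (y - b / (a + b) * u) ^+ 2 / (2 * (a * b / (a + b))).
    by field; rewrite !gt_eqF.
  by rewrite -!expRD E.
by rewrite mulrACA Hp He mulrACA.
Qed.

Lemma integral_centred_normal v f : 0 < v ->
  measurable_fun setT f -> (forall x, 0 <= f x)%E ->
  (\int[centred_normal v]_x f x = \int[leb]_x ((npdf v x)%:E * f x))%E.
Proof.
move=> v0 mf f0; rewrite /centred_normal gt_eqF//.
apply: integral_with_density => //; first exact: measurable_npdf.
exact: npdf_ge0.
Qed.

Lemma integral_centred_normal0 f : measurable_fun setT f ->
  (forall x, 0 <= f x)%E -> (\int[centred_normal (0 : R)]_x f x = f 0%R)%E.
Proof.
move=> mf f0; rewrite /centred_normal eqxx integral_dirac//.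
by rewrite diracT mul1e.
Qed.

Lemma centred_normal_translate v f s : 0 < v ->
  measurable_fun setT f -> (forall x, 0 <= f x)%E ->
  (\int[centred_normal v]_x f (x + s)%R =
   \int[centred_normal v]_x ((expR (s * x / v - s ^+ 2 / (2 * v)))%:E * f x))%E.
Proof.
move=> v0 mf f0.
have mfs : measurable_fun setT (fun x => f (x + s)).
  by apply: (measurableT_comp mf); exact: measurable_funD.
have me : measurable_fun setT (fun x => expR (s * x / v - s ^+ 2 / (2 * v))).
  by apply: measurableT_comp => //; apply: measurable_funB => //;
    apply: measurable_funM => //; exact: measurable_funM.
rewrite !integral_centred_normal//; first last.
- by move=> x; rewrite mule_ge0// lee_fin expR_ge0.
- by apply: emeasurable_funM => //; exact/measurable_EFinP.
have mp : measurable_fun setT (fun x => ((npdf v x)%:E)).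
  by apply/measurable_EFinP; exact: measurable_npdf.
rewrite -[LHS](ge0_integral_translate (- s))//.
- apply: eq_integral => x _; rewrite subrK npdf_translate// EFinM.
  by rewrite muleAC muleC.
- exact: emeasurable_funM.
- by move=> x; rewrite mule_ge0// lee_fin npdf_ge0.
Qed.

(** Degenerate variances are point masses at 0. Otherwise the order of integration is exchanged, x
    is replaced by u - y, and the order is exchanged back, so that y can be integrated out. *)
Lemma centred_normal_convolution a b f : 0 <= a -> 0 <= b ->
  measurable_fun setT f -> (forall x, 0 <= f x)%E ->
  (\int[centred_normal a]_x \int[centred_normal b]_y f (x + y)%R =
   \int[centred_normal (a + b)]_x f x)%E.
Proof.
move=> a0 b0 mf f0; set c := a + b; have cE : c = a + b by [].
move: c cE => c cE.
have mft s : measurable_fun setT (fun x => f (s + x)).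
  by apply: (measurableT_comp mf); exact: measurable_funD.
have mF e : measurable_fun setT (fun x => (\int[centred_normal e]_y f (x + y)%R)%E).
  apply: (@measurable_fun_fubini_tonelli_F _ _ _ _ _ (centred_normal e)
    (fun z : R * R => f (z.1 + z.2))) => //.
  by apply: (measurableT_comp mf); exact: measurable_funD.
have F0 e x : (0 <= \int[centred_normal e]_y f (x + y)%R)%E.
  by apply: integral_ge0 => y _.
move: a0; rewrite le_eqVlt => /predU1P[a0|a0].
  have -> : c = b by rewrite cE -a0 add0r.
  rewrite -a0; apply: etrans (integral_centred_normal0 _ (mF b) (F0 b)) _.
  by apply: eq_integral => y _; rewrite add0r.
move: b0; rewrite le_eqVlt => /predU1P[b0|b0].
  have -> : c = a by rewrite cE -b0 addr0.
  rewrite -b0; apply: eq_integral => x _.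
  by rewrite (integral_centred_normal0 _ (mft x)) ?addr0.
rewrite {}cE => {c}.
have mp c : measurable_fun setT (fun x => ((npdf c x)%:E)).
  by apply/measurable_EFinP; exact: measurable_npdf.
apply: etrans (integral_centred_normal _ _ a0 (mF b) (F0 b)) _.
apply: etrans _ (esym (integral_centred_normal _ _ (addr_gt0 a0 b0) mf f0)).
have mpft s : measurable_fun setT (fun y => ((npdf b y)%:E * f (s + y)%R)%E).
  exact: emeasurable_funM.
have pft0 (s y : R) : (0 <= (npdf b y)%:E * f (s + y)%R)%E.
  by rewrite mule_ge0// lee_fin npdf_ge0.
transitivity (\int[leb]_x \int[leb]_y
    ((npdf a x)%:E * ((npdf b y)%:E * f (x + y)%R)))%E.
  apply: eq_integral => x _.
  rewrite (integral_centred_normal b _ b0 (mft x) (fun y => f0 _)).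
  apply/esym/ge0_integralZl => //.
    exact: mpft.
  by rewrite lee_fin npdf_ge0.
have mpa1 : measurable_fun setT (fun z : R * R => (npdf a z.1)%:E).
  exact: (measurableT_comp (mp a)).
have mpb2 : measurable_fun setT (fun z : R * R => (npdf b z.2)%:E).
  exact: (measurableT_comp (mp b)).
rewrite (fubini_tonelli (m1 := leb) (m2 := leb)
    (fun z : R * R => (npdf a z.1)%:E * ((npdf b z.2)%:E * f (z.1 + z.2)%R))%E)/=;
  first last.
- by move=> z; rewrite !mule_ge0// ?lee_fin ?npdf_ge0.
- apply: emeasurable_funM => //; apply: emeasurable_funM => //.
  by apply: (measurableT_comp mf); exact: measurable_funD.
transitivity (\int[leb]_y \int[leb]_u
    ((npdf a (u - y))%:E * ((npdf b y)%:E * f u)))%E.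
  apply: eq_integral => y _; rewrite -[LHS](ge0_integral_translate (- y)).
  - by apply: eq_integral => u _; rewrite subrK.
  - apply: emeasurable_funM => //; apply: emeasurable_funM => //.
    by apply: (measurableT_comp mf); exact: measurable_funD.
  - by move=> x; rewrite !mule_ge0// ?lee_fin ?npdf_ge0.
have mpab : measurable_fun setT (fun z : R * R => (npdf a (z.2 - z.1))%:E).
  by apply: (measurableT_comp (mp a)); exact: measurable_funB.
have mpb1 : measurable_fun setT (fun z : R * R => (npdf b z.1)%:E).
  exact: (measurableT_comp (mp b)).
rewrite (fubini_tonelli (m1 := leb) (m2 := leb)
    (fun z : R * R => (npdf a (z.2 - z.1))%:E * ((npdf b z.1)%:E * f z.2))%E)/=;
  first last.
- by move=> z; rewrite !mule_ge0// ?lee_fin ?npdf_ge0.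
- apply: emeasurable_funM => //; apply: emeasurable_funM => //.
  exact: (measurableT_comp mf).
apply: eq_integral => u _.
(* For fixed u the integrand in y is a constant times the conditional density of [npdfM], of
   integral 1. *)
pose w := a * b / (a + b); pose s := - (b / (a + b) * u).
transitivity (\int[leb]_y (((npdf (a + b) u)%:E * f u) * (npdf w (y + s))%:E))%E.
  apply: eq_integral => y _.
  by rewrite muleA -EFinM npdfM// EFinM muleAC.
rewrite ge0_integralZl//.
- rewrite (ge0_integral_translate s (fun y => (npdf w y)%:E))//.
    by rewrite integral_npdf mule1.
  by move=> x; rewrite lee_fin npdf_ge0.
- by apply: (measurableT_comp (mp w)); exact: measurable_funD.
- by move=> y _; rewrite lee_fin npdf_ge0.
- by rewrite mule_ge0// lee_fin npdf_ge0.
Qed.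

Lemma is_derive_npdf v x : 0 < v ->
  is_derive x 1 (fun y => - (v * npdf v y)) (x * npdf v x).
Proof.
move=> v0; pose c := (Num.sqrt (v * pi *+ 2))^-1.
have -> : (fun y => - (v * npdf v y)) =
    (- (v * c)) \*: (expR \o ((- (2 * v)^-1) \*: (@id R ^+ 2))).
  apply/funext => y /=; rewrite npdfE// /c.
  rewrite mulrA -mulNr /GRing.scale /=; congr (_ * expR _).
  by rewrite mulNr mulrC -mulNr mulrC; congr (_ * _).
pose k : R := - (2 * v)^-1.
have H1 : is_derive x 1 (k \*: (@id R ^+ 2)) (k *: ((2%:R * x ^+ 1) *: 1)).
  by apply: is_deriveZ; apply: is_deriveX.
have H2 := is_derive1_comp (is_derive_expR ((k \*: (@id R ^+ 2)) x)) H1.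
have H3 := is_deriveZ (- (v * c)) H2.
apply: (is_derive_eq H3).
rewrite npdfE// -/c /k /= expr1.
transitivity (- (v * c) * (expR (- (2 * v)^-1 * x ^+ 2) *
    (- (2 * v)^-1 * (2 * x * 1)))); first by [].
have -> : - (2 * v)^-1 * x ^+ 2 = - x ^+ 2 / (2 * v) by rewrite mulNr mulrC -mulNr.
move: (expR _) => e; field.
by rewrite gt_eqF.
Qed.

Lemma cvg_npdfy v : 0 < v -> npdf v x @[x --> +oo] --> 0.
Proof.
move=> v0; pose c := (Num.sqrt (v * pi *+ 2))^-1.
have -> : npdf v = (fun x => c * gauss_fun ((Num.sqrt (2 * v))^-1 * x)).
  apply/funext => x; rewrite npdfE// /gauss_fun exprMn exprVn sqr_sqrtr.
    by congr (_ * expR _); rewrite mulNr mulrC.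
  by rewrite mulr_ge0// ltW.
rewrite -[X in _ --> X](mulr0 c); apply: cvgM; first exact: cvg_cst.
apply: (cvg_comp _ _ _ cvg_gauss_fun).
apply: gt0_cvgMry; last exact: cvg_id.
by rewrite invr_gt0 sqrtr_gt0 mulr_gt0.
Qed.

(** By symmetry only x >= 0 matters. There x^2 p(x) is the integral of x p(x) over t in [0, x];
    after exchanging the integrals, the one of x p(x) over x >= t is v p(t), because - v p is a
    primitive of x p(x). *)
Lemma second_moment_centred_normal v : 0 <= v ->
  (\int[centred_normal v]_x (x ^+ 2)%:E = v%:E)%E.
Proof.
have msq : measurable_fun setT (fun x : R => (x ^+ 2)%:E).
  by apply/measurable_EFinP; exact: measurable_funX.
have sq0 x : (0 <= (x ^+ 2)%:E)%E by rewrite lee_fin sqr_ge0.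
rewrite le_eqVlt => /predU1P[<-|v0].
  by rewrite integral_centred_normal0// expr0n.
rewrite integral_centred_normal//.
have cp : continuous (npdf v).
  by apply: continuous_normal_pdf; rewrite gt_eqF// sqrtr_gt0.
under eq_integral do rewrite -EFinM.
rewrite ge0_symfun_integralT//=; first last.
- by move=> x; rewrite /= npdfN// sqrrN.
- by move=> x; apply: cvgM; [exact: cp|exact: sqr_continuous].
- by move=> x; rewrite mulr_ge0 ?npdf_ge0 ?sqr_ge0.
have := integral_npdf v.
rewrite ge0_symfun_integralT//=; first last.
- by move=> x; rewrite /= npdfN.
- exact: npdf_ge0.
set P := [set x | 0 <= x].
have mP : measurable P by rewrite /P -set_itvcy.
move=> half.
have tail t : 0 <= t ->
    (\int[leb]_(x in `[t, +oo[) (x * npdf v x)%:E = (v * npdf v t)%:E)%E.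
  move=> t0; rewrite (@ge0_continuous_FTC2y _ _ (fun x => - (v * npdf v x)) _ 0).
  - by rewrite sub0e EFinN oppeK.
  - by move=> x tx; rewrite mulr_ge0 ?npdf_ge0// (le_trans t0).
  - apply: continuous_subspaceT => x; apply: cvgM; [exact: cvg_id|exact: cp].
  - rewrite -oppr0 -(mulr0 v); apply: cvgN; apply: cvgM; first exact: cvg_cst.
    exact: cvg_npdfy.
  - by move=> x _; have [] := is_derive_npdf v x v0.
  - by apply: cvg_at_right_filter; apply: cvgN; apply: cvgM; [exact: cvg_cst|exact: cp].
  - by move=> x _; rewrite derive1E; have [_] := is_derive_npdf v x v0.
transitivity (2%:E * \int[leb]_(t in P) (v * npdf v t)%:E)%E; last first.
  under eq_integral do rewrite EFinM.
  rewrite ge0_integralZl//.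
  - by rewrite muleCA half mule1.
  - by apply/measurable_EFinP/measurable_funTS; exact: measurable_npdf.
  - by move=> x _; rewrite lee_fin npdf_ge0.
  - by rewrite lee_fin ltW.
congr (_ * _)%E.
pose h (z : R * R) : \bar R :=
  (if (0 <= z.2) && (z.2 <= z.1) then z.1 * npdf v z.1 else 0)%:E.
have mh : measurable_fun setT h.
  apply/measurable_EFinP; apply: measurable_fun_ifT.
  - apply: measurable_and; apply: measurable_fun_ler => //.
  - by apply: measurable_funM => //; apply: (measurableT_comp (measurable_npdf v)).
  - exact: measurable_cst.
have h0 z : (0 <= h z)%E.
  rewrite lee_fin; case: ifP => // /andP[z2 z12].
  by rewrite mulr_ge0 ?npdf_ge0// (le_trans z2).
transitivity (\int[leb]_x \int[leb]_t h (x, t))%E.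
  rewrite [LHS]integral_mkcond; apply: eq_integral => x _.
  rewrite patchE; case: ifPn => [/set_mem x0|/negP x0].
    transitivity (\int[leb]_(t in `[0%R, x]) (x * npdf v x)%:E)%E.
      rewrite integral_cst//= lebesgue_measure_itv/= lte_fin.
      have [_|x0'] := ltP 0 x; first by rewrite sube0 -EFinM; congr EFin; ring.
      have -> : x = 0 by apply/eqP; rewrite eq_le x0'.
      by rewrite mule0 expr0n/= mulr0.
    rewrite integral_mkcond; apply: eq_integral => t _.
    rewrite patchE /h/=; case: ifPn => [/set_mem|/negP tx].
      by rewrite /= in_itv/= => ->.
    by case: ifPn => // tx'; exfalso; apply: tx; apply/mem_set; rewrite /= in_itv.
  rewrite integral0_eq// => t _; rewrite /h/=; case: ifPn => // /andP[t0 tx].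
  by exfalso; apply: x0; apply/mem_set; exact: le_trans tx.
rewrite (fubini_tonelli (m1 := leb) (m2 := leb) h)//=.
rewrite [RHS]integral_mkcond; apply: eq_integral => t _.
rewrite patchE; case: ifPn => [/set_mem t0|/negP t0].
  rewrite -tail// [RHS]integral_mkcond; apply: eq_integral => x _.
  rewrite patchE /h/=; case: ifPn => [tx|/negP tx].
    case: ifPn => [//|/negP tx'].
    by exfalso; apply: tx'; apply/mem_set; rewrite /= in_itv/= andbT; case/andP: tx.
  case: ifPn => [/set_mem|//].
  by rewrite /= in_itv/= andbT => tx'; exfalso; apply: tx; rewrite t0.
rewrite integral0_eq// => x _; rewrite /h/=; case: ifPn => // /andP[t0' _].
by exfalso; apply: t0; exact/mem_set.
Qed.


End NormalDensity.

(** * Gaussian spaces: independence and shifts *)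

Section GaussianVariable.
Context {d : measure_display} {Omega : measurableType d} {R : realType}.
Variable Q : probability Omega R.
Implicit Types X Y : Omega -> R.

Definition gaussian_law X (v : R) :=
  [/\ measurable_fun setT X, 0 <= v &
    forall A, measurable A -> Q (X @^-1` A) = centred_normal v A].

Lemma ge0_integral_gaussian_law X v (f : R -> \bar R) : gaussian_law X v ->
  measurable_fun setT f -> (forall x, 0 <= f x)%E ->
  (\int[Q]_w f (X w) = \int[centred_normal v]_x f x)%E.
Proof.
move=> [mX v0 lX] mf f0.
have := @ge0_integral_pushforward _ _ Omega (measurableTypeR R) R X mX Q
  setT f measurableT mf.
rewrite preimage_setT => <-; last by move=> x _; exact: f0.
by apply: eq_measure_integral => A mA _; exact: lX.
Qed.

Lemma gaussian_law_second_moment X v : gaussian_law X v ->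
  (\int[Q]_w (X w ^+ 2)%:E = v%:E)%E.
Proof.
move=> lX; rewrite (ge0_integral_gaussian_law X v (fun x => (x ^+ 2)%:E))//.
- by rewrite second_moment_centred_normal//; case: lX.
- by apply/measurable_EFinP; exact: measurable_funX.
- by move=> x; rewrite lee_fin sqr_ge0.
Qed.

Lemma gaussian_law_Lfun2 X v : gaussian_law X v -> X \in Lfun Q 2%:E.
Proof.
move=> lX; have [mX v0 _] := lX.
rewrite inE; apply/andP; split; rewrite inE//=.
rewrite /finite_norm unlock /=.
apply: poweR_lty.
rewrite [ltLHS](_ : _ = v%:E) ?ltry// -(gaussian_law_second_moment _ _ lX).
apply: eq_integral => w _.
by rewrite powR_mulrn// real_normK// num_real.
Qed.

Lemma gaussian_law_Lfun1 X v : gaussian_law X v -> X \in Lfun Q 1.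
Proof.
move=> /gaussian_law_Lfun2; apply: Lfun_subset12.
by rewrite fin_num_measure.
Qed.

(** By symmetry of the law, the positive and negative parts have the same integral, which is finite
    since X is in L^1. *)
Lemma gaussian_law_mean X v : gaussian_law X v -> ('E_Q[X] = 0)%E.
Proof.
move=> lX; have [mX v0 _] := lX.
have mE : measurable_fun [set: R] (@EFin R) by exact/measurable_EFinP.
have mp := measurable_funepos mE; have mn := measurable_funeneg mE.
have sym : (\int[Q]_w ((@EFin R)^\+ (X w)) = \int[Q]_w ((@EFin R)^\- (X w)))%E.
  rewrite !(ge0_integral_gaussian_law _ _ _ lX)//.
  move: v0 {lX}; rewrite le_eqVlt => /predU1P[<-|v0].
    by rewrite !integral_centred_normal0// !unlock oppe0.
  rewrite !integral_centred_normal//.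
  rewrite -[LHS](ge0_integral_reflect 0).
  - apply: eq_integral => x _; rewrite sub0r npdfN//; congr (_ * _)%E.
    by rewrite !unlock EFinN.
  - by apply: emeasurable_funM => //; apply/measurable_EFinP; exact: measurable_npdf.
  - by move=> x; rewrite mule_ge0// lee_fin npdf_ge0.
have /Lfun1_integrable iX := gaussian_law_Lfun1 _ _ lX.
rewrite unlock integralE.
have -> : (\int[Q]_x (EFin \o X)^\+ x = \int[Q]_x (EFin \o X)^\- x)%E.
  by move: sym; rewrite !unlock.
rewrite subee//; exact: integrable_neg_fin_num.
Qed.

Lemma gaussian_law_variance X v : gaussian_law X v -> ('V_Q[X] = v%:E)%E.
Proof.
move=> lX; rewrite varianceE; last exact: gaussian_law_Lfun2 lX.
rewrite (gaussian_law_mean _ _ lX) expe2 mule0 sube0 unlock.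
exact: gaussian_law_second_moment.
Qed.

End GaussianVariable.

Section GaussianSpace.
Context {d : measure_display} {Omega : measurableType d} {R : realType}.
Variable Q : probability Omega R.

Definition gaussian_space (GS : set (Omega -> R)) :=
  [/\ forall X, GS X -> exists v, gaussian_law Q X v, GS (fun=> 0) &
    forall (a : R) X Y, GS X -> GS Y -> GS (fun w => a * X w + Y w)].

Variable GS : set (Omega -> R).
Hypothesis hGS : gaussian_space GS.

Let GS_law X : GS X -> gaussian_law Q X (fine 'V_Q[X]%E).
Proof.
case: hGS => + _ _ => /[apply] -[v lX].
by rewrite (gaussian_law_variance _ _ _ lX).
Qed.

Let GS0 : GS (fun=> 0). Proof. by case: hGS. Qed.

Let GSD a X Y : GS X -> GS Y -> GS (fun w => a * X w + Y w).
Proof. by case: hGS => _ _; exact. Qed.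

Let GSZ a X : GS X -> GS (fun w => a * X w).
Proof. by move=> /GSD /(_ GS0) => /(_ a); under eq_fun do rewrite addr0. Qed.

Let GSm X : GS X -> measurable_fun setT X.
Proof. by move=> /GS_law[]. Qed.

Let GS1 X : GS X -> X \in Lfun Q 1.
Proof. by move=> /GS_law/gaussian_law_Lfun1. Qed.

Let GS2 X : GS X -> X \in Lfun Q 2%:E.
Proof. by move=> /GS_law/gaussian_law_Lfun2. Qed.

Let GSM X Y : GS X -> GS Y -> (X * Y)%R \in Lfun Q 1.
Proof. by move=> gX gY; apply: Lfun2_mul_Lfun1; exact: GS2. Qed.

Let cov_lin a X Y Z : GS X -> GS Y -> GS Z ->
  covariance Q Z (fun w => a * X w + Y w) =
  (a%:E * covariance Q Z X + covariance Q Z Y)%E.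
Proof.
move=> gX gY gZ.
have aXE : (fun w => a * X w) = a \o* X by apply/funext => w /=; rewrite mulrC.
have gaX := GSZ a _ gX; rewrite aXE in gaX.
have -> : (fun w => a * X w + Y w) = a \o* X \+ Y.
  by apply/funext => w /=; rewrite mulrC.
rewrite covarianceDr; [|exact: GS2..].
by rewrite covarianceZr//; [exact: GS1|exact: GS1|exact: GSM].
Qed.

Let var_sum X Y : GS X -> GS Y -> covariance Q X Y = 0%E ->
  ('V_Q[fun w => (X w + Y w)%R] = 'V_Q[X] + 'V_Q[Y])%E.
Proof.
move=> gX gY cXY.
have := @varianceD _ _ _ Q _ _ (GS2 _ gX) (GS2 _ gY).
by rewrite cXY mule0 adde0.
Qed.

Section Independence.
Context {I : Type} (S : set I) (X : Omega -> R) (Y : S -> Omega -> R).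
Hypotheses (gX : GS X) (gY : forall i, GS (Y i))
  (cXY : forall i, covariance Q X (Y i) = 0%E).

(* Independence: the laws of (X, Y) and (X, Y'), with Y' an independent copy of Y,
   are compared on the linear forms over R^(option S). *)
Let all := [set: option S].
Let pt (o : option S) : all := exist _ o (mem_set (Logic.I : all o)).

Let join (w : Omega * Omega) : path_space R all := fun o =>
  match val o with None => X w.1 | Some i => Y i w.2 end.

Let unjoin (z : path_space R all) : R * path_space R S :=
  (z (pt None), fun i => z (pt (Some i))).

Let measurable_join : measurable_fun setT join.
Proof.
apply: measurable_path => -[[i|] io]; rewrite /join /=.
  exact: (measurableT_comp (GSm _ (gY i))).
exact: (measurableT_comp (GSm _ gX)).
Qed.

Let diag (w : Omega) := (w, w).

Let measurable_diag : measurable_fun setT diag.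
Proof. exact: measurable_fun_pair. Qed.

Let measurable_unjoin : measurable_fun setT unjoin.
Proof.
apply: measurable_fun_pair => /=; first exact: measurable_coordinate.
by apply: measurable_path => i; exact: measurable_coordinate.
Qed.

Let linear_form_join s : exists a L, [/\ GS L, covariance Q X L = 0%E &
  forall w, linear_form all s (join w) = a * X w.1 + L w.2].
Proof.
elim: s => [|[[k ka] c] s [a [L [gL cXL LE]]]].
  exists 0, (fun=> 0); split => //.
    have := covariance_cst_r; exact.
  by move=> w; rewrite /linear_form big_nil mul0r addr0.
case: k ka => [i|] ka.
  exists a, (fun w => c * Y i w + L w); split.
  - exact: GSD.
  - by rewrite cov_lin// cXY cXL mule0 adde0.
  - move=> w; rewrite /linear_form big_cons -/(linear_form all s (join w)) LE.
    by rewrite /join/=; ring.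
exists (c + a), L; split => // w.
rewrite /linear_form big_cons -/(linear_form all s (join w)) LE.
by rewrite /join/=; ring.
Qed.

(** Both laws are centred normal with variance u + v: on the diagonal because a X and L are
    uncorrelated members of the Gaussian space, on the product because the law is the convolution of
    theirs. *)
Let law_linear_form_join s (A : set R) : measurable A ->
  Q ((linear_form all s \o join \o diag) @^-1` A) =
  (Q \x Q)%E ((linear_form all s \o join) @^-1` A).
Proof.
move=> mA; have [a [L [gL cXL LE]]] := linear_form_join s.
have gaX := GSZ a _ gX.
have gaXL := GSD a _ _ gX gL.
have lX := GS_law _ gaX; have lL := GS_law _ gL; have laXL := GS_law _ gaXL.
set u := fine _ in lX; set v := fine _ in lL; set uv := fine _ in laXL.
have uvE : uv = u + v.
  rewrite /uv /u /v var_sum//.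
    by rewrite fineD//; rewrite variance_fin_num//; exact: GS2.
  rewrite -[covariance _ _ _](_ : covariance Q L (fun w => a * X w + 0) = _).
    rewrite cov_lin// covarianceC cXL mule0 add0e.
    by have := covariance_cst_r; exact.
  by rewrite covarianceC; congr covariance; apply/funext => w; rewrite addr0.
have [mL v0 _] := lL; have [maX u0 _] := lX.
pose f x : \bar R := (\1_A x)%:E.
have mf : measurable_fun setT f by apply/measurable_EFinP.
have f0 x : (0 <= f x)%E by rewrite lee_fin.
have [maXL _ lawE] := laXL.
transitivity (centred_normal uv A).
  rewrite -lawE//; congr (Q _); apply/funext => w /=.
  by rewrite /preimage/= LE.
transitivity (\int[centred_normal uv]_x f x)%E.
  by rewrite integral_indic// setIT.
rewrite uvE -centred_normal_convolution//.
rewrite -(ge0_integral_gaussian_law _ _ _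
  (fun x => \int[centred_normal v]_y f (x + y)%R)%E lX); first last.
- by move=> x; apply: integral_ge0 => y _.
- apply: (@measurable_fun_fubini_tonelli_F _ _ _ _ _ (centred_normal v)
    (fun z : R * R => f (z.1 + z.2))) => //.
  by apply: (measurableT_comp mf); exact: measurable_funD.
apply: eq_integral => w _ /=.
rewrite -(ge0_integral_gaussian_law _ _ _ (fun y => f (a * X w + y)) lL)//; last first.
  by apply: (measurableT_comp mf); exact: measurable_funD.
have mB : measurable ((fun w' => a * X w + L w') @^-1` A).
  rewrite -[X in measurable X]setTI.
  have : measurable_fun setT (fun w' => a * X w + L w') by exact: measurable_funD.
  exact.
transitivity (\int[Q]_w' (\1_((fun w' => a * X w + L w') @^-1` A) w')%:E)%E.
  by apply: eq_integral => w' _; rewrite /f !indicE; congr (_%:R%:E).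
rewrite integral_indic// setIT; congr (Q _).
by apply/seteqP; split => w' /=; rewrite /xsection/= inE /= LE.
Qed.

Lemma uncorrelated_gaussian_indep (f : R * path_space R S -> \bar R) :
  measurable_fun setT f -> (forall x, 0 <= f x)%E ->
  (\int[Q]_w f (X w, fun i => Y i w) =
   \int[Q]_w \int[Q]_w' f (X w, fun i => Y i w'))%E.
Proof.
move=> mf f0.
have mj := measurable_join; have md := measurable_diag; have mu := measurable_unjoin.
have mjd : measurable_fun setT (join \o diag) by exact: measurableT_comp.
have mfu : measurable_fun setT (f \o unjoin) by exact: measurableT_comp.
transitivity (\int[pushforward Q (join \o diag)]_z f (unjoin z))%E.
  by rewrite ge0_integral_pushforward.
transitivity (\int[pushforward (Q \x Q)%E join]_z f (unjoin z))%E.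
  apply: eq_measure_integral => A mA _.
  apply: cramer_wold => //.
    by rewrite -[ltLHS]/(Q setT) probability_setT ltry.
rewrite ge0_integral_pushforward// preimage_setT fubini_tonelli1//.
  exact: (measurableT_comp mfu).
by move=> w; exact: f0.
Qed.

End Independence.

Lemma uncorrelated_gaussian_indep2 X L (f : R * R -> \bar R) :
  GS X -> GS L -> covariance Q X L = 0%E ->
  measurable_fun setT f -> (forall x, 0 <= f x)%E ->
  (\int[Q]_w f (X w, L w) = \int[Q]_w \int[Q]_w' f (X w, L w'))%E.
Proof.
move=> gX gL cXL mf f0.
pose u : [set: unit] := exist _ tt (mem_set (Logic.I : [set: unit] tt)).
have := @uncorrelated_gaussian_indep unit setT X (fun=> L) gX (fun=> gL)
  (fun=> cXL) (fun z => f (z.1, z.2 u)).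
apply => //; apply: (measurableT_comp mf).
apply: measurable_fun_pair => //=.
exact: (measurableT_comp (measurable_coordinate setT u)).
Qed.

(** Regression of L on X: L = L' + (c / v) X with L' uncorrelated with X, hence independent of it.
    With L' frozen, the claim is the translation formula for the one-dimensional law of X. *)
Let shift_law X L (A : set R) : GS X -> GS L -> measurable A ->
  (\int[Q]_w (\1_A (L w + fine (covariance Q X L)))%:E =
   \int[Q]_w ((expR (X w - fine 'V_Q[X] / 2))%:E * (\1_A (L w))%:E))%E.
Proof.
move=> gX gL mA; have lX := GS_law _ gX.
set v := fine _ in lX; set c := fine (covariance _ _ _).
have [mX v0 _] := lX.
pose f x : \bar R := (\1_A x)%:E.
have mf : measurable_fun setT f by apply/measurable_EFinP.
have f0 x : (0 <= f x)%E by rewrite lee_fin.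
have vE : ('V_Q[X] = v%:E)%E.
  by rewrite fineK// variance_fin_num//; exact: GS2.
have cE : covariance Q X L = c%:E.
  by rewrite fineK// covariance_fin_num//; [exact: GS1|exact: GS1|exact: GSM].
rewrite vE /=; move: v0; rewrite le_eqVlt => /predU1P[v0|v0].
  have X0 : {ae Q, forall w, X w = 0}.
    exists (X @^-1` [set~ 0]); split => //.
    - rewrite -[X in measurable X]setTI; apply: mX => //.
      exact: measurableC.
    - have [_ _ ->] := lX; last exact: measurableC.
      rewrite -v0 /centred_normal eqxx /= diracE memNset//= => H; exact: H.
  (* The Cauchy-Schwarz inequality bounds the covariances of X with L and with - L above by 0. *)
  have c0 : c = 0.
    have bound Z : GS Z -> (covariance Q X Z <= 0)%E.
      move=> gZ; apply: le_trans (covariance_le (GS2 _ gX) (GS2 _ gZ)) _.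
      by rewrite vE -v0 sqrte0 mul0e.
    have := bound _ gL; have := bound _ (GSD (-1) _ _ gL GS0).
    rewrite cov_lin// covariance_cst_r adde0 cE -EFinM !lee_fin mulN1r.
    by move=> ? ?; lra.
  rewrite c0 -v0; apply: ae_eq_integral => //.
  - by apply: (measurableT_comp mf); apply: measurable_funD => //; exact: GSm.
  - apply: emeasurable_funM; last by apply: (measurableT_comp mf); exact: GSm.
    by apply/measurable_EFinP; apply: measurableT_comp => //; exact: measurable_funB.
  - by apply: filterS X0 => w -> _; rewrite mul0r subr0 expR0 mul1e addr0.
pose b := - (c / v); pose L' w := b * X w + L w.
have gL' : GS L' by exact: GSD.
have cXL' : covariance Q X L' = 0%E.
  rewrite cov_lin// cE.
  have -> : covariance Q X X = v%:E by [].
  by rewrite -EFinM -EFinD /b mulNr divfK ?gt_eqF// addNr.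
transitivity (\int[Q]_w \int[Q]_w' f (L' w' - b * X w + c)%R)%E.
  rewrite -(uncorrelated_gaussian_indep2 X L' (fun z => f (z.2 - b * z.1 + c)))//.
    by apply: eq_integral => w _; rewrite /f /L' /=; congr (\1_A _)%:E; ring.
  apply: (measurableT_comp mf); apply: measurable_funD => //.
  by apply: measurable_funB => //; exact: measurable_funM.
transitivity (\int[Q]_w \int[Q]_w'
    ((expR (X w - v / 2))%:E * f (L' w' - b * X w)%R))%E; last first.
  rewrite -(uncorrelated_gaussian_indep2 X L'
    (fun z : R * R => (expR (z.1 - v / 2))%:E * f (z.2 - b * z.1)%R)%E)//.
  - by apply: eq_integral => w _; rewrite /f /L' /=; congr (_ * (\1_A _)%:E)%E; ring.
  - apply: emeasurable_funM; last first.
      apply: (measurableT_comp mf).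
      by apply: measurable_funB => //; exact: measurable_funM.
    by apply/measurable_EFinP; apply: measurableT_comp => //; exact: measurable_funB.
  - by move=> z; rewrite mule_ge0// lee_fin expR_ge0.
have mL' := GSm _ gL'.
have m1 : measurable_fun setT (fun z : Omega * Omega => f (L' z.2 - b * X z.1 + c)).
  apply: (measurableT_comp mf); apply: measurable_funD => //.
  apply: measurable_funB; first exact: (measurableT_comp mL').
  by apply: measurable_funM => //; exact: (measurableT_comp mX).
have m2 : measurable_fun setT (fun z : Omega * Omega =>
    (expR (X z.1 - v / 2))%:E * f (L' z.2 - b * X z.1)%R)%E.
  apply: emeasurable_funM.
    apply/measurable_EFinP; apply: measurableT_comp => //.
    by apply: measurable_funB => //; exact: (measurableT_comp mX).
  apply: (measurableT_comp mf).
  apply: measurable_funB; first exact: (measurableT_comp mL').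
  by apply: measurable_funM => //; exact: (measurableT_comp mX).
rewrite (fubini_tonelli (m1 := Q) (m2 := Q) _ m1)/=; last by move=> z; exact: f0.
rewrite (fubini_tonelli (m1 := Q) (m2 := Q) _ m2)/=; last first.
  by move=> z; rewrite mule_ge0// lee_fin expR_ge0.
apply: eq_integral => w' _.
pose g x := f (L' w' - b * x).
have mg : measurable_fun setT g.
  by apply: (measurableT_comp mf); apply: measurable_funB.
have me : measurable_fun setT (fun x : R => (expR (x - v / 2))%:E).
  by apply/measurable_EFinP; apply: measurableT_comp => //; exact: measurable_funB.
(* As - b v = c, raising the argument by c amounts to translating X by its variance inside g. *)
transitivity (\int[Q]_w (g (X w + v)%R))%E.
  apply: eq_integral => w _; rewrite /g /b; congr f; field.
  by rewrite gt_eqF.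
rewrite (ge0_integral_gaussian_law _ _ _ (fun x => g (x + v)) lX); first last.
- by move=> x; exact: f0.
- by apply: (measurableT_comp mg); exact: measurable_funD.
rewrite (ge0_integral_gaussian_law _ _ _
  (fun x => (expR (x - v / 2))%:E * g x)%E lX); first last.
- by move=> x; rewrite mule_ge0// ?lee_fin ?expR_ge0// f0.
- exact: emeasurable_funM.
apply: etrans (centred_normal_translate _ _ _ v0 mg (fun x => f0 _)) _.
apply: eq_integral => x _; congr ((expR _)%:E * _)%E; field.
by rewrite gt_eqF.
Qed.

Section Shift.
Context {I : Type} (S : set I) (X : Omega -> R) (Y : S -> Omega -> R).
Variables (v : R) (c : S -> R).
Hypotheses (gX : GS X) (gY : forall i, GS (Y i))
  (vX : ('V_Q[X] = v%:E)%E) (cXY : forall i, covariance Q X (Y i) = (c i)%:E).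

Let mw : measurable_fun setT (fun w => expR (X w - v / 2)).
Proof. by apply: measurableT_comp => //; apply: measurable_funB => //; exact: GSm. Qed.

Let w0 w : 0 <= expR (X w - v / 2). Proof. exact: expR_ge0. Qed.

Let linear_form_shift s : exists L C, [/\ GS L, covariance Q X L = C%:E,
  forall w, linear_form S s (fun i => Y i w) = L w &
  forall w, linear_form S s (fun i => Y i w + c i) = L w + C].
Proof.
elim: s => [|[i a] s [L [C [gL cL LE LCE]]]].
  exists (fun=> 0), 0; split => //.
  - exact: covariance_cst_r.
  - by move=> w; rewrite /linear_form big_nil.
  - by move=> w; rewrite /linear_form big_nil addr0.
exists (fun w => a * Y i w + L w), (a * c i + C); split.
- exact: GSD.
- by rewrite cov_lin// cXY cL -EFinM -EFinD.
- by move=> w; rewrite -LE /linear_form big_cons.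
- move=> w; rewrite /linear_form big_cons.
  by rewrite -/(linear_form S s (fun i => Y i w + c i)) LCE/=; ring.
Qed.

(** The Cameron-Martin formula: shifting each Y_i by its covariance with X has density exp(X - v /
    2). The law of the shifted process and the reweighted law agree on linear forms by [shift_law],
    hence everywhere. *)
Theorem gaussian_shift (f : path_space R S -> \bar R) :
  measurable_fun setT f -> (forall x, 0 <= f x)%E ->
  (\int[Q]_w f (fun i => (Y i w + c i)%R) =
   \int[Q]_w ((expR (X w - v / 2))%:E * f (fun i => Y i w)))%E.
Proof.
move=> mf f0.
pose Z w : path_space R S := fun i => Y i w.
pose Zc w : path_space R S := fun i => Y i w + c i.
have mZ : measurable_fun setT Z by apply: measurable_path => i; exact: GSm _ (gY i).
have mZc : measurable_fun setT Zc.
  by apply: measurable_path => i; apply: measurable_funD => //; exact: GSm _ (gY i).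
rewrite -[LHS]/(\int[Q]_w (f \o Zc) w)%E.
rewrite -[X in X = _](_ : \int[pushforward Q Zc]_z f z = _)%E; last first.
  by rewrite ge0_integral_pushforward.
have mfZ : measurable_fun setT (f \o Z) by exact: measurableT_comp.
have fZ0 w : (0 <= (f \o Z) w)%E by exact: f0.
rewrite -(integral_density_measure Q _ mw w0 (f \o Z) mfZ fZ0).
rewrite -[X in _ = X](_ : \int[pushforward (density_measure Q _ mw w0) Z]_z f z = _)%E;
  last first.
  by rewrite ge0_integral_pushforward.
apply: eq_measure_integral => A mA _.
apply: cramer_wold => //.
  by rewrite -[ltLHS]/(Q setT) probability_setT ltry.
move=> s B mB.
have [L [C [gL cL LE LCE]]] := linear_form_shift s.
have mL := GSm _ gL.
have ind (D : set R) (h : Omega -> R) : measurable D -> measurable_fun setT h ->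
    (\int[Q]_w (\1_D (h w))%:E = Q (h @^-1` D))%E.
  move=> mD mh; have mhD : measurable (h @^-1` D).
    by rewrite -[X in measurable X]setTI; exact: mh.
  rewrite -[X in Q X]setIT -integral_indic//.
transitivity (Q ((fun w => L w + C) @^-1` B)).
  by congr (Q _); apply/seteqP; split => w; rewrite /= LCE.
rewrite -ind//; last exact: measurable_funD.
have := shift_law _ _ _ gX gL mB; rewrite cL vX /= => ->.
rewrite -[RHS]/(\int[Q]_(w in Z @^-1` (linear_form S s @^-1` B))
  (expR (X w - v / 2))%:E)%E.
rewrite [RHS]integral_mkcond; apply: eq_integral => w _.
rewrite epatch_indic; congr (_ * (_%:R)%:E)%E; congr nat_of_bool.
by apply/idP/idP => /set_mem H; apply/mem_set; move: H; rewrite /= LE.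
Qed.

End Shift.
End GaussianSpace.

(** * Smoothed and truncated losses *)

Lemma le_limn_einf {R : realType} (u : nat -> \bar R) (a : \bar R) :
  (\forall n \near \oo, (a <= u n)%E) -> (a <= limn_einf u)%E.
Proof.
move=> [N _ aN]; rewrite limn_einf_lim (cvg_lim _ (@cvg_einfs_sup _ u))//.
apply: (@le_trans _ _ (einfs u N)); last by apply: ereal_sup_ubound; exists N.
by apply: le_ereal_inf_tmp => _ [n /= Nn <-]; exact: aN.
Qed.

Lemma limn_einf_le {R : realType} (u : nat -> \bar R) (a : \bar R) :
  (forall n, (u n <= a)%E) -> (limn_einf u <= a)%E.
Proof.
move=> ua; rewrite limn_einf_lim (cvg_lim _ (@cvg_einfs_sup _ u))//.
apply: ge_ereal_sup => _ [n _ <-]; apply: le_trans (ua n).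
by apply: ereal_inf_lbound; exists n => /=.
Qed.

Lemma ge0_ereal_between {R : realType} (x y : \bar R) : (0 <= x)%E -> (x < y)%E ->
  exists r : R, (x < r%:E)%E /\ (r%:E < y)%E.
Proof.
case: x y => [x| |] [y| |]//; rewrite ?lee_fin ?lte_fin => x0 xy.
  by exists ((x + y) / 2); rewrite !lte_fin; split; lra.
by exists (x + 1); rewrite lte_fin ltry; split => //; lra.
Qed.

Lemma lower_semicontinuous_limn_einf {R : realType} (f : R -> \bar R)
    (u : nat -> R) (c : R) : lower_semicontinuous f -> (forall x, 0 <= f x)%E ->
  u n @[n --> \oo] --> c -> (f c <= limn_einf (fun n => f (u n)))%E.
Proof.
move=> lsc f0 uc; rewrite leNgt; apply/negP => H.
have [|r [r1 r2]] := ge0_ereal_between _ _ _ H.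
  by apply: le_limn_einf; apply: nearW => n.
suff : (r%:E <= limn_einf (fun n => f (u n)))%E by rewrite leNgt r1.
apply: le_limn_einf; have [V Vc Vr] := lsc _ _ r2.
have uV : \forall n \near \oo, V (u n) := uc _ Vc.
by apply: filterS uV => n /Vr /ltW.
Qed.

Section BowlShapedSmoothing.
Context {R : realType}.
Local Notation leb := (@lebesgue_measure R).

Lemma centred_normal_symmetric (v : R) (f : R -> \bar R) : 0 <= v ->
  measurable_fun setT f -> (forall x, 0 <= f x)%E ->
  (\int[centred_normal v]_x f (- x)%R = \int[centred_normal v]_x f x)%E.
Proof.
move=> v0 mf f0.
have mfN : measurable_fun setT (fun x : R => f (- x)) by exact: measurableT_comp.
have fN0 x : (0 <= f (- x)%R)%E by exact: f0.
move: v0; rewrite le_eqVlt => /predU1P[<-|v0].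
  rewrite (integral_centred_normal0 _ mfN fN0) (integral_centred_normal0 _ mf f0).
  by rewrite oppr0.
rewrite (integral_centred_normal _ _ v0 mfN fN0) (integral_centred_normal _ _ v0 mf f0).
rewrite -(ge0_integral_reflect 0).
- by apply: eq_integral => x _; rewrite sub0r opprK npdfN.
- by apply: emeasurable_funM => //; apply/measurable_EFinP; exact: measurable_npdf.
- by move=> x; rewrite mule_ge0// lee_fin npdf_ge0.
Qed.

(** Adding the integrals of (c + g)^2 and (c - g)^2, equal by symmetry, removes the cross term
    before anything is integrated, so that all integrands stay nonnegative. *)
Lemma smoothed_square_loss (v : R) (c : R) : 0 <= v ->
  smoothed_loss (fun x : R => (x ^+ 2)%:E) v c = (c ^+ 2 + v)%:E.
Proof.
move=> v0; rewrite /smoothed_loss; set A := (\int[_]_g _)%E.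
have mq (e : R) : measurable_fun setT (fun g : R => ((c + e * g) ^+ 2)%:E).
  by apply/measurable_EFinP; apply: measurable_funX; apply: measurable_funD.
have q0 (x : R) : (0 <= (x ^+ 2)%:E)%E by rewrite lee_fin sqr_ge0.
have AE : A = (\int[centred_normal v]_g ((c + 1 * g) ^+ 2)%:E)%E.
  by apply: eq_integral => g _; rewrite mul1r.
have AN : A = (\int[centred_normal v]_g ((c + -1 * g) ^+ 2)%:E)%E.
  rewrite AE -(centred_normal_symmetric _ (fun g => ((c + 1 * g) ^+ 2)%:E))//;
    try exact: (mq 1).
  by apply: eq_integral => g _; rewrite mul1r mulN1r.
have : (A + A = (2 * (c ^+ 2 + v))%:E)%E.
  rewrite {1}AE AN -ge0_integralD//; try exact: mq.
  transitivity (\int[centred_normal v]_g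
      ((2 * c ^+ 2)%:E + 2%:E * (g ^+ 2)%:E))%E.
    by apply: eq_integral => g _; rewrite -EFinM -!EFinD; congr EFin; ring.
  rewrite ge0_integralD//.
  - rewrite integral_cst// [X in (_ * X)%E]probability_setT mule1.
    rewrite ge0_integralZl//.
    + by rewrite second_moment_centred_normal// -EFinM -EFinD; congr EFin; ring.
    + by apply/measurable_EFinP; exact: measurable_funX.
  - by move=> x _; rewrite lee_fin mulr_ge0// sqr_ge0.
  - by move=> x _; rewrite mule_ge0.
  - by apply: measurable_funeM; apply/measurable_EFinP; exact: measurable_funX.
case: A {AE AN} => [a| |] //=.
by rewrite -EFinD => -[] ?; congr EFin; lra.
Qed.

Variable l : R -> \bar R.
Hypotheses (hl : bowl_shaped l) (lsc : lower_semicontinuous l).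

Let l0 x : (0 <= l x)%E. Proof. by have [+ _ _] := hl. Qed.
Let lN x : l (- x) = l x. Proof. by have [_ + _] := hl. Qed.
Let lle x y : `|x| <= `|y| -> (l x <= l y)%E. Proof. by have [_ _] := hl; exact. Qed.

Let ml : measurable_fun setT l.
Proof. exact: lower_semicontinuous_measurable. Qed.

Section Kernel.
Variable p : R -> R.
Hypotheses (mp : measurable_fun setT p) (p0 : forall x, 0 <= p x)
  (ple : forall x y, `|x| <= `|y| -> p y <= p x).

(** The kernel is even and nonincreasing in the magnitude, of arbitrary mass: this covers the normal
    density and its truncations. *)
Definition kernel_loss c : \bar R := (\int[leb]_g ((p g)%:E * l (c + g)%R))%E.

Let pN x : p (- x) = p x.
Proof. by apply/eqP; rewrite eq_le !ple// normrN. Qed.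

Let mr a : measurable_fun setT (fun x : R => l (a - x)).
Proof. by apply: (measurableT_comp ml); exact: measurable_funB. Qed.

Let mpt a : measurable_fun setT (fun x : R => (p (x + a))%:E).
Proof.
by apply/measurable_EFinP; apply: (measurableT_comp mp); exact: measurable_funD.
Qed.

Let mpl c : measurable_fun setT (fun g : R => ((p g)%:E * l (c + g)%R)%E).
Proof.
apply: emeasurable_funM; first exact/measurable_EFinP.
by apply: (measurableT_comp ml); exact: measurable_funD.
Qed.

Let pl0 a b : (0 <= (p a)%:E * l b)%E.
Proof. by rewrite mule_ge0// lee_fin. Qed.

Let kernel_loss_translate c :
  kernel_loss c = (\int[leb]_x ((p (x - c))%:E * l x))%E.
Proof.
rewrite -[RHS](ge0_integral_translate c)//.
- by apply: eq_integral => x _; rewrite addrK addrC.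
- by apply: emeasurable_funM => //; exact: mpt.
Qed.

Let kernel_loss_reflect c e :
  kernel_loss c = (\int[leb]_x ((p (x - e))%:E * l (c + e - x)%R))%E.
Proof.
rewrite kernel_loss_translate -(ge0_integral_reflect (c + e))//.
- apply: eq_integral => x _; congr (_%:E * _)%E.
  by rewrite -pN; congr p; ring.
- by apply: emeasurable_funM => //; exact: mpt.
Qed.

Let rearrange (a b : R) (s t : \bar R) : 0 <= a -> a <= b -> (0 <= t)%E ->
  (t <= s)%E -> (a%:E * s + b%:E * t <= b%:E * s + a%:E * t)%E.
Proof.
move=> a0 ab t0 ts; have b0 := le_trans a0 ab.
case: s t t0 ts => [s| |] [t| |]//.
- by rewrite -!EFinM -!EFinD !lee_fin => t0 ts; nra.
- move=> t0 _; move: b0; rewrite le_eqVlt => /predU1P[b0|b0].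
    have -> : a = 0 by apply/eqP; rewrite eq_le a0 b0 ab.
    by rewrite -b0.
  by rewrite [X in (_ <= X + _)%E]gt0_muley ?lte_fin// -EFinM addye// leey.
- by move=> _ _; rewrite addeC.
Qed.

(** Twice each side is written as one integral, using the reflection x |-> c + e - x that exchanges
    c and e. The integrands then compare pointwise by the rearrangement inequality: on the side of
    the midpoint nearer to e, both p(x - e) >= p(x - c) and l(x) >= l(c + e - x), and both are
    reversed on the other side. *)
Let kernel_loss_le_ge0 c e : 0 <= c -> c <= e ->
  (kernel_loss c <= kernel_loss e)%E.
Proof.
move=> c0 ce.
have : (kernel_loss c + kernel_loss c <= kernel_loss e + kernel_loss e)%E.
  rewrite {1}(kernel_loss_translate c) (kernel_loss_reflect c e).
  rewrite {1}(kernel_loss_translate e) (kernel_loss_reflect e c).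
  have mA a b : measurable_fun setT (fun x : R => ((p (x - a))%:E * l (b - x)%R)%E).
    by apply: emeasurable_funM => //; exact: mpt.
  have mB a : measurable_fun setT (fun x : R => ((p (x - a))%:E * l x)%E).
    by apply: emeasurable_funM => //; exact: mpt.
  rewrite -!ge0_integralD//; try exact: mA; try exact: mB.
  apply: ge0_le_integral => //.
  - by move=> x _; rewrite adde_ge0.
  - by apply: emeasurable_funD; [exact: mB|exact: mA].
  - by apply: emeasurable_funD; [exact: mB|exact: mA].
  move=> x _; rewrite (addrC e c).
  have [xm|xm] := leP (c + e) (2 * x).
    apply: rearrange => //.
      apply: ple; rewrite [leRHS]ger0_norm; last lra.
      by rewrite ler_norml; apply/andP; split; lra.
    apply: lle; rewrite [leRHS]ger0_norm; last lra.
    by rewrite ler_norml; apply/andP; split; lra.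
  rewrite addeC [leRHS]addeC; apply: rearrange => //.
    apply: ple; rewrite [leRHS]ler0_norm; last lra.
    by rewrite ler_norml; apply/andP; split; lra.
  apply: lle; rewrite [leRHS]ger0_norm; last lra.
  by rewrite ler_norml; apply/andP; split; lra.
have K0 a : (0 <= kernel_loss a)%E by apply: integral_ge0 => x _.
move: (kernel_loss c) (kernel_loss e) (K0 c) (K0 e) => [x| |] [y| |]//.
- by rewrite -!EFinD !lee_fin => _ _ ?; lra.
- by move=> *; rewrite leey.
Qed.

Lemma bowl_shaped_kernel_loss : bowl_shaped kernel_loss.
Proof.
have KN c : kernel_loss (- c) = kernel_loss c.
  rewrite /kernel_loss -(ge0_integral_reflect 0)//.
  apply: eq_integral => x _; rewrite sub0r pN; congr (_ * _)%E.
  by rewrite -lN; congr l; ring.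
have Kn c : kernel_loss `|c| = kernel_loss c.
  by have [//|_] := ger0P c; rewrite KN.
split => //; first by move=> c; apply: integral_ge0 => x _.
move=> x y xy; rewrite -(Kn x) -(Kn y); exact: kernel_loss_le_ge0.
Qed.

(** Fatou's lemma along u_n = c (1 - 1/(n + 1)) finds a point of smaller magnitude at which the
    value still exceeds a; monotonicity in the magnitude then carries the bound to the neighbourhood
    |y| > |u_n| of c. At c = 0 the value is the minimum. *)
Lemma lower_semicontinuous_kernel_loss : lower_semicontinuous kernel_loss.
Proof.
have [_ _ Kle] := bowl_shaped_kernel_loss.
move=> c a ac.
pose u n : R := c * (1 - n.+1%:R^-1).
have uc : u n @[n --> \oo] --> c.
  rewrite -[X in _ --> X]mulr1 /u; apply: cvgM; first exact: cvg_cst.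
  rewrite -[X in _ --> X]subr0; apply: cvgB; first exact: cvg_cst.
  exact: cvg_harmonic.
have [n an] : exists n, (a%:E < kernel_loss (u n))%E.
  apply: contrapT => /forallNP H.
  have {}H n : (kernel_loss (u n) <= a%:E)%E by rewrite leNgt; exact/negP/H.
  suff : (kernel_loss c <= a%:E)%E by rewrite leNgt ac.
  apply: (@le_trans _ _ (\int[leb]_g limn_einf (fun n => (p g)%:E * l (u n + g)%R))%E).
    apply: ge0_le_integral => //.
    - exact: mpl.
    - apply: (measurableT_comp (@oppe_measurable R setT)) => //.
      apply: measurable_fun_limn_esup => n.
      by apply: (measurableT_comp (@oppe_measurable R setT)) => //; exact: mpl.
    - move=> g _; have := p0 g; rewrite le_eqVlt => /predU1P[<-|pg].
        by rewrite mul0e; apply: le_limn_einf; apply: nearW => n; rewrite mul0e.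
      have lscg : lower_semicontinuous (fun x => (p g)%:E * l (x + g)%R)%E.
        move=> x b bx; have bx' : ((b / p g)%:E < l (x + g)%R)%E.
          by rewrite EFinM lte_pdivrMr// muleC.
        have [V Vx Vb] := lsc _ _ bx'.
        exists ((fun y => y + g) @^-1` V).
          have : (fun y : R => y + g) @ x --> x + g.
            by apply: cvgD; [exact: cvg_id|exact: cvg_cst].
          exact.
        by move=> y /= /Vb; rewrite EFinM lte_pdivrMr// muleC.
      apply: (lower_semicontinuous_limn_einf _ _ _ lscg) => //.
  apply: le_trans (fatou _ _ _ _) _ => //.
    by move=> n; exact: mpl.
  exact: limn_einf_le.
have [c0|c0] := eqVneq c 0.
  exists setT; first exact: filterT.
  by move=> y _; apply: lt_le_trans ac _; apply: Kle; rewrite c0 normr0.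
have unc : `|u n| < `|c|.
  rewrite normrM -[ltRHS]mulr1 ltr_pM2l ?normr_gt0//.
  rewrite ger0_norm; last by rewrite subr_ge0 invf_le1// ler1n.
  by rewrite ltrBlDr ltrDl invr_gt0.
exists [set y | `|u n| < `|y|].
  have : (fun y : R => `|y|) @ c --> `|c| by apply: cvg_norm; exact: cvg_id.
  by move=> /cvgr_gt; apply.
move=> y /= uy; apply: lt_le_trans an _.
by apply: Kle; exact: ltW.
Qed.

End Kernel.

Lemma smoothed_loss0 : smoothed_loss l 0 = l.
Proof.
apply/funext => c; rewrite /smoothed_loss.
have mlc : measurable_fun setT (fun g : R => l (c + g)).
  by apply: (measurableT_comp ml); exact: measurable_funD.
rewrite (integral_centred_normal0 _ mlc) ?addr0// => x.
Qed.

Lemma smoothed_lossE (v : R) : 0 < v -> smoothed_loss l v = kernel_loss (npdf v).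
Proof.
move=> v0; apply/funext => c; rewrite /smoothed_loss.
apply: integral_centred_normal => //.
by apply: (measurableT_comp ml); exact: measurable_funD.
Qed.

Lemma bowl_shaped_smoothed_loss (v : R) : 0 <= v -> bowl_shaped (smoothed_loss l v).
Proof.
rewrite le_eqVlt => /predU1P[<-|v0]; first by rewrite smoothed_loss0.
rewrite smoothed_lossE//; apply: bowl_shaped_kernel_loss.
- exact: measurable_npdf.
- exact: npdf_ge0.
- by move=> x y; exact: npdf_le.
Qed.

Lemma lower_semicontinuous_smoothed_loss (v : R) : 0 <= v ->
  lower_semicontinuous (smoothed_loss l v).
Proof.
rewrite le_eqVlt => /predU1P[<-|v0]; first by rewrite smoothed_loss0.
rewrite smoothed_lossE//; apply: lower_semicontinuous_kernel_loss.
- exact: measurable_npdf.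
- exact: npdf_ge0.
- by move=> x y; exact: npdf_le.
Qed.

(** Bounded support confines the shifts that enter the average to a bounded interval, while the
    kernel stays even and nonincreasing in the magnitude. *)
Definition truncated_npdf (v : R) (n : nat) (x : R) : R :=
  if `|x| <= n%:R then npdf v x else 0.

Lemma measurable_truncated_npdf v n : measurable_fun setT (truncated_npdf v n).
Proof.
apply: measurable_fun_ifT; last exact: measurable_cst.
  by apply: measurable_fun_ler => //; exact: measurableT_comp.
exact: measurable_npdf.
Qed.

Lemma truncated_npdf_ge0 v n x : 0 <= truncated_npdf v n x.
Proof. by rewrite /truncated_npdf; case: ifP => // _; exact: npdf_ge0. Qed.

Lemma truncated_npdf_le v n x y : 0 < v -> `|x| <= `|y| ->
  truncated_npdf v n y <= truncated_npdf v n x.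
Proof.
move=> v0 xy; rewrite /truncated_npdf.
case: ifPn => [yn|_]; first by rewrite (le_trans xy yn) npdf_le.
by case: ifPn => // _; exact: npdf_ge0.
Qed.

Lemma truncated_npdf_nondecreasing v x (m n : nat) : (m <= n)%N ->
  truncated_npdf v m x <= truncated_npdf v n x.
Proof.
move=> mn; rewrite /truncated_npdf.
case: ifPn => [xm|_]; first by rewrite (le_trans xm)// ler_nat.
by case: ifPn => // _; exact: npdf_ge0.
Qed.

Definition truncated_loss (v : R) (n : nat) := kernel_loss (truncated_npdf v n).

Let mtl v n c : measurable_fun setT
  (fun g : R => ((truncated_npdf v n g)%:E * l (c + g)%R)%E).
Proof.
apply: emeasurable_funM.
  by apply/measurable_EFinP; exact: measurable_truncated_npdf.
by apply: (measurableT_comp ml); exact: measurable_funD.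
Qed.

Let tl0 v n c g : (0 <= (truncated_npdf v n g)%:E * l (c + g)%R)%E.
Proof. by rewrite mule_ge0// lee_fin truncated_npdf_ge0. Qed.

Lemma bowl_shaped_truncated_loss v n : 0 < v -> bowl_shaped (truncated_loss v n).
Proof.
move=> v0; apply: bowl_shaped_kernel_loss.
- exact: measurable_truncated_npdf.
- exact: truncated_npdf_ge0.
- by move=> x y; exact: truncated_npdf_le.
Qed.

Lemma lower_semicontinuous_truncated_loss v n : 0 < v ->
  lower_semicontinuous (truncated_loss v n).
Proof.
move=> v0; apply: lower_semicontinuous_kernel_loss.
- exact: measurable_truncated_npdf.
- exact: truncated_npdf_ge0.
- by move=> x y; exact: truncated_npdf_le.
Qed.

Lemma truncated_loss_nondecreasing v c (m n : nat) : (m <= n)%N ->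
  (truncated_loss v m c <= truncated_loss v n c)%E.
Proof.
move=> mn; apply: ge0_le_integral => //.
- exact: mtl.
- exact: mtl.
- by move=> x _; rewrite lee_wpmul2r// lee_fin truncated_npdf_nondecreasing.
Qed.

Lemma cvg_truncated_loss v c : 0 < v ->
  truncated_loss v n c @[n --> \oo] --> smoothed_loss l v c.
Proof.
move=> v0; rewrite smoothed_lossE//.
have -> : kernel_loss (npdf v) c =
    (\int[leb]_g limn (fun n => (truncated_npdf v n g)%:E * l (c + g)%R))%E.
  apply: eq_integral => g _; apply/esym/cvg_lim => //; apply: cvg_near_cst.
  have [m gm] : exists m : nat, `|g| <= m%:R.
    by exists (Num.bound `|g|); rewrite ltW// archi_boundP.
  exists m => // n /= mn; rewrite /truncated_npdf.
  by rewrite (le_trans gm)// ler_nat.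
apply: cvg_monotone_convergence => //.
- by move=> n; exact: mtl.
- by move=> x _ m n mn; rewrite lee_wpmul2r// lee_fin truncated_npdf_nondecreasing.
Qed.

(** Sublevel sets are symmetric intervals. If the nonnegative half E of one is bounded and nonempty,
    then c is its supremum, and lower semicontinuity puts this supremum in E. If E is unbounded, no
    point exceeds the level. *)
Lemma bowl_shaped_superlevel (t : R) :
  (exists c : R, forall x, (t%:E < l x)%E = (c < `|x|)) \/
  (forall x, (l x <= t%:E)%E).
Proof.
pose E := [set x | 0 <= x /\ (l x <= t%:E)%E].
have lE x y : E y -> `|x| <= y -> (l x <= t%:E)%E.
  by move=> [y0 yt] xy; apply: le_trans yt; apply: lle; rewrite (ger0_norm y0).
have [E0|nE0] := pselect (E !=set0); last first.
  (* With E empty every point exceeds the level; a negative c expresses the whole line. *)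
  left; exists (-1) => x; rewrite (@lt_le_trans _ _ 0 (-1))//.
  rewrite ltNge; apply/negP => lxt; apply: nE0; exists `|x|; split => //.
  by apply: le_trans lxt; apply: lle; rewrite normr_id.
have [ubE|nubE] := pselect (has_ubound E); last first.
  right => x; have [y Ey xy] : exists2 y, E y & `|x| < y.
    apply: contrapT => H; apply: nubE; exists `|x| => y Ey.
    by rewrite leNgt; apply/negP => xy; apply: H; exists y.
  exact: lE Ey (ltW xy).
left; exists (sup E) => x.
have sE : has_sup E by [].
have Et : (l (sup E) <= t%:E)%E.
  rewrite leNgt; apply/negP => /lsc[V /nbhs_ballP[e /= e0 eV] Vt].
  have [y Ey ye] := sup_adherent e0 sE.
  have ys : y <= sup E by exact: ub_le_sup.
  have := Vt y; rewrite ltNge => H; move: Ey => [_]; apply/negP; apply: H.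
  by apply: eV; rewrite /ball/= ger0_norm; lra.
have s0 : 0 <= sup E.
  by case: E0 => y Ey; apply: le_trans (ub_le_sup ubE Ey); case: Ey.
apply/idP/idP => [tx|sx].
  rewrite ltNge; apply/negP => xs; move: tx; rewrite ltNge; move/negP; apply.
  by apply: le_trans Et; apply: lle; rewrite (ger0_norm s0).
rewrite ltNge; apply/negP => lxt.
have : E `|x|.
  split => //; apply: le_trans lxt; apply: lle; by rewrite normr_id.
by move/(ub_le_sup ubE); rewrite leNgt sx.
Qed.

End BowlShapedSmoothing.

(** * Limits of measures along an ultrafilter *)

Section UltraLimit.
Context {R : realType} (U : set_system nat) (UU : UltraFilter U).

(** Compactness of [0, +oo]: either the sequence is bounded by a real on a set of [U] and a segment
    is compact, or it exceeds every real on a set of [U]. *)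
Lemma ultra_cvge (u : nat -> \bar R) : (forall n, 0 <= u n)%E -> cvg (u @ U).
Proof.
move=> u0.
have [[M uM]|H] := pselect (exists M : R, U [set n | (u n <= M%:E)%E]); last first.
  apply/cvg_ex; exists +oo%E; apply/cvgeyPgt => A.
  have [|//] := in_ultra_setVsetC [set n | (A%:E < u n)%E] UU; first by [].
  move=> uA; exfalso; apply: H; exists A; apply: filterS uA => n /=.
  by rewrite leNgt => /negP.
have Mseg : fmap (fine \o u) U `[0, M]%classic.
  apply: (@filterS _ U _ [set n | (u n <= M%:E)%E]) => // n /=; have := u0 n.
  by case: (u n) => [r| |]//; rewrite !lee_fin in_itv/= => -> ->.
have [p [_ clp]] := @segment_compact R 0 M (fmap (fine \o u) U) _ Mseg.
have cvp : (fine \o u) @ U --> p.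
  move=> B pB; have [//|nB] := in_ultra_setVsetC ((fine \o u) @^-1` B) UU.
  by have [x [nBx Bx]] := clp (~` B) B nB pB.
apply/cvg_ex; exists p%:E.
apply/fine_cvgP; split => //.
apply: filterS uM => n /= unM; rewrite ge0_fin_numE//.
by apply: le_lt_trans unM _; rewrite ltry.
Qed.

Lemma lim_ultraD (u v : nat -> \bar R) :
  (forall n, 0 <= u n)%E -> (forall n, 0 <= v n)%E ->
  (lim ((fun n => u n + v n) @ U) = lim (u @ U) + lim (v @ U))%E.
Proof.
move=> u0 v0; apply: limeD; [exact: ultra_cvge|exact: ultra_cvge|].
apply: ge0_adde_def; rewrite inE.
  by apply: lime_ge; [exact: ultra_cvge|exact: nearW].
by apply: lime_ge; [exact: ultra_cvge|exact: nearW].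
Qed.

Lemma lim_ultra_ge0 (u : nat -> \bar R) : (forall n, 0 <= u n)%E ->
  (0 <= lim (u @ U))%E.
Proof. by move=> u0; apply: lime_ge; [exact: ultra_cvge|exact: nearW]. Qed.

Lemma lim_ultra_le (u v : nat -> \bar R) : (forall n, 0 <= u n)%E ->
  (forall n, u n <= v n)%E -> (lim (u @ U) <= lim (v @ U))%E.
Proof.
move=> u0 uv; apply: lee_lim; last exact: nearW.
  exact: ultra_cvge.
by apply: ultra_cvge => n; exact: le_trans (uv n).
Qed.

Section Measure.
Context {d : measure_display} {T : measurableType d}.
Variables (P : probability T R) (nu_ : nat -> {measure set T -> \bar R}).
Hypothesis nuP : forall n A, measurable A -> (nu_ n A <= P A)%E.

Definition ultra_measure of (forall n A, measurable A -> (nu_ n A <= P A)%E) :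
  set T -> \bar R := fun A => lim ((fun n => nu_ n A) @ U).

Local Notation nu := (ultra_measure nuP).

Let nu0 : nu set0 = 0%E.
Proof.
rewrite /ultra_measure; under eq_fun do rewrite measure0.
exact: lim_cst.
Qed.

Let nu_ge0 A : (0 <= nu A)%E.
Proof. exact: lim_ultra_ge0. Qed.

Let nu_le A : measurable A -> (nu A <= P A)%E.
Proof.
move=> mA; apply: lime_le; first exact: ultra_cvge.
by apply: nearW => n; exact: nuP.
Qed.

Let nuU A B : measurable A -> measurable B -> A `&` B = set0 ->
  nu (A `|` B) = (nu A + nu B)%E.
Proof.
move=> mA mB AB; rewrite /ultra_measure -lim_ultraD//.
by under eq_fun do rewrite measureU//.
Qed.

(** A setwise limit along an ultrafilter is in general only finitely additive. Here domination by
    the single probability [P] forces the mass of the tails [B n] to 0. *)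
Let nu_sigma_additive : semi_sigma_additive nu.
Proof.
move=> F mF tF mUF.
pose A n := \big[setU/set0]_(i < n) F i.
have mA n : measurable (A n) by exact: bigsetU_measurable.
have AE n : A n `<=` \bigcup_i F i by exact: bigsetU_bigcup.
have nuA n : nu (A n) = (\sum_(0 <= i < n) nu (F i))%E.
  elim: n => [|n ih]; first by rewrite /A big_ord0 big_nil nu0.
  rewrite big_nat_recr//= -ih /A big_ord_recr/= nuU//; first exact: mA.
  apply/seteqP; split => // x; rewrite -bigcup_mkord => -[[i /= ltin Fi] Fn].
  have := tF i n Logic.I Logic.I (ex_intro _ x (conj Fi Fn)).
  by move=> E; move: ltin; rewrite E ltnn.
pose B n := \bigcup_i F i `\` A n.
have mB n : measurable (B n) by exact: measurableD.
have PB : P (B n) @[n --> \oo] --> 0%E.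
  rewrite -(measure0 P).
  have -> : set0 = \bigcap_n B n.
    apply/esym/seteqP; split => // x Bx.
    have [[i _ Fix] _] := Bx 0%N Logic.I.
    have [_] := Bx i.+1 Logic.I; apply.
    by rewrite /A big_ord_recr/=; right.
  apply: nonincreasing_cvg_mu => //.
  - by apply: le_lt_trans (probability_le1 _ (mB 0%N)) _; rewrite ltry.
  - exact: bigcap_measurable.
  - move=> m n mn; rewrite subsetEset => x [Fx Ax]; split => // Amx.
    by apply: Ax; move: Amx; apply: subset_bigsetU.
have nuE n : nu (\bigcup_i F i) = (nu (A n) + nu (B n))%E.
  rewrite -nuU//; last by rewrite setDIK.
  by rewrite setDUK.
have nufin C : measurable C -> nu C \is a fin_num.
  move=> mC; rewrite ge0_fin_numE//; apply: le_lt_trans (nu_le _ mC) _.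
  by apply: le_lt_trans (probability_le1 _ mC) _; rewrite ltry.
have -> : (fun n => \sum_(0 <= i < n) nu (F i))%E =
    (fun n => nu (\bigcup_i F i) - nu (B n))%E.
  by apply/funext => n; rewrite (nuE n) addeK// -?nuA// nufin.
have nuB : nu (B n) @[n --> \oo] --> 0%E.
  apply: (@squeeze_cvge _ _ _ _ (fun=> 0%E) _ (fun n => P (B n))) => //.
  - by apply: nearW => n; rewrite nu_ge0 nu_le.
  - exact: cvg_cst.
rewrite -[X in _ --> X]sube0.
apply: cvgeB; [|exact: cvg_cst|exact: nuB].
by rewrite fin_num_adde_defl.
Qed.

HB.instance Definition _ := isMeasure.Build _ _ _ nu nu0 nu_ge0 nu_sigma_additive.

Let nu_fin : fin_num_fun nu.
Proof.
move=> A mA; rewrite ge0_fin_numE//; apply: le_lt_trans (nu_le _ mA) _.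
by apply: le_lt_trans (probability_le1 _ mA) _; rewrite ltry.
Qed.

HB.instance Definition _ := @Measure_isFinite.Build _ _ _ nu nu_fin.

Lemma ultra_measure_density : exists f : T -> \bar R,
  [/\ forall x, (0 <= f x)%E, measurable_fun setT f,
      (forall A, measurable A -> (nu A = \int[P]_(x in A) f x)%E) &
      P.-integrable setT f].
Proof.
have dom : nu `<< P.
  apply/null_content_dominatesP => A mA PA0.
  by apply/eqP; rewrite eq_le nu_ge0 andbT -PA0; exact: nu_le.
have [f [f0 fi fE]] := radon_nikodym_finite dom.
by exists f; split => //; exact: measurable_int fi.
Qed.

Import HBNNSimple.

(** Equality holds for simple functions, as finite sums pass to the limit. Approximation from below
    preserves only the inequality, which is the direction that the risk bound needs. *)
Lemma integral_ultra_measure_le (f : T -> \bar R) :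
  measurable_fun setT f -> (forall x, 0 <= f x)%E ->
  (\int[nu]_x f x <= lim ((fun n => \int[nu_ n]_x f x) @ U))%E.
Proof.
move=> mf f0; pose h := nnsfun_approx measurableT mf.
have hf n x : ((h n x)%:E <= f x)%E.
  have cv : (h m x)%:E @[m --> \oo] --> f x by exact: cvg_nnsfun_approx.
  apply: (cvge_ge _ cv).
  by exists n => // m /= nm; rewrite lee_fin; exact/lefP/nd_nnsfun_approx.
have -> : (\int[nu]_x f x = limn (fun n => \int[nu]_x (h n x)%:E))%E.
  rewrite -monotone_convergence//.
  - by apply: eq_integral => x _; apply/esym/cvg_lim => //; exact: cvg_nnsfun_approx.
  - by move=> n; exact/measurable_EFinP.
  - by move=> n x _; rewrite lee_fin.
  - by move=> x _ m n mn; rewrite lee_fin; exact/lefP/nd_nnsfun_approx.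
apply: lime_le.
  apply: ereal_nondecreasing_is_cvgn => m n mn; apply: ge0_le_integral => //.
  - by move=> x _; rewrite lee_fin.
  - exact/measurable_EFinP.
  - exact/measurable_EFinP.
  - by move=> x _; rewrite lee_fin; exact/lefP/nd_nnsfun_approx.
apply: nearW => n.
have sE (m : {measure set T -> \bar R}) : (\int[m]_x (h n x)%:E =
    \sum_(y <- fset_set (range (h n))) y%:E * m (h n @^-1` [set y]))%E.
  by rewrite integral_nnsfun// patch_setT sintegralE fsbig_finite.
rewrite sE.
have -> : (\sum_(y <- fset_set (range (h n))) y%:E * nu (h n @^-1` [set y]) =
    lim ((fun k => \int[nu_ k]_x (h n x)%:E) @ U))%E.
  have y0 y : y \in (fset_set (range (h n)) : seq R) -> (0 <= y%:E)%E.
    move=> yh; have : y \in fset_set (range (h n)) by [].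
    by rewrite in_fset_set// => /set_mem[x _ <-]; rewrite lee_fin.
  apply/esym/cvg_lim => //; rewrite (_ : (fun k => _) = (fun k =>
      \sum_(y <- fset_set (range (h n)) | y \in (fset_set (range (h n)) : seq R))
        y%:E * nu_ k (h n @^-1` [set y]))%E); last first.
    by apply/funext => k; rewrite sE big_seq.
  rewrite big_seq; apply: cvg_nnesum => y /y0 {}y0.
    by apply: nearW => k; rewrite mule_ge0.
  by apply: cvgeZl => //; exact: ultra_cvge.
apply: lim_ultra_le => k; first by apply: integral_ge0 => x _; rewrite lee_fin.
apply: ge0_le_integral => //.
- by move=> x _; rewrite lee_fin.
- exact/measurable_EFinP.
Qed.

End Measure.
End UltraLimit.

(** * Layer-cake comparison of integrals along an ultrafilter *)

Section LayerCake.
Context {R : realType}.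

(** A discrete layer-cake sum: it approximates y from below with mesh delta and is capped at M
    delta. Its integral involves superlevel sets only. *)
Definition lower_sum (delta : R) (M : nat) (y : \bar R) : \bar R :=
  (\sum_(i < M) delta%:E * (if (i.+1%:R * delta)%:E < y then 1 else 0))%E.

Lemma lower_sum_bounds (delta : R) (M : nat) (y : R) : 0 < delta -> 0 <= y ->
  exists s : R, [/\ lower_sum delta M y%:E = s%:E, s <= y, s <= M%:R * delta &
    M%:R * delta <= s \/ y - delta <= s].
Proof.
move=> d0 y0; elim: M => [|M [s [sE sy sM Ms]]].
  by exists 0; rewrite /lower_sum big_ord0 mul0r; split => //; left.
rewrite /lower_sum big_ord_recr/= -/(lower_sum delta M y%:E) sE lte_fin.
case: ifPn => [My|]; last first.
  rewrite -leNgt => yM; exists s; rewrite mule0 adde0; split => //.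
    by apply: le_trans sM _; rewrite ler_wpM2r ?ler_nat// ltW.
  right; move: yM; rewrite -natr1 mulrDl mul1r => yM.
  by case: Ms => ?; lra.
exists (s + delta); rewrite mule1 -EFinD; split => //.
- by move: My; rewrite -natr1 mulrDl mul1r; lra.
- by rewrite -natr1 mulrDl mul1r lerD2r.
- by rewrite -natr1 mulrDl mul1r; case: Ms => ?; [left|right]; lra.
Qed.

Lemma lower_sumy (delta : R) (M : nat) : 0 < delta ->
  lower_sum delta M +oo%E = (M%:R * delta)%:E.
Proof.
move=> d0; elim: M => [|M ih]; first by rewrite /lower_sum big_ord0 mul0r.
rewrite /lower_sum big_ord_recr/= -/(lower_sum delta M +oo) ih ltry mule1 -EFinD.
by rewrite -natr1 mulrDl mul1r.
Qed.

Lemma lower_sum_ge0 (delta : R) (M : nat) (y : \bar R) : 0 < delta ->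
  (0 <= lower_sum delta M y)%E.
Proof.
move=> d0; apply: sume_ge0 => i _; apply: mule_ge0; last by case: ifP.
by rewrite lee_fin ltW.
Qed.

Lemma lower_sum_le (delta : R) (M : nat) (y : \bar R) : 0 < delta -> (0 <= y)%E ->
  (lower_sum delta M y <= y)%E.
Proof.
move=> d0; case: y => [y| |]//; last by move=> _; rewrite leey.
by rewrite lee_fin => y0; have [s [-> ? _ _]] := lower_sum_bounds _ M _ d0 y0.
Qed.

(** Mesh 1/(n + 1) and (n + 1)^2 steps, so the cap is n + 1. The meshes are not nested and the sums
    not monotone in n, hence the passage through the lower limit and Fatou's lemma. *)
Definition dyadic_lower_sum (n : nat) := lower_sum n.+1%:R^-1 (n.+1 * n.+1).

Lemma le_limn_einf_lower_sum (y : \bar R) : (0 <= y)%E ->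
  (y <= limn_einf (fun n => dyadic_lower_sum n y))%E.
Proof.
move=> y0; rewrite leNgt; apply/negP => H.
have [|r [r1 r2]] := ge0_ereal_between _ _ _ H.
  by apply: le_limn_einf; apply: nearW => n; exact: lower_sum_ge0.
suff : (r%:E <= limn_einf (fun n => dyadic_lower_sum n y))%E by rewrite leNgt r1.
apply: le_limn_einf.
have nE n : (n.+1 * n.+1)%:R * n.+1%:R^-1 = n.+1%:R :> R.
  by rewrite natrM mulfK.
have rn : \forall n \near \oo, r <= n.+1%:R.
  exists (Num.bound `|r|) => // n /= rn; apply: le_trans (ler_norm r) _.
  apply: (@le_trans _ _ (Num.bound `|r|)%:R); first by rewrite ltW// archi_boundP.
  by rewrite ler_nat (leq_trans rn).
case: y y0 r2 {H r1} => [y| |]//; last first.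
  move=> _ _; apply: filterS rn => n rn.
  by rewrite /dyadic_lower_sum lower_sumy// nE lee_fin.
rewrite lee_fin lte_fin => y0 ry.
have yr : 0 < y - r by rewrite subr_gt0.
have rd := near_infty_natSinv_lt (PosNum yr).
near=> n.
have dn : 0 < n.+1%:R^-1 :> R by rewrite invr_gt0.
have [s [sE _ _ sM]] := lower_sum_bounds n.+1%:R^-1 (n.+1 * n.+1) y dn y0.
rewrite /dyadic_lower_sum sE lee_fin; case: sM => [|ys].
  by rewrite nE; apply: le_trans; near: n.
apply: le_trans ys; have : n.+1%:R^-1 < y - r by near: n.
by rewrite ltrBrDr lerBrDl => /ltW.
Unshelve. all: by end_near. Qed.

Lemma integral_lower_sum {d : measure_display} {T : measurableType d}
    (m : {measure set T -> \bar R}) (f : T -> \bar R) (delta : R) M :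
  0 < delta -> measurable_fun setT f ->
    measurable_fun setT (fun x => lower_sum delta M (f x)) /\
    (\int[m]_x lower_sum delta M (f x) =
     \sum_(i < M) delta%:E * m [set x | (i.+1%:R * delta)%:E < f x])%E.
Proof.
move=> d0 mf.
  have mS (t : R) : measurable [set x | (t%:E < f x)%E].
    rewrite -[X in measurable X]setTI; exact: emeasurable_fun_o_infty.
  have mi (t : R) : measurable_fun setT (fun x => (if t%:E < f x then 1 else 0)%E : \bar R).
    have -> : (fun x => (if t%:E < f x then 1 else 0)%E : \bar R) =
        (fun x => (\1_[set y | (t%:E < f y)%E] x)%:E).
      apply/funext => x; rewrite indicE; case: ifPn => tx.
        by rewrite mem_set.
      by rewrite memNset//; exact/negP.
    by apply/measurable_EFinP; exact: measurable_indic.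
  split; first by apply: emeasurable_sum => i; exact: measurable_funeM.
  rewrite ge0_integral_sum//.
  - apply: eq_bigr => i _; rewrite ge0_integralZl//.
    + congr (_ * _)%E; rewrite -[X in m X]setIT -integral_indic//.
      apply: eq_integral => x _; rewrite indicE; case: ifPn => tx.
        by rewrite mem_set.
      by rewrite memNset//; exact/negP.
    + by move=> x _; case: ifP.
    + by rewrite lee_fin ltW.
  - by move=> i; exact: measurable_funeM.
  - by move=> i x _; apply: mule_ge0; [rewrite lee_fin ltW|case: ifP].
Qed.

Lemma integral_le_superlevel {d1 d2 : measure_display} {T1 : measurableType d1}
    {T2 : measurableType d2} (U : set_system nat) (UU : UltraFilter U)
    (a : {measure set T1 -> \bar R}) (b : nat -> {measure set T2 -> \bar R})
    (f1 : T1 -> \bar R) (f2 : T2 -> \bar R) :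
  measurable_fun setT f1 -> measurable_fun setT f2 ->
  (forall x, 0 <= f1 x)%E -> (forall x, 0 <= f2 x)%E ->
  (forall t : R, 0 < t -> (a [set x | t%:E < f1 x] <=
     lim ((fun n => b n [set x | t%:E < f2 x]) @ U))%E) ->
  (\int[a]_x f1 x <= lim ((fun n => \int[b n]_x f2 x) @ U))%E.
Proof.
move=> mf1 mf2 f10 f20 ab.
apply: (@le_trans _ _ (\int[a]_x limn_einf (fun n => dyadic_lower_sum n (f1 x)))%E).
  apply: ge0_le_integral => //.
  - apply: (measurableT_comp (@oppe_measurable R setT)) => //.
    apply: measurable_fun_limn_esup => n.
    apply: (measurableT_comp (@oppe_measurable R setT)) => //.
    by have [] := integral_lower_sum a f1 n.+1%:R^-1 (n.+1 * n.+1)%N; rewrite ?invr_gt0.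
  - by move=> x _; exact: le_limn_einf_lower_sum.
apply: le_trans (fatou _ _ _ _) _ => //.
- by move=> n; have [] := integral_lower_sum a f1 n.+1%:R^-1 (n.+1 * n.+1)%N; rewrite ?invr_gt0.
- by move=> n x _; apply: lower_sum_ge0; rewrite invr_gt0.
apply: limn_einf_le => n.
have d0 : 0 < n.+1%:R^-1 :> R by rewrite invr_gt0.
have [_ ->] := integral_lower_sum a f1 n.+1%:R^-1 (n.+1 * n.+1)%N d0 mf1.
set M := (n.+1 * n.+1)%N; set delta := n.+1%:R^-1 in d0 *.
apply: (@le_trans _ _ (\sum_(i < M) delta%:E *
    lim ((fun k => b k [set x | (i.+1%:R * delta)%:E < f2 x]) @ U))%E).
  apply: lee_sum => i _; apply: lee_wpmul2l; first by rewrite lee_fin ltW.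
  by apply: ab; rewrite mulr_gt0.
have -> : (\sum_(i < M) delta%:E *
    lim ((fun k => b k [set x | (i.+1%:R * delta)%:E < f2 x]) @ U) =
    lim ((fun k => \sum_(i < M) delta%:E * b k [set x | (i.+1%:R * delta)%:E < f2 x]) @ U))%E.
  apply/esym/cvg_lim => //; apply: cvg_nnesum => i _.
    by apply: nearW => k; rewrite mule_ge0// lee_fin ltW.
  by apply: cvgeZl => //; exact: ultra_cvge.
apply: lim_ultra_le => k.
  by apply: sume_ge0 => i _; rewrite mule_ge0// lee_fin ltW.
have [mls <-] := integral_lower_sum (b k) f2 delta M d0 mf2.
apply: ge0_le_integral => //.
- by move=> x _; exact: lower_sum_ge0.
- by move=> x _; exact: lower_sum_le.
Qed.

End LayerCake.

(** * Compactness of randomized rules *)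

(** On the set where g < f, the pointwise and the integrated inequalities are opposite, so f = g
    almost everywhere there, which makes that set negligible. *)
Lemma ae_le_of_integral_le {d : measure_display} {T : measurableType d}
    {R : realType} (P : probability T R) (f g : T -> R) :
  measurable_fun setT f -> measurable_fun setT g ->
  (forall x, 0 <= f x) -> (forall x, 0 <= g x) ->
  P.-integrable setT (EFin \o g) ->
  (forall A, measurable A ->
     (\int[P]_(x in A) (f x)%:E <= \int[P]_(x in A) (g x)%:E)%E) ->
  \forall x \ae P, f x <= g x.
Proof.
move=> mf mg f0 g0 gi fg.
pose D := [set x | g x < f x].
have mD : measurable D.
  have -> : D = ~` (setT `&` [set x | f x <= g x]).
    by rewrite setTI; apply/seteqP; split => x; rewrite /D /= ltNge => /negP.
  by apply: measurableC; exact: measurable_fun_le.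
have : ae_eq P D (EFin \o g) (EFin \o f).
  apply: integral_ae_eq => //.
  - by apply: integrableS gi.
  - by apply/measurable_EFinP; apply: measurable_funTS.
  - move=> E ED mE; apply/eqP; rewrite eq_le fg// andbT.
    apply: ge0_le_integral => //.
    + by move=> x _; rewrite /= lee_fin.
    + by apply/measurable_EFinP; apply: measurable_funTS.
    + by apply/measurable_EFinP; apply: measurable_funTS.
    + by move=> x /ED /ltW; rewrite /= lee_fin.
apply: filterS => x H; rewrite leNgt; apply/negP => gf.
by have [E] := H gf; move: gf; rewrite E ltxx.
Qed.

Section RandomizedRule.
Context {R : realType} {d : measure_display} {Z : measurableType d}.
Variables (U : set_system nat) (UU : UltraFilter U).
Variables (PZ : probability Z R)
  (pi_ : nat -> {measure set (Z * measurableTypeR R) -> \bar R}).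
Hypothesis marginal : forall n A, measurable A -> pi_ n (A `*` setT) = PZ A.

Lemma measurable_indic_snd (D : set R) : measurable D ->
  measurable_fun setT (fun p : Z * measurableTypeR R => \1_D p.2 : R).
Proof.
by move=> mD; apply: (measurableT_comp (f := \1_D : measurableTypeR R -> R)).
Qed.

Lemma measurable_weighted_indic (D : set R) (L : Z -> R) :
  measurable D -> measurable_fun setT L -> measurable_fun setT
    (fun p : Z * measurableTypeR R => ((\1_D p.2)%:E * (L p.1)%:E)%E).
Proof.
move=> mD mL; apply: emeasurable_funM; apply/measurable_EFinP.
  exact: measurable_indic_snd.
exact: measurableT_comp mL (@measurable_fst _ _ Z (measurableTypeR R)).
Qed.

(** [w] plays the role of a limiting conditional probability of D given z. The measures A |-> pi_n
    (A x D) are dominated by the common marginal, so their limit has a density, made real-valued by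
    [fine]. The last clause brings in the likelihood ratio L. *)
Lemma slice_density (D : set R) : measurable D -> exists w : Z -> R,
  [/\ measurable_fun setT w, forall z, 0 <= w z,
      PZ.-integrable setT (EFin \o w),
      (forall A, measurable A -> (\int[PZ]_(z in A) (w z)%:E =
         lim ((fun n => pi_ n (A `*` D)) @ U))%E) &
      forall L : Z -> R, measurable_fun setT L -> (forall z, 0 <= L z) ->
        (\int[PZ]_z ((w z)%:E * (L z)%:E) <= lim ((fun n =>
           \int[pi_ n]_p ((\1_D p.2)%:E * (L p.1)%:E)) @ U))%E].
Proof.
move=> mD.
have mI := measurable_indic_snd D mD.
have I0 (p : Z * measurableTypeR R) : 0 <= (\1_D p.2 : R) by [].
have mfst : measurable_fun setT (fst : Z * measurableTypeR R -> Z) by [].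
pose marg n : {measure set Z -> \bar R} :=
  pushforward (density_measure (pi_ n) _ mI I0) (fst : Z * measurableTypeR R -> Z).
pose nu_ := marg mfst.
have nuE n A : measurable A -> nu_ n A = pi_ n (A `*` D).
  move=> mA; rewrite /nu_ /marg /= /pushforward /density_measure.
  transitivity (\int[pi_ n]_(x in fst @^-1` A) (\1_(setT `*` D) x)%:E)%E.
    apply: eq_integral => p _; rewrite !indicE; congr ((nat_of_bool _)%:R%:E).
    by apply/idP/idP => /set_mem Dp; apply/mem_set => //; case: Dp.
  rewrite integral_indic//; last 2 first.
  - by rewrite -[X in measurable X]setTI; exact: (@measurable_fst _ _ Z (measurableTypeR R)).
  - exact: measurableX.
  congr (pi_ n _); apply/seteqP; split => -[z x] /=.
    by case=> -[_ ?] ?.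
  by case.
have nuP n A : measurable A -> (nu_ n A <= PZ A)%E.
  move=> mA; rewrite nuE// -(marginal n _ mA); apply: le_measure.
  - by rewrite inE; exact: measurableX.
  - by rewrite inE; exact: measurableX.
  - by move=> [z x] [].
have [f [f0 mf fE fi]] := ultra_measure_density U UU PZ nu_ nuP.
pose w z := fine (f z).
have mw : measurable_fun setT w by apply: measurableT_comp mf.
have w0 z : 0 <= w z by rewrite fine_ge0.
have fw : ae_eq PZ setT f (EFin \o w).
  have := integrable_ae measurableT fi; apply: filterS => z H _.
  by rewrite /= /w fineK// H.
have wE A : measurable A -> (\int[PZ]_(z in A) (w z)%:E =
    lim ((fun n => nu_ n A) @ U))%E.
  move=> mA; transitivity (\int[PZ]_(z in A) f z)%E; last first.
    by rewrite -fE.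
  apply: ae_eq_integral => //.
  - by apply/measurable_EFinP; apply: measurable_funTS.
  - by apply: measurable_funTS.
  - by apply: filterS fw => z H _; rewrite H.
exists w; split => //.
- apply/integrableP; split; first exact/measurable_EFinP.
  rewrite (eq_integral (EFin \o w)); last by move=> z _; rewrite /= ger0_norm.
  by rewrite wE// [ltLHS](fE setT)//; exact: integrable_lty fi.
- by move=> A mA; rewrite wE//; congr (lim (_ @ U)); apply/funext => n; exact: nuE.
move=> L mL L0.
have mLE : measurable_fun setT (EFin \o L) by exact/measurable_EFinP.
have LE0 z : (0 <= (EFin \o L) z)%E by rewrite /= lee_fin.
rewrite -(integral_with_density PZ (ultra_measure U PZ nu_ nuP) w mw w0 _
  (EFin \o L))//; last first.
  by move=> A mA; rewrite wE.
apply: le_trans (integral_ultra_measure_le _ _ _ _ _ _ _ _) _ => //.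
apply: lim_ultra_le => n; first by apply: integral_ge0.
rewrite /nu_ /marg ge0_integral_pushforward// preimage_setT integral_density_measure//.
  by apply: measurableT_comp mLE (@measurable_fst _ _ Z (measurableTypeR R)).
by move=> p; exact: LE0.
Qed.

Definition rational (n : nat) : R := ratr (odflt 0 (choice.unpickle n : option rat)).

Lemma rational_dense (a b : R) : a < b -> exists n, a < rational n < b.
Proof.
move=> ab; have [q] := rat_in_itvoo ab; rewrite in_itv/= => aqb.
by exists (choice.pickle q); rewrite /rational choice.pickleK.
Qed.

(* The generalized inverse of the distribution functions w _ z, restricted to
   rational arguments; [fine] gives the junk value 0 when the infimum is
   infinite. *)
Definition quantile_rule (w : nat -> Z -> R) (p : Z * measurableTypeR R) : R :=
  fine (einfs (fun n => if p.2 <= w n p.1 then (rational n)%:E else +oo%E) 0).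

Lemma measurable_quantile_rule (w : nat -> Z -> R) :
  (forall n, measurable_fun setT (w n)) -> measurable_fun setT (quantile_rule w).
Proof.
move=> mw; apply: measurableT_comp => //.
apply: measurable_fun_einfs => n; apply: measurable_fun_ifT => //.
apply: measurable_fun_ler; first exact: (@measurable_snd _ _ Z (measurableTypeR R)).
by apply: measurableT_comp (mw n) (@measurable_fst _ _ Z (measurableTypeR R)).
Qed.

(** Stated for every z, even where w _ z is not monotone or lacks the limits 0 and 1: the definition
    of the infimum alone supplies a rational witness. *)
Lemma quantile_rule_far (w : nat -> Z -> R) (z : Z) (u a c : R) : 0 <= c ->
  c < `|quantile_rule w (z, u) - a| ->
  exists n, a + c < rational n /\ w n z < u \/ rational n < a - c /\ u <= w n z.
Proof.
move=> c0; rewrite /quantile_rule/=.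
set v := fun n => if u <= w n z then (rational n)%:E else +oo%E : \bar R.
have below r : (einfs v 0%N < r%:E)%E -> exists n, rational n < r /\ u <= w n z.
  move=> /ereal_inf_lt[_ [n _ <-]]; rewrite /v; case: ifPn => // uw.
  by rewrite lte_fin => nr; exists n.
have above r : (r%:E < einfs v 0%N)%E -> exists n, r < rational n /\ w n z < u.
  move=> rv; have [s [rs sv]] : exists s : R, r < s /\ (s%:E <= einfs v 0%N)%E.
    move: rv; case: (einfs v 0%N) => [s| |]//; first by rewrite lte_fin; exists s.
    by move=> _; exists (r + 1); rewrite leey ltrDl ltr01.
  have [n /andP[rn ns]] := rational_dense _ _ rs; exists n; split => //.
  rewrite ltNge; apply/negP => uw.
  have : (einfs v 0%N <= v n)%E by apply: ereal_inf_lbound; exists n.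
  rewrite /v uw => /(le_trans sv); rewrite lee_fin leNgt ns//.
case: (einfs v 0%N) below above => [i| |] below above /=.
- rewrite ltr_normr => /orP[ia|ai].
    have [|n H] := above (a + c); first by rewrite lte_fin; lra.
    by exists n; left.
  have [|n H] := below (a - c); first by rewrite lte_fin; lra.
  by exists n; right.
(* At an infinite infimum a witness exists whatever the default value of the rule, since every level
   is passed. *)
- by move=> _; have [|n H] := above (a + c); [rewrite ltry|exists n; left].
- by move=> _; have [|n H] := below (a - c); [rewrite ltNyr|exists n; right].
Qed.

Local Notation unif := (uniform_prob (@ltr01 R)).

Lemma uniform_prob_le (A : set R) (b c : R) : b <= c -> measurable A ->
  (forall x, A x -> 0 <= x <= 1 -> b <= x <= c) -> (unif A <= (c - b)%:E)%E.
Proof.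
move=> bc mA Abc; rewrite /uniform_prob.
apply: (@le_trans _ _ (\int[lebesgue_measure]_(x in A) (\1_`[b, c] x)%:E)%E).
  apply: ge0_le_integral => //.
  - by move=> x _; rewrite lee_fin uniform_pdf_ge0.
  - apply/measurable_EFinP; apply: measurable_funTS; exact: measurable_uniform_pdf.
  - by apply/measurable_EFinP; apply: measurable_funTS; exact: measurable_indic.
  - move=> x Ax; rewrite lee_fin /uniform_pdf; case: ifPn => // x01.
    rewrite subr0 invr1 indicE mem_set//= in_itv/=; exact: Abc.
rewrite integral_indic//; apply: le_trans (le_measure _ _ _ (@subIsetl _ _ _)) _.
- by rewrite inE; exact: measurableI.
- by rewrite inE.
have := @lebesgue_measure_itv R `[b, c]; rewrite /= lte_fin => ->.
by case: ifPn => // _; rewrite lee_fin subr_ge0.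
Qed.

Lemma measurable_quantile_rule_level (w : nat -> Z -> R) (a c : R) :
  (forall n, measurable_fun setT (w n)) ->
  measurable [set p | c < `|quantile_rule w p - a|].
Proof.
move=> mw.
have mq : measurable_fun setT (fun p => `|quantile_rule w p - a|).
  apply: measurableT_comp => //; apply: measurable_funB => //.
  exact: measurable_quantile_rule.
rewrite (_ : mkset _ = (fun p => `|quantile_rule w p - a|) @^-1` `]c, +oo[).
  by rewrite -[X in measurable X]setTI; exact: mq.
by apply/seteqP; split => p /=; rewrite in_itv/= andbT.
Qed.

Lemma quantile_rule_spread (w : nat -> Z -> R) (z : Z) (a c G H : R) :
  (forall n, measurable_fun setT (w n)) -> 0 <= c -> 0 <= G -> 0 <= H ->
  (forall n, a + c < rational n -> 1 <= w n z + G) ->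
  (forall n, rational n < a - c -> w n z <= H) ->
  (unif [set u | (c < `|quantile_rule w (z, u) - a|)%R] <= (G + H)%:E)%E.
Proof.
move=> mw c0 G0 H0 wG wH.
apply: (@le_trans _ _ (unif (`]1 - G, +oo[%classic `|` `]-oo, H]%classic))).
  apply: le_measure; rewrite ?inE.
  - have := measurable_xsection z (measurable_quantile_rule_level w a c mw).
    by rewrite /xsection (_ : [set _ | _] = [set u | c < `|quantile_rule w (z, u) - a|])//;
      apply/seteqP; split => u /=; rewrite inE.
  - exact: measurableU.
  - move=> u /quantile_rule_far => /(_ c0)[n [[/wG n1 n2]|[/wH n1 n2]]].
      by left; rewrite /= in_itv/=; lra.
    by right; rewrite /= in_itv/=; lra.
apply: le_trans (measureU2 _ _ _) _ => //.
rewrite EFinD leeD//.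
  have := uniform_prob_le `]1 - G, +oo[%classic (1 - G) 1; rewrite subKr.
  apply => //; first lra.
  by move=> x /=; rewrite in_itv/= => ? ?; lra.
have := uniform_prob_le `]-oo, H]%classic 0 H; rewrite subr0.
apply => //.
by move=> x /=; rewrite in_itv/= => ? ?; lra.
Qed.

Lemma marginal_integral n (f : Z -> \bar R) : measurable_fun setT f ->
  (forall z, 0 <= f z)%E -> (\int[pi_ n]_p f p.1 = \int[PZ]_z f z)%E.
Proof.
move=> mf f0.
rewrite -[LHS](@ge0_integral_pushforward _ _ _ Z R fst
  (@measurable_fst _ _ Z (measurableTypeR R)) (pi_ n) setT f)//.
apply: eq_measure_integral => A mA _.
transitivity (pi_ n (A `*` setT)); last exact: marginal.
by rewrite /= /pushforward; congr (pi_ n _); apply/seteqP; split => -[z x] //= [].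
Qed.

(** The level set is split into the half-lines above a + c and below a - c, with densities G and H
    of their own. The functions w are compared with G and H at rationals strictly beyond these end
    points, so that open level sets suffice. *)
Lemma randomized_rule_level_set (w : nat -> Z -> R) :
  (forall n, measurable_fun setT (w n)) ->
  (forall n z, 0 <= w n z) ->
  (forall n, PZ.-integrable setT (EFin \o w n)) ->
  (forall n A, measurable A -> (\int[PZ]_(z in A) (w n z)%:E =
         lim ((fun k => pi_ k (A `*` `]-oo, rational n])) @ U))%E) ->
  forall (L : Z -> R) (a c : R), measurable_fun setT L -> (forall z, 0 <= L z) ->
  (\int[PZ]_z (unif [set u | (c < `|quantile_rule w (z, u) - a|)%R] * (L z)%:E) <=
   lim ((fun k => \int[pi_ k]_p ((\1_[set x | c < `|x - a|] p.2)%:E * (L p.1)%:E)) @ U))%E.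
Proof.
move=> mw w0 wi wE L a c mL L0.
have mLE : measurable_fun setT (EFin \o L) by exact/measurable_EFinP.
have mlev : measurable_fun setT (fun z =>
    unif [set u | (c < `|quantile_rule w (z, u) - a|)%R] * (L z)%:E)%E.
  apply: emeasurable_funM => //.
  have := measurable_fun_xsection unif (measurable_quantile_rule_level w a c mw).
  rewrite (_ : _ \o _ = fun z => unif [set u | (c < `|quantile_rule w (z, u) - a|)%R])//.
  apply/funext => z /=; congr unif.
  by apply/seteqP; split => u; rewrite /xsection /= inE.
(* For negative c the level set is everything, and both sides reduce to the integral of L through
   the common marginal. *)
have [c0|c0] := leP 0 c; last first.
  have E (x : R) : (c < `|x|)%R by apply: lt_le_trans c0 _.
  rewrite (_ : (fun k : nat => _) = (fun=> \int[PZ]_z (L z)%:E)%E).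
    rewrite lim_cst//; apply: ge0_le_integral => //.
    - by move=> z _; rewrite mule_ge0// lee_fin.
    - move=> z _; rewrite -[leRHS]mul1e lee_wpmul2r ?lee_fin//.
      rewrite (_ : mkset _ = setT) ?probability_setT//.
      by apply/seteqP; split => // u _ /=.
  apply/funext => k.
  rewrite -(marginal_integral k (EFin \o L))//.
  by apply: eq_integral => p _; rewrite indicE mem_set /= ?mul1e.
have mG : measurable (`]a + c, +oo[%classic : set R) by [].
have mH : measurable (`]-oo, a - c[%classic : set R) by [].
have [G [mGG G0 Gi GE GL]] := slice_density _ mG.
have [H [mHH H0 Hi HE HL]] := slice_density _ mH.
(* The half-lines ]-oo, q] and ]a + c, +oo[ cover the line when q > a + c, so for every k their two
   slices together weigh at least the marginal. *)
have aG n : a + c < rational n -> \forall z \ae PZ, 1 <= w n z + G z.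
  move=> acn.
  apply: ae_le_of_integral_le => //.
  - exact: measurable_funD.
  - by move=> z; rewrite addr_ge0.
  - by have := integrableD measurableT (wi n) Gi; apply: eq_integrable.
  move=> A mA; rewrite integral_cst// mul1e.
  rewrite [leRHS](_ : _ = (\int[PZ]_(z in A) (w n z)%:E +
      \int[PZ]_(z in A) (G z)%:E)%E); last first.
    rewrite -ge0_integralD//.
    - by move=> z _; rewrite lee_fin.
    - by apply/measurable_EFinP; apply: measurable_funTS.
    - by move=> z _; rewrite lee_fin.
    - by apply/measurable_EFinP; apply: measurable_funTS.
  rewrite wE// GE// -lim_ultraD//; apply: lime_ge.
    by apply: ultra_cvge => k; rewrite adde_ge0.
  apply: nearW => k; apply: (@le_trans _ _ (pi_ k (A `*` setT))).
    by rewrite (marginal k A mA).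
  apply: le_trans (measureU2 _ _ _); [|exact: measurableX..].
  apply: le_measure; rewrite ?inE.
  - exact: measurableX.
  - by apply: measurableU; exact: measurableX.
  - move=> [z x] [/= Az _]; rewrite !in_itv/= andbT.
    by have [xn|nx] := leP x (rational n); [left|right; split => //; exact: lt_trans nx].
have aH n : rational n < a - c -> \forall z \ae PZ, w n z <= H z.
  move=> nac; apply: ae_le_of_integral_le => // A mA.
  rewrite wE// HE//; apply: lim_ultra_le => // k.
  apply: le_measure; rewrite ?inE.
  - exact: measurableX.
  - exact: measurableX.
  - by move=> [z x] [/= Az]; rewrite !in_itv/= => xn; split => //; exact: le_lt_trans nac.
have aGH : \forall z \ae PZ, (forall n, a + c < rational n -> 1 <= w n z + G z) /\
    (forall n, rational n < a - c -> w n z <= H z).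
  (* Countability of the rationals yields a single negligible set. *)
  have aG' : \forall z \ae PZ, forall n, a + c < rational n -> 1 <= w n z + G z.
    apply/ae_foralln => n; have [/aG|] := boolP (a + c < rational n).
      by apply: filterS.
    by move=> _; apply: aeW => z.
  have aH' : \forall z \ae PZ, forall n, rational n < a - c -> w n z <= H z.
    apply/ae_foralln => n; have [/aH|] := boolP (rational n < a - c).
      by apply: filterS.
    by move=> _; apply: aeW => z.
  by move: aG' aH'; apply: filterS2.
apply: (@le_trans _ _ (\int[PZ]_z ((G z)%:E * (L z)%:E + (H z)%:E * (L z)%:E))%E).
  apply: ae_ge0_le_integral => //.
  - by move=> z _; rewrite mule_ge0// lee_fin.
  - by move=> z _; rewrite adde_ge0// mule_ge0// lee_fin.
  - by apply: emeasurable_funD; apply: emeasurable_funM => //; exact/measurable_EFinP.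
  - apply: filterS aGH => z [zG zH] _; rewrite -ge0_muleDl ?lee_fin//.
    by rewrite lee_wpmul2r ?lee_fin// -EFinD; exact: quantile_rule_spread.
rewrite ge0_integralD//; last 4 first.
- by move=> z _; rewrite mule_ge0// lee_fin.
- by apply: emeasurable_funM => //; exact/measurable_EFinP.
- by move=> z _; rewrite mule_ge0// lee_fin.
- by apply: emeasurable_funM => //; exact/measurable_EFinP.
apply: le_trans (leeD (GL L mL L0) (HL L mL L0)) _.
rewrite -lim_ultraD; last 2 first.
- by move=> k; apply: integral_ge0 => p _; rewrite mule_ge0// lee_fin.
- by move=> k; apply: integral_ge0 => p _; rewrite mule_ge0// lee_fin.
apply: lim_ultra_le => k.
  by rewrite adde_ge0//; apply: integral_ge0 => p _; rewrite mule_ge0// lee_fin.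
rewrite -ge0_integralD//; last 4 first.
- by move=> z _; rewrite mule_ge0// lee_fin.
- exact: measurable_weighted_indic.
- by move=> z _; rewrite mule_ge0// lee_fin.
- exact: measurable_weighted_indic.
apply: ge0_le_integral => //.
- by move=> p _; rewrite adde_ge0// mule_ge0// lee_fin.
- by apply: emeasurable_funD; exact: measurable_weighted_indic.
- apply: measurable_weighted_indic => //.
  have mn : measurable_fun setT (fun x : measurableTypeR R => `|x - a|).
    by apply: measurableT_comp => //; exact: measurable_funB.
  rewrite (_ : mkset _ = (fun x : R => `|x - a|) @^-1` `]c, +oo[).
    by rewrite -[X in measurable X]setTI; exact: mn.
  by apply/seteqP; split => x /=; rewrite in_itv/= andbT.
move=> p _; rewrite -!EFinM -EFinD lee_fin -mulrDl ler_wpM2r//.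
have E : (p.2 \in [set x | c < `|x - a|]) = (a + c < p.2) || (p.2 < a - c).
  apply/idP/idP => [/set_mem/=|].
    by rewrite ltr_normr => /orP[|] ?; apply/orP; [left|right]; lra.
  by move=> /orP[|] ?; apply/mem_set; rewrite /= ltr_normr; apply/orP; [left|right]; lra.
rewrite !indicE E !mem_setE !in_itv andbT -natrD ler_nat /=.
case: (ltP (a + c) p.2) => p1; case: (ltP p.2 (a - c)) => p2 //=.
by exfalso; lra.
Qed.

(** The order of quantifiers is the point: one rule for all likelihood ratios L, targets a and
    losses lam. The second coordinate of the product is the uniform variable fed to the quantile
    transform. *)
Lemma randomized_rule_compactness :
  exists rule : {mfun (Z * measurableTypeR R)%type >-> R},
    forall (L : Z -> R) (a : R) (lam : R -> \bar R), measurable_fun setT L ->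
      (forall z, 0 <= L z) -> bowl_shaped lam -> lower_semicontinuous lam ->
    (\int[PZ \x unif]_p ((L p.1)%:E * lam (rule p - a)%R) <=
     lim ((fun n => \int[pi_ n]_p ((L p.1)%:E * lam (p.2 - a)%R)) @ U))%E.
Proof.
have mh n : measurable (`]-oo, rational n]%classic : set R) by [].
have /choice[w Hw] := fun n => slice_density _ (mh n).
have mw n : measurable_fun setT (w n) by have [] := Hw n.
have w0 n z : 0 <= w n z by have [] := Hw n.
have wi n : PZ.-integrable setT (EFin \o w n) by have [] := Hw n.
have wE n A : measurable A -> (\int[PZ]_(z in A) (w n z)%:E =
    lim ((fun k => pi_ k (A `*` `]-oo, rational n])) @ U))%E by have [_ _ _ H _] := Hw n; exact: H.
have mq := measurable_quantile_rule w mw.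
pose rule : {mfun (Z * measurableTypeR R)%type >-> R} :=
  HB.pack (quantile_rule w) (isMeasurableFun.Build _ _ _ _ _ mq).
exists rule => L a lam mL L0 hlam lsclam.
have ml := lower_semicontinuous_measurable lsclam.
have mfst : measurable_fun setT (fst : Z * measurableTypeR R -> Z) := measurable_fst.
have mL1 : measurable_fun setT (fun p : Z * measurableTypeR R => L p.1).
  exact: measurableT_comp mL mfst.
have L10 (p : Z * measurableTypeR R) : 0 <= L p.1 by [].
have mf1 : measurable_fun setT (fun p : Z * measurableTypeR R => lam (rule p - a)).
  apply: measurableT_comp ml _; exact: measurable_funB.
have mf2 : measurable_fun setT (fun p : Z * measurableTypeR R => lam (p.2 - a)).
  apply: measurableT_comp ml _; apply: measurable_funB => //; exact: measurable_snd.
have lam0 x : (0 <= lam x)%E by have [] := hlam.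
rewrite -(integral_density_measure (PZ \x unif)%E _ mL1 L10 _ mf1)//.
rewrite [X in lim (X @ U)](_ : _ =
    fun n => \int[density_measure (pi_ n) _ mL1 L10]_p lam (p.2 - a)%R)%E; last first.
  by apply/funext => n; rewrite integral_density_measure.
apply: integral_le_superlevel => // t t0.
have dE (m : {measure set (Z * measurableTypeR R) -> \bar R}) B :
    density_measure m _ mL1 L10 B = (\int[m]_p ((\1_B p)%:E * (L p.1)%:E))%E.
  rewrite /density_measure integral_mkcond; apply: eq_integral => p _.
  by rewrite epatch_indic/= muleC.
have [[c lc]|lt] := bowl_shaped_superlevel lam hlam lsclam t; last first.
  rewrite (_ : mkset _ = set0) ?measure0; first exact: lim_ultra_ge0.
  by apply/seteqP; split => // p /=; rewrite ltNge lt.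
have E1 : [set p | (t%:E < lam (rule p - a)%R)%E] = [set p | c < `|quantile_rule w p - a|].
  by apply/seteqP; split => p /=; rewrite lc.
have mE1 := measurable_quantile_rule_level w a c mw.
rewrite E1 [leLHS](dE (PZ \x unif)%E _).
apply: le_trans (le_trans (randomized_rule_level_set w mw w0 wi wE L a c mL L0) _).
  rewrite fubini_tonelli1//; last 2 first.
  - apply: emeasurable_funM; apply/measurable_EFinP => //; exact: measurable_indic.
  - by move=> p; rewrite mule_ge0// lee_fin.
  rewrite le_eqVlt; apply/orP; left; apply/eqP; apply: eq_integral => z _.
  have ml1 : measurable [set u : measurableTypeR R | c < `|quantile_rule w (z, u) - a|].
    have := measurable_xsection z mE1.
    by rewrite /xsection (_ : [set _ | _] = [set u | c < `|quantile_rule w (z, u) - a|])//;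
      apply/seteqP; split => u /=; rewrite inE.
  transitivity (\int[unif]_u ((\1_[set u | (c < `|quantile_rule w (z, u) - a|)%R] u)%:E *
      (L z)%:E))%E.
    apply: eq_integral => u _; rewrite !indicE.
    have -> // : ((z, u) \in [set p | c < `|quantile_rule w p - a|]) =
        (u \in [set u | c < `|quantile_rule w (z, u) - a|]).
    by apply/idP/idP => /set_mem H; apply/mem_set.
  rewrite ge0_integralZr//; last 2 first.
  - by apply/measurable_EFinP; exact: (measurable_indic ml1).
  - by rewrite lee_fin.
  by congr (_ * _)%E; rewrite integral_indic// setIT.
apply: lim_ultra_le => k; first by apply: integral_ge0 => p _; rewrite mule_ge0// lee_fin.
rewrite [leRHS](dE (pi_ k) _) le_eqVlt; apply/orP; left; apply/eqP.
apply: eq_integral => p _.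
rewrite !indicE.
have -> // : (p.2 \in [set x | c < `|x - a|]) = (p \in [set p | (t%:E < lam (p.2 - a)%R)%E]).
by apply/idP/idP => /set_mem H; apply/mem_set; move: H; rewrite /= lc.
Qed.

End RandomizedRule.

Lemma randomized_rule_limit {R : realType} {d : measure_display}
    {Z : measurableType d} (PZ : probability Z R)
    (pi_ : nat -> {measure set (Z * measurableTypeR R) -> \bar R}) :
  (forall n A, measurable A -> pi_ n (A `*` setT) = PZ A) ->
  exists rule : {mfun (Z * measurableTypeR R)%type >-> R},
    forall (L : Z -> R) (a : R) (lam_ : nat -> R -> \bar R) (lam : R -> \bar R)
        (r_ : nat -> \bar R) (r : \bar R),
      measurable_fun setT L -> (forall z, 0 <= L z) ->
      (forall n, bowl_shaped (lam_ n)) ->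
      (forall n, lower_semicontinuous (lam_ n)) ->
      (forall x m n, (m <= n)%N -> (lam_ m x <= lam_ n x)%E) ->
      (forall x, lam_ n x @[n --> \oo] --> lam x) ->
      (forall n, \int[pi_ n]_p ((L p.1)%:E * lam_ n (p.2 - a)%R) <= r_ n)%E ->
      r_ n @[n --> \oo] --> r ->
    (\int[PZ \x uniform_prob (@ltr01 R)]_p ((L p.1)%:E * lam (rule p - a)%R) <= r)%E.
Proof.
move=> marginal; have [U [UU ooU]] := @ultraFilterLemma nat \oo _.
have [rule Hrule] := randomized_rule_compactness U UU PZ pi_ marginal.
exists rule => L a lam_ lam r_ r mL L0 hlam lsclam nd cvlam rle cvr.
have lam0 n x : (0 <= lam_ n x)%E by have [] := hlam n.
have mfst : measurable_fun setT (fst : Z * measurableTypeR R -> Z) := measurable_fst.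
have mL1 : measurable_fun setT (fun p : Z * measurableTypeR R => (L p.1)%:E).
  by apply/measurable_EFinP; exact: measurableT_comp mL mfst.
have ml n := lower_semicontinuous_measurable (lsclam n).
have mf1 n : measurable_fun setT (fun p : Z * measurableTypeR R =>
    ((L p.1)%:E * lam_ n (rule p - a)%R)%E).
  apply: emeasurable_funM => //; apply: measurableT_comp (ml n) _.
  exact: measurable_funB.
have mf2 n : measurable_fun setT (fun p : Z * measurableTypeR R =>
    ((L p.1)%:E * lam_ n (p.2 - a)%R)%E).
  apply: emeasurable_funM => //; apply: measurableT_comp (ml n) _.
  by apply: measurable_funB => //; exact: measurable_snd.
have f0 n (p : Z * measurableTypeR R) x : (0 <= (L p.1)%:E * lam_ n x)%E.
  by rewrite mule_ge0// lee_fin.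
have -> : (\int[PZ \x uniform_prob (@ltr01 R)]_p ((L p.1)%:E * lam (rule p - a)%R) =
    limn (fun n => \int[PZ \x uniform_prob (@ltr01 R)]_p ((L p.1)%:E * lam_ n (rule p - a)%R)))%E.
  rewrite -monotone_convergence//.
    by apply: eq_integral => p _; apply/esym/cvg_lim => //; exact: cvgeZl.
  by move=> p _ m n mn; rewrite lee_wpmul2l ?lee_fin// nd.
apply: lime_le.
  apply: ereal_nondecreasing_is_cvgn => m n mn; apply: ge0_le_integral => //.
  by move=> p _; rewrite lee_wpmul2l ?lee_fin// nd.
(* The loss is frozen at index m while the measures run along the ultrafilter; for n >= m it is
   dominated by [lam_ n], whose integral is at most [r_ n]. Monotone convergence in m then
   concludes. *)
apply: nearW => m; apply: le_trans (Hrule L a (lam_ m) mL L0 (hlam m) (lsclam m)) _.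
have cvU : r_ @ U --> r by apply: cvg_trans cvr => A; exact: ooU.
rewrite -(cvg_lim _ cvU)//; apply: lee_lim.
- by apply: ultra_cvge => n; exact: integral_ge0.
- by apply/cvg_ex; exists r.
apply: ooU; exists m => // n /= mn; apply: le_trans (rle n).
apply: ge0_le_integral => //.
by move=> p _; rewrite lee_wpmul2l ?lee_fin// nd.
Qed.

(** * The isonormal process *)

Section InnerProduct.
Context {d : measure_display} {X : measurableType d} {R : realType}.
Context {P : probability X R}.
Implicit Types f g h : L2 P.

Lemma integrable_inner f g : P.-integrable setT (EFin \o (fun x => f x * g x)).
Proof.
by apply/Lfun1_integrable; apply: Lfun2_mul_Lfun1; exact: LfunP.
Qed.

Lemma innerC f g : inner f g = inner g f.
Proof. by apply: eq_Rintegral => x _; rewrite mulrC. Qed.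

Lemma inner_linear (a : R) f g h :
  inner (a *: f + g) h = a * inner f h + inner g h.
Proof.
have iafh : P.-integrable setT (EFin \o (fun x => a * (f x * h x))).
  by have := integrableZl measurableT a (integrable_inner f h); apply: eq_integrable.
rewrite /inner -RintegralZl//; last exact: integrable_inner.
rewrite -RintegralD//; last exact: integrable_inner.
by apply: eq_Rintegral => x _; rewrite /= mulrDl mulrA.
Qed.

Lemma inner0 g : inner 0 g = 0.
Proof. by have := inner_linear (-1) 0 0 g; rewrite scaler0 addr0 mulN1r addNr. Qed.

Lemma inner_ge0 f : 0 <= inner f f.
Proof. by apply: Rintegral_ge0 => x _; rewrite -expr2 sqr_ge0. Qed.

End InnerProduct.

Section GaussianShiftExperiment.
Context {d : measure_display} {X : measurableType d} {R : realType}.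
Context {P : probability X R}.
Context {d' : measure_display} {Omega : measurableType d'}.
Variables (Q : probability Omega R) (Delta : L2 P -> Omega -> R).
Variables (TT : set (L2 P)) (hDelta : isonormal Q Delta TT).

Lemma isonormal_measurable g : TT g -> measurable_fun setT (Delta g).
Proof. by case: hDelta => + _ _; exact. Qed.

(** Combinations of the variables themselves: an isonormal process is linear in its index only
    almost surely, so a combination need not be some [Delta g] pointwise. *)
Definition gaussian_span : set (Omega -> R) :=
  [set Y | exists n (c : 'I_n -> R) (g : 'I_n -> L2 P), (forall i, TT (g i)) /\
     Y = (fun w => \sum_i c i * Delta (g i) w)].

Lemma gaussian_space_span : gaussian_space Q gaussian_span.
Proof.
case: hDelta => mD lawD _; split.
- move=> _ [n [c [g [gT ->]]]]; have [v v0 lv] := lawD n g c gT.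
  exists v; split => //.
  by apply: measurable_sum => i; apply: measurable_funM => //; exact: mD.
- exists 0%N, (fun=> 0), (fun=> 0); split => [[]//|].
  by apply/funext => w; rewrite big_ord0.
- move=> a _ _ [n [c [g [gT ->]]]] [m [c' [g' [gT' ->]]]].
  exists (n + m)%N, (fun i => match fintype.split i with inl j => a * c j | inr j => c' j end),
    (fun i => match fintype.split i with inl j => g j | inr j => g' j end); split.
    by move=> i; case: (fintype.split i).
  apply/funext => w; rewrite big_split_ord/= mulr_sumr; congr (_ + _).
    by apply: eq_bigr => i _; rewrite -[lshift _ _]/(unsplit (inl i)) unsplitK mulrA.
  by apply: eq_bigr => i _; rewrite -[rshift _ _]/(unsplit (inr i)) unsplitK.
Qed.

Lemma gaussian_spanZ (c : R) g : TT g -> gaussian_span (fun w => c * Delta g w).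
Proof.
by move=> gT; exists 1%N, (fun=> c), (fun=> g); split => //; apply/funext => w; rewrite big_ord1.
Qed.

Lemma gaussian_span_Delta g : TT g -> gaussian_span (Delta g).
Proof.
move=> gT; have := gaussian_spanZ 1 g gT.
by rewrite (_ : (fun w => _) = Delta g)//; apply/funext => w; rewrite mul1r.
Qed.

Lemma isonormal_variance g : TT g -> ('V_Q[Delta g] = (inner g g)%:E)%E.
Proof. by case: hDelta => _ _ + gT; exact. Qed.

Lemma isonormal_gaussian g : TT g -> gaussian_law Q (Delta g) (inner g g).
Proof.
move=> gT; have [+ _ _] := gaussian_space_span.
move=> /(_ _ (gaussian_span_Delta g gT))[v lv].
suff <- : v = inner g g by exact: lv.
by apply: EFin_inj; rewrite -(isonormal_variance g gT); apply/esym; exact: gaussian_law_variance lv.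
Qed.

Lemma measurable_observation (S : set (L2 P)) h : S `<=` TT ->
  measurable_fun setT (observation Delta (S:=S) h).
Proof.
move=> ST; apply: measurable_path => g; apply: measurable_funD => //.
by apply: isonormal_measurable; apply: ST; exact: set_valP.
Qed.

Lemma observation_indep (S : set (L2 P)) (k h : L2 P)
    (f : R * path_space R S -> \bar R) : TT k -> S `<=` TT ->
  (forall g, S g -> inner k g = 0) ->
  measurable_fun setT f -> (forall x, 0 <= f x)%E ->
  (\int[Q]_w f (Delta k w, observation Delta (S:=S) h w) =
   \int[Q]_w \int[Q]_w' f (Delta k w, observation Delta (S:=S) h w'))%E.
Proof.
move=> kT ST kS mf f0.
pose f' (p : R * path_space R S) := f (p.1, fun g => p.2 g + inner h (val g)).
rewrite -[LHS]/(\int[Q]_w f' (Delta k w, fun g => Delta (val g) w))%E.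
rewrite (uncorrelated_gaussian_indep Q gaussian_span)//.
- exact: gaussian_space_span.
- exact: gaussian_span_Delta.
- by move=> g; apply: gaussian_span_Delta; apply: ST; exact: set_valP.
- move=> g; have [_ _ ->]// := hDelta; last by apply: ST; exact: set_valP.
  by rewrite kS//; exact: set_valP.
- apply: measurableT_comp mf _; apply/measurable_fun_pairP; split => /=.
    exact: (@measurable_fst _ _ R (path_space R S)).
  apply: measurable_path => g; apply: measurable_funD => //.
  exact: measurableT_comp (measurable_coordinate S g)
    (@measurable_snd _ _ R (path_space R S)).
- by move=> x; exact: f0.
Qed.

(** The shift formula for X = c Delta k: its covariance with Delta g is c <k, g>, exactly the drift
    added at g, and its variance is c^2 <k, k>. *)
Lemma observation_shift (S : set (L2 P)) (c : R) (k h : L2 P)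
    (f : path_space R S -> \bar R) : TT k -> S `<=` TT ->
  measurable_fun setT f -> (forall x, 0 <= f x)%E ->
  (\int[Q]_w f (observation Delta (S:=S) (c *: k + h)%R w) =
   \int[Q]_w ((expR (c * Delta k w - c ^+ 2 * inner k k / 2)%R)%:E *
     f (observation Delta (S:=S) h w)))%E.
Proof.
move=> kT ST mf f0.
pose f' (z : path_space R S) := f (fun g => z g + inner h (val g)).
have lk := gaussian_law_Lfun2 Q _ _ (isonormal_gaussian k kT).
have cE : (fun w => c * Delta k w) = (c \o* Delta k).
  by apply/funext => w; rewrite /= mulrC.
have gS g : S g -> TT g by exact: ST.
have gY (g : S) : gaussian_span (Delta (val g)).
  by apply: gaussian_span_Delta; apply: gS; exact: set_valP.
have vk : ('V_Q[fun w => (c * Delta k w)%R] = (c ^+ 2 * inner k k)%:E)%E.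
  by rewrite cE varianceZ// isonormal_variance.
have ck (g : S) : covariance Q (fun w => c * Delta k w) (Delta (val g)) =
    (c * inner k (val g))%:E.
  have gT : TT (val g) by apply: gS; exact: set_valP.
  have lg := gaussian_law_Lfun2 Q _ _ (isonormal_gaussian _ gT).
  rewrite cE covarianceZl ?Lfun2_mul_Lfun1//; last 2 first.
  - by apply: Lfun_subset12 => //; exact: fin_num_measure.
  - by apply: Lfun_subset12 => //; exact: fin_num_measure.
  by have [_ _ ->] := hDelta.
have mf' : measurable_fun setT f'.
  apply: measurableT_comp mf _.
  apply: measurable_path => g; apply: measurable_funD => //.
  exact: measurable_coordinate S g.
have f'0 z : (0 <= f' z)%E by exact: f0.
have := gaussian_shift Q gaussian_span gaussian_space_span S _
  (fun g => Delta (val g)) _ _ (gaussian_spanZ c k kT) gY vk ck f' mf' f'0.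
apply: etrans; apply: eq_integral => w _; rewrite /f'; congr f.
by apply/funext => g; rewrite /observation inner_linear addrA.
Qed.

End GaussianShiftExperiment.

(** * Upper and lower bounds *)

Section Core.
Context {d : measure_display} {X : measurableType d} {R : realType}.
Context {P : probability X R}.
Variables (TT : set (L2 P)) (gamma : L2 P -> R) (hT : linear_subspace TT).

Lemma linear_subspaceZ (a : R) (f : L2 P) : TT f -> TT (a *: f).
Proof. by case: hT => T0 TD Tf; have := TD a f 0 Tf T0; rewrite addr0. Qed.

Lemma core_sub : core TT gamma `<=` TT.
Proof. by move=> w [[]]. Qed.

(** The defining identity of the core is applied to v = w itself with coefficient c - 1. *)
Lemma core_homogeneous (w : L2 P) (c : R) : core TT gamma w -> gamma (c *: w) = c * gamma w.
Proof.
move=> [aw /(_ w (c - 1) aw)].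
rewrite -[X in X + _ *: _]scale1r -scalerDl addrC subrK => ->.
by rewrite mulrBl mul1r addrC subrK.
Qed.

Lemma coreZ (w : L2 P) (c : R) : core TT gamma w -> core TT gamma (c *: w).
Proof.
move=> cw; have [[Tw _] wD] := cw; split; first split.
- exact: linear_subspaceZ.
- by rewrite -scaleNr !core_homogeneous// mulNr addrN.
- by move=> v a av; rewrite scalerA wD// core_homogeneous// mulrA.
Qed.

Lemma orthocomplement_sub (W : set (L2 P)) : orthocomplement TT W `<=` TT.
Proof. by move=> h []. Qed.

End Core.

Section UpperBound.
Context {d : measure_display} {X : measurableType d} {R : realType}.
Context {P : probability X R}.
Context {d' : measure_display} {Omega : measurableType d'}.
Variables (Q : probability Omega R) (Delta : L2 P -> Omega -> R).
Variables (TT : set (L2 P)) (hDelta : isonormal Q Delta TT).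
Variables (S : set (L2 P)) (ST : S `<=` TT).

Definition path_inclusion (g : S) : TT :=
  exist _ (val g) (mem_set (ST (val g) (set_valP g))).

Definition path_restriction (z : path_space R TT) : path_space R S :=
  fun g => z (path_inclusion g).

Lemma measurable_path_restriction : measurable_fun setT path_restriction.
Proof.
apply: measurable_path => g; exact: measurable_coordinate TT (path_inclusion g).
Qed.

Lemma path_restriction_observation (h : L2 P) (w : Omega) :
  path_restriction (observation Delta h w) = observation Delta h w.
Proof. by []. Qed.

Lemma observation_orthogonal (k h : L2 P) (w : Omega) :
  (forall g, S g -> inner k g = 0) ->
  observation Delta (S:=S) (k + h) w = observation Delta h w.
Proof.
move=> kS; apply/funext => g; rewrite /observation; congr (_ + _).
have := inner_linear 1 k h (val g); rewrite scale1r mul1r => ->.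
by rewrite kS ?add0r//; exact: set_valP.
Qed.

Context {da : measure_display} {Aux : measurableType da}.
Variables (nu : probability Aux R) (l : R -> \bar R).
Hypotheses (ml : measurable_fun setT l) (l0 : forall x, (0 <= l x)%E).

(** Neither orthogonal component disturbs the other: the restriction to S does not see k, and Z(psi)
    = Delta psi + <psi, k> does not see h. The error is thus that of the given rule plus Delta
    psi. *)
Lemma shifted_rule_risk (rule : {mfun (path_space R S * Aux)%type >-> R})
    (psi : L2 P) : TT psi -> (forall g, S g -> inner psi g = 0) ->
  measurable_fun setT (smoothed_loss l (inner psi psi)) ->
  exists rule' : {mfun (path_space R TT * Aux)%type >-> R},
    forall (k h : L2 P) (t : R),
      (forall g, S g -> inner k g = 0) -> inner psi h = 0 ->
    risk Q Delta l nu rule' (k + h) (inner psi k + t) =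
    risk Q Delta (smoothed_loss l (inner psi psi)) nu rule h t.
Proof.
move=> psiT psiS msl; pose ps : TT := exist _ psi (mem_set psiT).
pose r' (p : path_space R TT * Aux) := rule (path_restriction p.1, p.2) + p.1 ps.
have mr' : measurable_fun setT r'.
  apply: measurable_funD.
    apply: measurableT_comp => //; apply/measurable_fun_pairP; split => /=.
      exact: measurableT_comp measurable_path_restriction
        (@measurable_fst _ _ (path_space R TT) Aux).
    exact: (@measurable_snd _ _ (path_space R TT) Aux).
  exact: measurableT_comp (measurable_coordinate TT ps)
    (@measurable_fst _ _ (path_space R TT) Aux).
pose rule' : {mfun (path_space R TT * Aux)%type >-> R} :=
  HB.pack r' (isMeasurableFun.Build _ _ _ _ _ mr').
exists rule' => k h t kS psih.
have mO : measurable_fun setT (observation Delta (S:=S) h).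
  exact: (measurable_observation Q Delta TT hDelta S h ST).
have mpsi := isonormal_measurable Q Delta TT hDelta psi psiT.
pose F (p : Omega * Aux) := l (rule (observation Delta h p.1, p.2) + Delta psi p.1 - t).
have mrO : measurable_fun setT (fun p : Omega * Aux => rule (observation Delta h p.1, p.2)).
  apply: measurableT_comp => //; apply/measurable_fun_pairP; split => /=.
    exact: measurableT_comp mO (@measurable_fst _ _ Omega Aux).
  exact: (@measurable_snd _ _ Omega Aux).
have mF : measurable_fun setT F.
  apply: measurableT_comp ml _; apply: measurable_funB => //; apply: measurable_funD => //.
  exact: measurableT_comp mpsi (@measurable_fst _ _ Omega Aux).
have -> : risk Q Delta l nu rule' (k + h) (inner psi k + t) = (\int[Q \x nu]_p F p)%E.
  apply: eq_integral => p _; rewrite /F /= /r'/= path_restriction_observation.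
  rewrite (observation_orthogonal k h)//; congr l.
  rewrite {2}/observation /=.
  have := inner_linear 1 k h psi; rewrite scale1r mul1r => ->.
  by rewrite (innerC k) (innerC h) psih; lra.
pose G (p : Omega * Aux) := smoothed_loss l (inner psi psi)
  (rule (observation Delta h p.1, p.2) - t).
have mG : measurable_fun setT G.
  by apply: measurableT_comp msl _; exact: measurable_funB.
rewrite -[RHS]/(\int[Q \x nu]_p G p)%E.
have G0 p : (0 <= G p)%E by apply: integral_ge0 => x _.
have F0 p : (0 <= F p)%E by exact: l0.
(* The auxiliary variable is integrated last, so that independence is used at a fixed value of
   it. *)
apply: etrans (fubini_tonelli2 F mF F0) _.
apply: etrans _ (esym (fubini_tonelli2 G mG G0)).
apply: eq_integral => a _; rewrite /fubini_G.
pose f (p : R * path_space R S) := l (rule (p.2, a) + p.1 - t).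
have mf : measurable_fun setT f.
  apply: measurableT_comp ml _; apply: measurable_funB => //; apply: measurable_funD; last first.
    exact: (@measurable_fst _ _ R (path_space R S)).
  apply: measurableT_comp => //; apply/measurable_fun_pairP; split => /=.
    exact: (@measurable_snd _ _ R (path_space R S)).
  exact: measurable_cst.
transitivity (\int[Q]_w f (Delta psi w, observation Delta h w))%E; first by [].
rewrite (observation_indep Q Delta TT hDelta S psi h f)//; last by move=> x; exact: l0.
have mF2 : measurable_fun setT (fun p : Omega * Omega =>
    f (Delta psi p.1, observation Delta h p.2)).
  apply: measurableT_comp mf _; apply/measurable_fun_pairP; split => /=.
    exact: measurableT_comp mpsi (@measurable_fst _ _ Omega Omega).
  exact: measurableT_comp mO (@measurable_snd _ _ Omega Omega).
have F20 p : (0 <= f (Delta psi p.1, observation Delta (S:=S) h p.2))%E by exact: l0.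
apply: etrans (fubini_tonelli _ mF2 F20) _.
apply: eq_integral => w _; rewrite /G /smoothed_loss.
rewrite -(ge0_integral_gaussian_law Q (Delta psi) _ _
  (isonormal_gaussian Q Delta TT hDelta psi psiT))//.
- by apply: eq_integral => w' _; rewrite /f /=; congr l; lra.
- by apply: measurableT_comp ml _; exact: measurable_funD.
Qed.

End UpperBound.

(** * Averaging the risk over a bounded range of shifts *)

Section FlatPrior.
Context {R : realType}.
Variables (v M : R) (v0 : 0 < v) (M0 : 0 < M).
Local Notation leb := (@lebesgue_measure R).

(* The density, with respect to N(0, v), of the uniform law on [-M, M]. *)
Definition flat_weight (x : R) : R :=
  if `|x| <= M then Num.sqrt (v * pi *+ 2) * expR (x ^+ 2 / (2 * v)) / (2 * M) else 0.

Lemma flat_weight_ge0 x : 0 <= flat_weight x.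
Proof.
rewrite /flat_weight; case: ifP => // _.
by rewrite divr_ge0 ?mulr_ge0 ?sqrtr_ge0 ?expR_ge0// ltW.
Qed.

Lemma measurable_flat_weight : measurable_fun setT flat_weight.
Proof.
apply: measurable_fun_ifT; last exact: measurable_cst.
  by apply: measurable_fun_ler => //; exact: measurableT_comp.
apply: measurable_funM => //; apply: measurable_funM => //.
by apply: measurableT_comp => //; apply: measurable_funM => //; exact: measurable_funX.
Qed.

Lemma flat_weight_npdf x : `|x| <= M -> flat_weight x * npdf v x = (2 * M)^-1.
Proof.
move=> xM; rewrite /flat_weight xM npdfE// mulNr expRN.
have s0 : Num.sqrt (v * pi *+ 2) != 0.
  by rewrite gt_eqF// sqrtr_gt0 mulrn_wgt0// mulr_gt0// pi_gt0.
have e0 := expR_eq0 (x ^+ 2 / (2 * v)).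
have M1 := lt0r_neq0 M0.
by field; rewrite e0 M1 s0.
Qed.

Lemma integral_flat_weight : (\int[centred_normal v]_x (flat_weight x)%:E = 1)%E.
Proof.
rewrite integral_centred_normal//; last 2 first.
- by apply/measurable_EFinP; exact: measurable_flat_weight.
- by move=> x; rewrite lee_fin flat_weight_ge0.
transitivity (\int[leb]_(x in `[(- M)%R, M]) ((2 * M)^-1)%:E)%E.
  rewrite [RHS]integral_mkcond; apply: eq_integral => x _; rewrite patchE.
  rewrite mem_setE in_itv/= -ler_norml -EFinM; case: ifPn => xM.
    by rewrite mulrC flat_weight_npdf.
  by rewrite /flat_weight (negbTE xM) mulr0.
rewrite integral_cst//; have := @lebesgue_measure_itv R `[- M, M].
rewrite /= lte_fin gtrN// => -> ; rewrite -EFinB -EFinM; congr _%:E.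
have M1 := lt0r_neq0 M0; by field.
Qed.

Variable l : R -> \bar R.
Hypotheses (ml : measurable_fun setT l) (l0 : forall x, (0 <= l x)%E).

(* Completing the square: up to the factor npdf v x, the exponential weight is
   the normal density at x - s. *)
Lemma flat_weight_truncated_loss (n : nat) (c x : R) :
  ((flat_weight x)%:E * truncated_loss l v n (c - x)%R <=
   \int[leb]_(s in `[(- (M + n%:R))%R, (M + n%:R)%R])
     ((expR (s * x / v - s ^+ 2 / (2 * v)) / (2 * M))%:E * l (c - s)%R))%E.
Proof.
rewrite /truncated_loss /kernel_loss.
have mp : measurable_fun setT (fun g : R => ((truncated_npdf v n g)%:E * l (c - x + g)%R)%E).
  apply: emeasurable_funM; first by apply/measurable_EFinP; exact: measurable_truncated_npdf.
  by apply: measurableT_comp ml _; exact: measurable_funD.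
have p0 g : (0 <= (truncated_npdf v n g)%:E * l (c - x + g)%R)%E.
  by rewrite mule_ge0// lee_fin truncated_npdf_ge0.
(* The substitution g = x - s turns c - x + g into c - s, so the kernel variable becomes the
   shift. *)
rewrite -(ge0_integral_reflect x _ mp p0).
have mp' : measurable_fun setT (fun s : R => ((truncated_npdf v n (x - s)%R)%:E *
    l (c - x + (x - s))%R)%E).
  by apply: (measurableT_comp mp); exact: measurable_funB.
have me : measurable_fun setT (fun s : R =>
    ((expR (s * x / v - s ^+ 2 / (2 * v)) / (2 * M))%:E * l (c - s)%R)%E).
  apply: emeasurable_funM.
    apply/measurable_EFinP; apply: measurable_funM => //; apply: measurableT_comp => //.
    by apply: measurable_funB; apply: measurable_funM => //; exact: measurable_funM.
  by apply: measurableT_comp ml _; exact: measurable_funB.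
rewrite -ge0_integralZl//; last by rewrite lee_fin flat_weight_ge0.
rewrite [leRHS]integral_mkcond; apply: ge0_le_integral => //.
- by move=> s _; rewrite mule_ge0// lee_fin flat_weight_ge0.
- exact: measurable_funeM.
- apply/(measurable_restrictT _ _).1 => //; exact: measurable_funTS.
move=> s _; rewrite patchE mem_setE in_itv/= -ler_norml.
have -> : c - x + (x - s) = c - s by ring.
have e0 : 0 <= expR (s * x / v - s ^+ 2 / (2 * v)) / (2 * M).
  by rewrite divr_ge0 ?expR_ge0// mulr_ge0// ltW.
rewrite muleA -EFinM /truncated_npdf.
have [xM|Mx] := leP `|x| M; last first.
  rewrite (_ : flat_weight x = 0) ?mul0r ?mul0e; last by rewrite /flat_weight leNgt Mx.
  case: ifP => // _.
  by rewrite mule_ge0// lee_fin.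
have [xsn|nxs] := leP `|x - s| n%:R; last first.
  rewrite mulr0 mul0e; case: ifP => // _.
  by rewrite mule_ge0// lee_fin.
(* Here the range of s is fixed: |x| <= M and |x - s| <= n give |s| <= M + n. *)
rewrite ifT; last first.
  have -> : s = x - (x - s) by ring.
  by rewrite (le_trans (ler_normB _ _))// lerD.
by rewrite npdf_translate// mulrCA flat_weight_npdf.
Qed.

(** The factor is the length 2 (M + n) of the range of s divided by the normalization 2 M of the
    flat weight. *)
Lemma averaged_shift {dY : measure_display} {Y : measurableType dY}
    (mu : probability Y R) (T G : Y -> R) (n : nat) (r : \bar R) :
  measurable_fun setT (truncated_loss l v n) ->
  measurable_fun setT T -> measurable_fun setT G ->
  (forall s, \int[mu]_y ((expR (s * G y / v - s ^+ 2 / (2 * v))%R)%:E *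
     l (T y - s)%R) <= r)%E ->
  (\int[mu]_y ((flat_weight (G y))%:E * truncated_loss l v n (T y - G y)%R) <=
     ((M + n%:R) / M)%:E * r)%E.
Proof.
move=> mtl mT mG Hr.
pose F (p : Y * measurableTypeR R) : \bar R :=
  ((expR (p.2 * G p.1 / v - p.2 ^+ 2 / (2 * v)) / (2 * M))%:E * l (T p.1 - p.2)%R)%E.
have mT1 : measurable_fun setT (fun p : Y * measurableTypeR R => T p.1).
  exact: measurableT_comp mT (@measurable_fst _ _ Y (measurableTypeR R)).
have mG1 : measurable_fun setT (fun p : Y * measurableTypeR R => G p.1).
  exact: measurableT_comp mG (@measurable_fst _ _ Y (measurableTypeR R)).
have m2 : measurable_fun setT (fun p : Y * measurableTypeR R => p.2 : R).
  exact: (@measurable_snd _ _ Y (measurableTypeR R)).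
have mF : measurable_fun setT F.
  apply: emeasurable_funM; last by apply: measurableT_comp ml _; exact: measurable_funB.
  apply/measurable_EFinP; apply: measurable_funM => //; apply: measurableT_comp => //.
  by apply: measurable_funB; apply: measurable_funM => //;
    [exact: measurable_funM|exact: measurable_funX].
have F0 p : (0 <= F p)%E.
  by rewrite mule_ge0// lee_fin divr_ge0 ?expR_ge0// mulr_ge0// ltW.
set I := `[(- (M + n%:R))%R, (M + n%:R)%R].
have mI : measurable [set` I] by exact: measurable_itv.
pose leI := mrestr leb mI.
pose H (p : Y * measurableTypeR R) : \bar R := ((\1_[set` I] p.2)%:E * F p)%E.
have mH : measurable_fun setT H.
  apply: emeasurable_funM => //; apply/measurable_EFinP.
  exact: measurable_indic_snd.
have H0 p : (0 <= H p)%E by rewrite mule_ge0// lee_fin.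
apply: (@le_trans _ _ (\int[mu]_y \int[leb]_s H (y, s))%E).
  apply: ge0_le_integral => //.
  - move=> y _; rewrite mule_ge0 ?lee_fin ?flat_weight_ge0//.
    by apply: integral_ge0 => g _; rewrite mule_ge0// lee_fin truncated_npdf_ge0.
  - apply: emeasurable_funM.
      by apply/measurable_EFinP; exact: measurableT_comp measurable_flat_weight mG.
    by apply: measurableT_comp mtl _; exact: measurable_funB.
  - exact: (measurable_fun_fubini_tonelli_F _ mH).
  - move=> y _; apply: le_trans (flat_weight_truncated_loss _ _ _) _.
    rewrite integral_mkcond le_eqVlt; apply/orP; left; apply/eqP.
    by apply: eq_integral => s _; rewrite /H epatch_indic muleC.
rewrite (fubini_tonelli H)//.
apply: (@le_trans _ _ (\int[leb]_(s in [set` I]) ((2 * M)^-1%:E * r))%E).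
  rewrite [leRHS]integral_mkcond; apply: ge0_le_integral => //.
  - by move=> s _; exact: integral_ge0.
  - exact: measurable_fun_fubini_tonelli_G.
  - apply/(measurable_restrictT _ _).1 => //.
  move=> s _; rewrite epatch_indic [leRHS]muleC.
  have -> : (\int[mu]_y H (y, s) = (\1_[set` I] s)%:E * \int[mu]_y F (y, s))%E.
    rewrite -ge0_integralZl//.
    by apply: (measurableT_comp mF); exact: measurable_pair2.
  rewrite lee_wpmul2l ?lee_fin//.
  have mE : measurable_fun setT (fun y => ((expR (s * G y / v - s ^+ 2 / (2 * v))%R)%:E *
      l (T y - s)%R)%E).
    apply: emeasurable_funM; last by apply: measurableT_comp ml _; exact: measurable_funB.
    apply/measurable_EFinP; apply: measurableT_comp => //; apply: measurable_funB => //.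
    by apply: measurable_funM => //; exact: measurable_funM.
  apply: (@le_trans _ _ ((2 * M)^-1%:E * \int[mu]_y ((expR (s * G y / v -
      s ^+ 2 / (2 * v))%R)%:E * l (T y - s)%R))%E); last first.
    by rewrite lee_wpmul2l// lee_fin invr_ge0 mulr_ge0// ltW.
  rewrite -ge0_integralZl//; last 2 first.
  - by move=> y _; rewrite mule_ge0// lee_fin expR_ge0.
  - by rewrite lee_fin invr_ge0 mulr_ge0// ltW.
  rewrite le_eqVlt; apply/orP; left; apply/eqP; apply: eq_integral => y _.
  by rewrite /F/= muleA -EFinM mulrC.
rewrite integral_cst//; have := @lebesgue_measure_itv R I.
have N0 : 0 < M + n%:R by rewrite ltr_pwDl.
rewrite /= lte_fin gtrN// => ->; rewrite -EFinB muleAC -EFinM.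
have M1 := lt0r_neq0 M0.
by rewrite (_ : (2 * M)^-1 * _ = (M + n%:R) / M)//; field.
Qed.

End FlatPrior.

(** * A limit rule based on the orthogonal observation *)

Section LimitRule.
Context {d : measure_display} {X : measurableType d} {R : realType}.
Context {P : probability X R}.
Context {d' : measure_display} {Omega : measurableType d'}.
Variables (Q : probability Omega R) (Delta : L2 P -> Omega -> R).
Variables (TT : set (L2 P)) (hDelta : isonormal Q Delta TT).
Variables (S : set (L2 P)) (ST : S `<=` TT).
Context {da : measure_display} {Aux : measurableType da}.
Variables (nu : probability Aux R)
  (rule : {mfun (path_space R TT * Aux)%type >-> R}).
Variables (psi : L2 P) (psiT : TT psi) (psiS : forall g, S g -> inner psi g = 0).
Variables (wt : nat -> R -> R) (b : R).
Hypotheses (mwt : forall n, measurable_fun setT (wt n)) (wt0 : forall n x, 0 <= wt n x)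
  (wt1 : forall n, (\int[Q]_w (wt n (Delta psi w))%:E = 1)%E).

Let ps : TT := exist _ psi (mem_set psiT).

Let O := observation Delta (S:=S) 0.

Let mO : measurable_fun setT O.
Proof. exact: (measurable_observation Q Delta TT hDelta S 0 ST). Qed.

Let mpsi : measurable_fun setT (Delta psi).
Proof. exact: (isonormal_measurable Q Delta TT hDelta psi psiT). Qed.

Let statistic (h : L2 P) (p : Omega * Aux) : R :=
  rule (observation Delta h p.1, p.2) - b * Delta psi p.1.

Let mstatistic h : measurable_fun setT (statistic h).
Proof.
apply: measurable_funB.
  apply: measurableT_comp => //; apply/measurable_fun_pairP; split => /=.
    exact: measurableT_comp (measurable_observation Q Delta TT hDelta TT h (@subset_refl _ _))
      (@measurable_fst _ _ Omega Aux).
  exact: (@measurable_snd _ _ Omega Aux).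
apply: measurable_funM => //.
exact: measurableT_comp mpsi (@measurable_fst _ _ Omega Aux).
Qed.

Let mW n : measurable_fun setT (fun p : Omega * Aux => wt n (Delta psi p.1)).
Proof.
apply: measurableT_comp (mwt n) _.
exact: measurableT_comp mpsi (@measurable_fst _ _ Omega Aux).
Qed.

Let W0 n (p : Omega * Aux) : 0 <= wt n (Delta psi p.1).
Proof. by []. Qed.

Let joint (p : Omega * Aux) : path_space R S * measurableTypeR R := (O p.1, statistic 0 p).

Let mjoint : measurable_fun setT joint.
Proof.
apply/measurable_fun_pairP; split => /=; last exact: mstatistic.
exact: measurableT_comp mO (@measurable_fst _ _ Omega Aux).
Qed.

Let PZ : probability (path_space R S) R :=
  distribution Q (HB.pack O (isMeasurableFun.Build _ _ _ _ _ mO) : {mfun Omega >-> path_space R S}).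

Let integral_PZ (g : path_space R S -> \bar R) : measurable_fun setT g ->
  (forall z, 0 <= g z)%E -> (\int[PZ]_z g z = \int[Q]_w g (O w))%E.
Proof.
move=> mg g0; have g0' : {in [set: path_space R S], forall z, 0 <= g z}%E by [].
have := @ge0_integral_pushforward _ _ Omega (path_space R S) R O mO Q setT g
  measurableT mg g0'.
by rewrite preimage_setT.
Qed.

Let pi_of (mj : measurable_fun setT joint) n :
    {measure set (path_space R S * measurableTypeR R) -> \bar R} :=
  measure_function_pushforward__canonical__measure_function_Measure
    (density_measure (Q \x nu)%E _ (mW n) (W0 n)) mj.

Let pi_ := pi_of mjoint.

Let integral_pi n (f : path_space R S * measurableTypeR R -> \bar R) :
  measurable_fun setT f -> (forall x, 0 <= f x)%E ->
  (\int[pi_ n]_x f x =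
   \int[Q \x nu]_p ((wt n (Delta psi p.1))%:E * f (O p.1, statistic 0%R p)))%E.
Proof.
move=> mf f0; rewrite ge0_integral_pushforward// preimage_setT integral_density_measure//.
  exact: measurableT_comp mf mjoint.
by move=> p; exact: f0.
Qed.

(** The weight is a function of Delta psi, independent of the observation on S, and it integrates to
    1. *)
Let marginal n A : measurable A -> pi_ n (A `*` setT) = PZ A.
Proof.
move=> mA.
have mI : measurable (A `*` [set: measurableTypeR R]) by exact: measurableX.
transitivity (\int[pi_ n]_x (\1_(A `*` [set: measurableTypeR R]) x)%:E)%E.
  by rewrite integral_indic// setIT.
rewrite integral_pi//; last by apply/measurable_EFinP; exact: measurable_indic.
have mIO : measurable_fun setT (fun w => (\1_A (O w))%:E : \bar R).
  by apply/measurable_EFinP; apply: measurableT_comp mO; exact: measurable_indic.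
pose f (p : R * path_space R S) : \bar R := ((wt n p.1)%:E * (\1_A p.2)%:E)%E.
have mf : measurable_fun setT f.
  apply: emeasurable_funM; apply/measurable_EFinP.
    exact: measurableT_comp (mwt n) (@measurable_fst _ _ R (path_space R S)).
  exact: measurableT_comp (measurable_indic mA) (@measurable_snd _ _ R (path_space R S)).
have f0 p : (0 <= f p)%E by rewrite mule_ge0// lee_fin.
have mF : measurable_fun setT (fun p : Omega * Aux => f (Delta psi p.1, O p.1)).
  apply: measurableT_comp mf _; apply/measurable_fun_pairP; split => /=.
    exact: measurableT_comp mpsi (@measurable_fst _ _ Omega Aux).
  exact: measurableT_comp mO (@measurable_fst _ _ Omega Aux).
transitivity (\int[Q \x nu]_p f (Delta psi p.1, O p.1))%E.
  apply: eq_integral => p _; rewrite /f !indicE.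
  have -> // : ((O p.1, statistic 0 p) \in A `*` [set: measurableTypeR R]) = (O p.1 \in A).
  by apply/idP/idP => /set_mem H; apply/mem_set => //; case: H.
apply: etrans (fubini_tonelli1 _ mF _) _ => //.
transitivity (\int[Q]_w f (Delta psi w, O w))%E.
  apply: eq_integral => w _.
  apply: etrans (@integral_cst _ Aux R nu setT measurableT (f (Delta psi w, O w))) _.
  by rewrite -[RHS]mule1; congr (_ * _)%E; exact: probability_setT.
rewrite (observation_indep Q Delta TT hDelta S psi 0 f psiT ST psiS mf f0).
transitivity (\int[Q]_w ((wt n (Delta psi w))%:E * PZ A))%E.
  apply: eq_integral => w _; rewrite /f/= ge0_integralZl ?lee_fin//.
  congr (_ * _)%E.
  transitivity (\int[Q]_w' (\1_(O @^-1` A) w')%:E)%E.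
    by apply: eq_integral => w' _; rewrite !indicE; congr ((nat_of_bool _)%:R%:E);
      apply/idP/idP => /set_mem H; apply/mem_set.
  rewrite integral_indic ?setIT//.
  by rewrite -[X in measurable X]setTI; exact: mO.
rewrite ge0_integralZr ?wt1 ?mul1e//.
- by apply/measurable_EFinP; exact: measurableT_comp (mwt n) mpsi.
- by move=> w _; rewrite lee_fin.
Qed.

(** One statement for both cases: b = 1 with flat weights when psi has positive norm, b = 0 with
    weight 1 otherwise. Risks at h are moved to the origin, where the joint laws [pi_] do not depend
    on h. *)
Lemma limit_rule : exists U : {mfun (path_space R S * measurableTypeR R)%type >-> R},
  forall (h : L2 P) (t : R) (lam_ : nat -> R -> \bar R) (lam : R -> \bar R)
      (r_ : nat -> \bar R) (r : \bar R),
    S h -> (forall n, bowl_shaped (lam_ n)) ->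
    (forall n, lower_semicontinuous (lam_ n)) ->
    (forall x m n, (m <= n)%N -> (lam_ m x <= lam_ n x)%E) ->
    (forall x, lam_ n x @[n --> \oo] --> lam x) ->
    measurable_fun setT lam -> (forall x, 0 <= lam x)%E ->
    (forall n, \int[Q \x nu]_p ((wt n (Delta psi p.1))%:E *
       lam_ n (rule (observation Delta h p.1, p.2) - b * Delta psi p.1 - t)%R) <= r_ n)%E ->
    r_ n @[n --> \oo] --> r ->
  (risk Q Delta lam (uniform_prob (@ltr01 R)) U h t <= r)%E.
Proof.
have [U HU] := randomized_rule_limit PZ pi_ marginal.
exists U => h t lam_ lam r_ r Sh hlam lsclam nd cvlam ml lam0 rle cvr.
have lam0_ n x : (0 <= lam_ n x)%E by have [] := hlam n.
pose hs : S := exist _ h (mem_set Sh).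
have hT : TT h by exact: ST.
(* The likelihood ratio of the shift by h. As h lies in S, it is a function of the coordinate [hs]
   of the restricted path; the form with 1 matches [observation_shift] at c = 1. *)
pose L (z : path_space R S) := expR (1 * z hs - 1 ^+ 2 * inner h h / 2).
have mL : measurable_fun setT L.
  apply: measurableT_comp => //; apply: measurable_funB => //.
  by apply: measurable_funM => //; exact: measurable_coordinate S hs.
have L0 z : 0 <= L z by exact: expR_ge0.
have LO w : L (O w) = expR (1 * Delta h w - 1 ^+ 2 * inner h h / 2).
  by rewrite /L /O /observation /= inner0 addr0.
have ->: risk Q Delta lam (uniform_prob (@ltr01 R)) U h t =
    (\int[PZ \x uniform_prob (@ltr01 R)]_p ((L p.1)%:E * lam (U p - t)%R))%E.
  pose F (p : Omega * measurableTypeR R) := lam (U (observation Delta h p.1, p.2) - t).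
  pose Phi (z : path_space R S * measurableTypeR R) : \bar R :=
    ((L z.1)%:E * lam (U z - t)%R)%E.
  have mF : measurable_fun setT F.
    apply: measurableT_comp ml _; apply: measurable_funB => //.
    apply: measurableT_comp => //; apply/measurable_fun_pairP; split => /=.
      exact: measurableT_comp (measurable_observation Q Delta TT hDelta S h ST)
        (@measurable_fst _ _ Omega (measurableTypeR R)).
    exact: (@measurable_snd _ _ Omega (measurableTypeR R)).
  have mU : measurable_fun setT (fun z => lam (U z - t)).
    by apply: measurableT_comp ml _; exact: measurable_funB.
  have mPhi : measurable_fun setT Phi.
    apply: emeasurable_funM => //; apply/measurable_EFinP.
    exact: measurableT_comp mL (@measurable_fst _ _ (path_space R S) (measurableTypeR R)).
  have F0 p : (0 <= F p)%E by exact: lam0.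
  have Phi0 z : (0 <= Phi z)%E by rewrite mule_ge0// lee_fin.
  apply: etrans (fubini_tonelli2 F mF F0) _.
  apply: etrans _ (esym (fubini_tonelli2 Phi mPhi Phi0)).
  apply: eq_integral => u _; rewrite /fubini_G.
  pose f (z : path_space R S) := lam (U (z, u) - t).
  have mf : measurable_fun setT f by apply: measurableT_comp mU _; exact: measurable_pair2.
  have f0 z : (0 <= f z)%E by exact: lam0.
  have := observation_shift Q Delta TT hDelta S 1 h 0 f hT ST mf f0.
  rewrite scale1r addr0 => shiftE; apply: etrans shiftE _.
  have mPhiu : measurable_fun setT (fun z => Phi (z, u)).
    by apply: (measurableT_comp mPhi); exact: measurable_pair2.
  apply: etrans _ (esym (integral_PZ (fun z => Phi (z, u)) mPhiu (fun z => Phi0 (z, u)))).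
  by apply: eq_integral => w _; rewrite /Phi /= -LO.
apply: (HU L t lam_ lam r_ r) => // n; apply: le_trans (rle n).
have mln := lower_semicontinuous_measurable (lsclam n).
rewrite integral_pi; last 2 first.
- apply: emeasurable_funM.
    apply/measurable_EFinP.
    exact: measurableT_comp mL (@measurable_fst _ _ (path_space R S) (measurableTypeR R)).
  apply: measurableT_comp mln _; exact: measurable_funB.
- by move=> p; rewrite mule_ge0// lee_fin.
rewrite le_eqVlt; apply/orP; left; apply/eqP.
pose F1 (p : Omega * Aux) : \bar R := ((wt n (Delta psi p.1))%:E *
  ((L (O p.1))%:E * lam_ n (statistic 0%R p - t)%R))%E.
pose F2 (p : Omega * Aux) : \bar R := ((wt n (Delta psi p.1))%:E *
  lam_ n (statistic h p - t)%R)%E.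
have mF1 : measurable_fun setT F1.
  apply: emeasurable_funM; first exact/measurable_EFinP.
  apply: emeasurable_funM; last by apply: measurableT_comp mln _; exact: measurable_funB.
  apply/measurable_EFinP; apply: measurableT_comp mL _.
  exact: measurableT_comp mO (@measurable_fst _ _ Omega Aux).
have mF2 : measurable_fun setT F2.
  apply: emeasurable_funM; first exact/measurable_EFinP.
  by apply: measurableT_comp mln _; exact: measurable_funB.
have F10 p : (0 <= F1 p)%E by rewrite !mule_ge0// lee_fin.
have F20 p : (0 <= F2 p)%E by rewrite mule_ge0// lee_fin.
apply: etrans (fubini_tonelli2 F1 mF1 F10) _.
apply: etrans _ (esym (fubini_tonelli2 F2 mF2 F20)).
apply: eq_integral => a _; rewrite /fubini_G.
(* Delta psi is read off the path as [z ps], which the shift by h leaves unchanged because h is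
   orthogonal to psi. The weight and the statistic therefore move together with the rule. *)
pose f (z : path_space R TT) : \bar R := ((wt n (z ps))%:E *
  lam_ n (rule (z, a) - b * z ps - t)%R)%E.
have mps : measurable_fun setT (fun z : path_space R TT => z ps).
  exact: measurable_coordinate TT ps.
have mf : measurable_fun setT f.
  apply: emeasurable_funM; first by apply/measurable_EFinP; exact: measurableT_comp (mwt n) mps.
  apply: measurableT_comp mln _; apply: measurable_funB => //; apply: measurable_funB.
    by apply: measurableT_comp => //; exact: measurable_pair2.
  exact: measurable_funM.
have f0 z : (0 <= f z)%E by rewrite mule_ge0// lee_fin.
have := observation_shift Q Delta TT hDelta TT 1 h 0 f hT (@subset_refl _ _) mf f0.
rewrite scale1r addr0 => shiftE.
transitivity (\int[Q]_w f (observation Delta h w))%E.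
  rewrite shiftE; apply: eq_integral => w _; rewrite /F1 /f /statistic /= LO.
  by rewrite /observation /= inner0 addr0 muleCA.
apply: eq_integral => w _; rewrite /F2 /f /statistic /=.
by rewrite /observation /= (innerC h) psiS// addr0.
Qed.


End LimitRule.

Section LowerBound.
Context {d : measure_display} {X : measurableType d} {R : realType}.
Context {P : probability X R}.
Context {d' : measure_display} {Omega : measurableType d'}.
Variables (Q : probability Omega R) (Delta : L2 P -> Omega -> R).
Variables (TT : set (L2 P)) (hDelta : isonormal Q Delta TT).
Context {da : measure_display} {Aux : measurableType da}.
Variables (nu : probability Aux R)
  (rule : {mfun (path_space R TT * Aux)%type >-> R}).
Variables (l : R -> \bar R) (hl : bowl_shaped l) (hlsc : lower_semicontinuous l).

Let l0 x : (0 <= l x)%E.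
Proof. by have [] := hl. Qed.

Let ml : measurable_fun setT l.
Proof. exact: lower_semicontinuous_measurable. Qed.

Lemma measurable_rule_observation (h : L2 P) :
  measurable_fun setT (fun p : Omega * Aux => rule (observation Delta h p.1, p.2)).
Proof.
apply: measurableT_comp => //; apply/measurable_fun_pairP; split => /=.
  exact: measurableT_comp (measurable_observation Q Delta TT hDelta TT h (@subset_refl _ _))
    (@measurable_fst _ _ Omega Aux).
exact: (@measurable_snd _ _ Omega Aux).
Qed.

Lemma risk_shift (c : R) (k h : L2 P) (t : R) : TT k ->
  risk Q Delta l nu rule (c *: k + h) t =
  (\int[Q \x nu]_p ((expR (c * Delta k p.1 - c ^+ 2 * inner k k / 2)%R)%:E *
     l (rule (observation Delta h p.1, p.2) - t)%R))%E.
Proof.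
move=> kT.
pose F (p : Omega * Aux) := l (rule (observation Delta (c *: k + h) p.1, p.2) - t).
pose G (p : Omega * Aux) : \bar R :=
  ((expR (c * Delta k p.1 - c ^+ 2 * inner k k / 2)%R)%:E *
     l (rule (observation Delta h p.1, p.2) - t)%R)%E.
have mD := isonormal_measurable Q Delta TT hDelta k kT.
have mF : measurable_fun setT F.
  apply: measurableT_comp ml _; apply: measurable_funB => //.
  exact: measurable_rule_observation.
have mG : measurable_fun setT G.
  apply: emeasurable_funM; last first.
    apply: measurableT_comp ml _; apply: measurable_funB => //.
    exact: measurable_rule_observation.
  apply/measurable_EFinP; apply: measurableT_comp => //; apply: measurable_funB => //.
  by apply: measurable_funM => //; exact: measurableT_comp mD (@measurable_fst _ _ Omega Aux).
have F0 p : (0 <= F p)%E by exact: l0.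
have G0 p : (0 <= G p)%E by rewrite mule_ge0// lee_fin expR_ge0.
apply: etrans (fubini_tonelli2 F mF F0) _.
apply: etrans _ (esym (fubini_tonelli2 G mG G0)).
apply: eq_integral => a _; rewrite /fubini_G.
pose f (z : path_space R TT) := l (rule (z, a) - t).
have mf : measurable_fun setT f.
  apply: measurableT_comp ml _; apply: measurable_funB => //.
  by apply: measurableT_comp => //; exact: measurable_pair2.
have f0 z : (0 <= f z)%E by exact: l0.
exact: (observation_shift Q Delta TT hDelta TT c k h f kT (@subset_refl _ _) mf f0).
Qed.

Variables (gamma : L2 P -> R) (psi : L2 P)
  (hpsi : riesz_representer gamma (core TT gamma) psi).
Local Notation S := (orthocomplement TT (core TT gamma)).
Local Notation V := (inner psi psi).

(** The risk bound is required only on the line h + c psi, along which the target moves by c V. The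
    rule U is chosen before h and t. *)
Lemma reduced_rule (r : R) : 0 <= r ->
  exists U : {mfun (path_space R S * measurableTypeR R)%type >-> R},
    forall (h : L2 P) (t : R), S h ->
      (forall c : R, (risk Q Delta l nu rule (c *: psi + h)%R (c * V + t)%R <= r%:E)%E) ->
    (risk Q Delta (smoothed_loss l V) (uniform_prob (@ltr01 R)) U h t <= r%:E)%E.
Proof.
move=> r0.
have [cpsi psiE] := hpsi.
have psiT : TT psi by exact: (core_sub TT gamma).
have psiS g : S g -> inner psi g = 0 by move=> [_ /(_ psi cpsi)]; rewrite innerC.
have ST : S `<=` TT by exact: orthocomplement_sub.
have mD := isonormal_measurable Q Delta TT hDelta psi psiT.
have V0 : 0 <= V by exact: inner_ge0.
have [Veq|Vneq] := eqVneq V 0.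
  have [] := limit_rule Q Delta TT hDelta S ST nu rule psi psiT psiS (fun _ _ => 1) 0.
  - by move=> n; exact: measurable_cst.
  - by [].
  - move=> n; apply: etrans (@integral_cst _ Omega R Q setT measurableT 1%E) _.
    by rewrite mul1e; exact: probability_setT.
  move=> U HU; exists U => h t Sh Hr; rewrite Veq smoothed_loss0//.
  apply: (HU h t (fun=> l) l (fun=> r%:E)) => //.
  - by move=> x; exact: cvg_cst.
  - move=> _; have := Hr 0; rewrite scale0r add0r mul0r add0r.
    apply: le_trans; rewrite le_eqVlt; apply/orP; left; apply/eqP.
    by apply: eq_integral => p _; rewrite mul1e mul0r subr0.
  - exact: cvg_cst.
have {V0 Vneq}V0 : 0 < V by rewrite lt_neqAle eq_sym Vneq.
(* The square makes n / M n at most 1/(n + 1), so the cost factor tends to 1 while the truncation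
   level n grows. *)
pose M (n : nat) : R := n.+1%:R ^+ 2.
have M0 n : 0 < M n by rewrite exprn_gt0.
have [] := limit_rule Q Delta TT hDelta S ST nu rule psi psiT psiS
  (fun n => flat_weight V (M n)) 1.
- by move=> n; exact: measurable_flat_weight.
- by move=> n x; exact: flat_weight_ge0.
- move=> n.
  rewrite (ge0_integral_gaussian_law Q (Delta psi) V (fun x => (flat_weight V (M n) x)%:E)).
  + exact: integral_flat_weight.
  + exact: isonormal_gaussian hDelta psi psiT.
  + by apply/measurable_EFinP; exact: measurable_flat_weight.
  + by move=> x; rewrite lee_fin; exact: flat_weight_ge0.
move=> U HU; exists U => h t Sh Hr.
apply: (HU h t (truncated_loss l V) _ (fun n => ((M n + n%:R) / M n)%:E * r%:E)%E) => //.
- by move=> n; exact: bowl_shaped_truncated_loss.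
- by move=> n; exact: lower_semicontinuous_truncated_loss.
- by move=> x m n mn; exact: truncated_loss_nondecreasing.
- by move=> x; exact: cvg_truncated_loss.
- apply: lower_semicontinuous_measurable.
  by apply: lower_semicontinuous_smoothed_loss => //; exact: ltW.
- by move=> x; apply: integral_ge0 => g _.
- move=> n.
  have mtl : measurable_fun setT (truncated_loss l V n).
    by apply: lower_semicontinuous_measurable; exact: lower_semicontinuous_truncated_loss.
  pose T (p : Omega * Aux) := rule (observation Delta h p.1, p.2) - t.
  have mT : measurable_fun setT T.
    by apply: measurable_funB => //; exact: measurable_rule_observation.
  have mG : measurable_fun setT (fun p : Omega * Aux => Delta psi p.1).
    exact: measurableT_comp mD (@measurable_fst _ _ Omega Aux).
  apply: le_trans (averaged_shift V (M n) V0 (M0 n) l ml l0 (Q \x nu)%E T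
    (fun p => Delta psi p.1) n r%:E mtl mT mG _).
    rewrite le_eqVlt; apply/orP; left; apply/eqP; apply: eq_integral => p _.
    by congr (_ * truncated_loss l V n _)%E; rewrite /T; ring.
  (* With c = s / V the target moves by s, and c Delta psi - c^2 V / 2 is the exponent s G / V - s^2
     / (2 V) of [averaged_shift]. *)
  move=> s; have := Hr (s / V); rewrite (risk_shift (s / V) psi h _ psiT).
  apply: le_trans; rewrite le_eqVlt; apply/orP; left; apply/eqP.
  have V1 := lt0r_neq0 V0.
  apply: eq_integral => p _; congr ((expR _)%:E * l _)%E.
    by field.
  by rewrite /T divfK//; ring.
- rewrite -[X in _ --> X]mul1e; apply: cvgeZr => //; apply: cvg_EFin; first exact: nearW.
  apply: (@squeeze_cvgr _ _ _ _ (fun=> 1) (fun n => 1 + n.+1%:R^-1)).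
  + apply: nearW => n /=; rewrite mulrDl divff ?gt_eqF//.
    rewrite lerDl divr_ge0 ?(ltW (M0 n))//= lerD2l ler_pdivrMr//.
    by rewrite /M expr2 mulKf// ler_nat.
  + exact: cvg_cst.
  + rewrite -[X in _ --> X]addr0; apply: cvgD; first exact: cvg_cst.
    exact: cvg_harmonic.
Qed.


End LowerBound.

Theorem theorem8 (R : realType) (d d' : measure_display)
  (X : measurableType d)
  (PP : set (probability X R)) (P : probability X R) (hP : PP P)
  (TT : set (L2 P)) (hT0 : mean_zero TT) (hT : linear_subspace TT)
  (Psi : probability X R -> R) (gamma : L2 P -> R)
  (hgamma : directional_derivative PP TT Psi gamma)
  (assumption1 : path_realization PP TT)
  (assumption2 : core TT gamma = additivity_space TT gamma)
  (psi : L2 P) (hpsi : riesz_representer gamma (core TT gamma) psi)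
  (Omega : measurableType d') (Q : probability Omega R)
  (Delta : L2 P -> Omega -> R) (hDelta : isonormal Q Delta TT)
  (l : R -> \bar R) (hl : bowl_shaped l) (hlsc : lower_semicontinuous l) :
  [/\ bowl_shaped (smoothed_loss l (inner psi psi)),
      lower_semicontinuous (smoothed_loss l (inner psi psi)),
      forall c : R, smoothed_loss (fun x : R => (x ^+ 2)%:E) (inner psi psi) c
        = (c ^+ 2 + inner psi psi)%:E &
      forall B : set (L2 P), B !=set0 ->
        B `<=` orthocomplement TT (core TT gamma) ->
        full_minimax_risk Q Delta TT gamma psi l B
        = reduced_minimax_risk Q Delta TT gamma psi l B].
Proof.
have V0 := inner_ge0 psi.
have slsc := lower_semicontinuous_smoothed_loss l hl hlsc _ V0.
split => //.
- exact: bowl_shaped_smoothed_loss.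
- by move=> c; exact: smoothed_square_loss.
move=> B [h0 Bh0] BS.
have [cpsi psiE] := hpsi.
have psiT : TT psi by exact: (core_sub TT gamma).
have core_orth k g : core TT gamma k -> orthocomplement TT (core TT gamma) g -> inner k g = 0.
  by move=> ck [_ /(_ k ck)]; rewrite innerC.
have ST : orthocomplement TT (core TT gamma) `<=` TT by exact: orthocomplement_sub.
have l0 x : (0 <= l x)%E by have [] := hl.
have ml := lower_semicontinuous_measurable hlsc.
have msl := lower_semicontinuous_measurable slsc.
apply/eqP; rewrite eq_le; apply/andP; split.
  apply: le_ereal_inf_tmp => _ [da [Aux [nu [rule ->]]]].
  have [rule' E] := shifted_rule_risk Q Delta TT hDelta _ ST nu l ml l0 rule psi psiT
    (fun g => core_orth psi g cpsi) msl.
  apply: (@le_trans _ _ (ereal_sup [set risk Q Delta l nu rule' (i.1 + i.2)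
      (inner psi i.1 + gamma i.2) | i in core TT gamma `*` B])).
    by apply: ereal_inf_lbound; exists da, Aux, nu, rule'.
  apply: ge_ereal_sup => _ [[k h] [/= ck Bh] <-].
  rewrite E; last 2 first.
  - by move=> g; exact: core_orth.
  - by apply: core_orth => //; exact: BS.
  by apply: ereal_sup_ubound; exists h.
apply: le_ereal_inf_tmp => _ [da [Aux [nu [rule ->]]]].
set r := ereal_sup _.
(* The multiples of psi belong to the core, so this line of parameters is part of the supremum. *)
have rge (c : R) h : B h ->
    (risk Q Delta l nu rule (c *: psi + h)%R (c * inner psi psi + gamma h)%R <= r)%E.
  move=> Bh; apply: ereal_sup_ubound; exists (c *: psi, h) => /=.
    by split => //=; exact: coreZ.
  congr (risk Q Delta l nu rule _ (_ + _)).
  by rewrite innerC -[c *: psi]addr0 inner_linear inner0 addr0.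
(* The point of B makes the supremum one over a nonempty set, so it is not -oo; the value +oo leaves
   nothing to prove. *)
have r0 : (0 <= r)%E.
  by apply: le_trans (rge 0 h0 Bh0); apply: integral_ge0 => p _; exact: l0.
case: r rge r0 => [r| |]//; last by move=> _ _; rewrite leey.
rewrite lee_fin => rge r0.
have [U HU] := reduced_rule Q Delta TT hDelta nu rule l hl hlsc gamma psi hpsi r r0.
apply: (@le_trans _ _ (ereal_sup [set risk Q Delta (smoothed_loss l (inner psi psi))
    (uniform_prob (@ltr01 R)) U (id i) (gamma i) | i in B])).
  by apply: ereal_inf_lbound; eexists _, _, (uniform_prob (@ltr01 R)), U.
apply: ge_ereal_sup => _ [h Bh <-]; apply: HU; first exact: BS.
by move=> c; exact: rge.
Qed.
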